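(* Let $K$ be an algebraically closed field of characteristic $p > 2$, let $G = \operatorname{SO}(V)$, where $V$ is a $K$-vector space with a non-degenerate quadratic form and $\dim V = n$ for some $n \geq 5$, and let $\mathfrak{g}$ be the Lie algebra of $G$. Let $e \in \mathfrak{g}$ be a nilpotent element whose Jordan normal form on $V$ has block sizes $d_1, \ldots, d_t$ (counted with multiplicity), where $t \geq 1$ and $d_r \geq 1$ for all $1 \leq r \leq t$. Set $\alpha = \nu_p(\gcd(d_1, \ldots, d_t))$. Let $e_0$ be the action of $e$ on the symmetric square $S^2(V)$, and let $e_0''$ be the action of $e$ on $L_G(2\varpi_1)$. Then the Jordan block sizes of $e_0''$ are determined from those of $e_0$ as follows: (iii) If $p \nmid n$, then $r_1(e_0'') = r_1(e_0) - 1$ and $r_m(e_0'') = r_m(e_0)$ for all $m \neq 1$. (iv) If $p \mid n$ and $\alpha = 0$, then $r_1(e_0'') = r_1(e_0) - 2$ and $r_m(e_0'') = r_m(e_0)$ for all $m \neq 1$. (v) If $p \mid n$ and $\alpha > 0$, then $r_{p^{\alpha}}(e_0'') = r_{p^{\alpha}}(e_0) - 2$, $r_{p^{\alpha}-1}(e_0'') = 2$, and $r_m(e_0'') = r_m(e_0)$ for all $m \neq p^{\alpha}, p^{\alpha}-1$.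
   Context: For a nilpotent linear map $f$, $r_m(f)$ is the number of Jordan blocks of size $m$ in the Jordan normal form of $f$ ($m \geq 1$). $\nu_p(a)$ is the largest integer $k \geq 0$ such that $p^k$ divides $a$. $L_G(\lambda)$ denotes the rational irreducible $G$-module of highest weight $\lambda$ (with respect to a fixed maximal torus and base of the root system), and $\varpi_i$ is the $i$-th fundamental dominant weight in the standard Bourbaki labelling; so $V = L_G(\varpi_1)$ is the natural module, and $L_G(2\varpi_1)$ is a composition factor of $S^2(V)$. An element $e \in \mathfrak{g}$ acts on a rational $G$-module given by $f: G \to \operatorname{GL}(W)$ via the differential $\mathrm{d} f(e)$. The element $e$ is nilpotent if $\mathrm{d} f(e)$ is nilpotent for every rational representation $f$. *)

(* Defs.v *)
From HB Require Import structures.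
From mathcomp Require Import all_boot all_order all_algebra.
From mathcomp Require Import ring mpoly.

Set Implicit Arguments.
Unset Strict Implicit.
Unset Printing Implicit Defensive.

Import GRing.Theory.
Local Open Scope ring_scope.

(* Vectors are columns, and matrices act on them from the left. *)

Section Jordan.

Variable K : fieldType.

Definition nilpotent_mx N (A : 'M[K]_N) : Prop := exists k : nat, A ^+ k = 0.

Definition jordan_block (d : nat) : 'M[K]_d := \matrix_(i, j) (i.+1 == j)%:R.

Definition jordan_mx (s : seq nat) : 'M[K]_(\sum_(i < size s) nth 0%N s i) :=
  \mxdiag_(i < size s) jordan_block (nth 0%N s i).

(* The nilpotent matrix A is similar to the Jordan matrix with block sizes s.
   P and Q are written as rectangular matrices, because N and the sum of the
   sizes are only propositionally equal. *)
Definition jordan_sizes N (A : 'M[K]_N) (s : seq nat) : Prop :=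
  all (leq 1) s /\
  exists P : 'M[K]_(N, \sum_(i < size s) nth 0%N s i),
  exists Q : 'M[K]_(\sum_(i < size s) nth 0%N s i, N),
    [/\ P *m Q = 1%:M, Q *m P = 1%:M & A = P *m jordan_mx s *m Q].

End Jordan.

Section AlgebraicGroups.

Variables (K : fieldType) (n : nat).

(* Polynomial functions of the n * n entries of a matrix. *)
Definition mxfun := {mpoly K[n * n]}.

Definition mxeval (F : mxfun) (g : 'M[K]_n) : K := F.@[fun k => mxvec g 0 k].

(* Derivative of F at the identity matrix in the direction X. *)
Definition mxderiv1 (F : mxfun) (X : 'M[K]_n) : K :=
  \sum_(k < n * n) (F^`M(k)).@[fun k => mxvec (1%:M : 'M[K]_n) 0 k]
                   * mxvec X 0 k.

(* Tangent space at the identity of a closed subgroup G of GL_n. *)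
Definition lie_algebra (G : 'M[K]_n -> Prop) (X : 'M[K]_n) : Prop :=
  forall F : mxfun, (forall g, G g -> mxeval F g = 0) -> mxderiv1 F X = 0.

(* For G closed in SL_n, the regular functions on G are the restrictions of
   polynomials in the matrix entries (det^-1 is not needed). A rational
   representation on K^N is recorded with polynomials for its matrix
   coefficients; for X in the Lie algebra of G, the differential does not
   depend on the choice of these polynomials. *)
Record ratrep (G : 'M[K]_n -> Prop) (N : nat) := RatRep {
  rep_coef : 'I_N -> 'I_N -> mxfun;
  rep_act : 'M[K]_n -> 'M[K]_N :=
    fun g => \matrix_(i, j) mxeval (rep_coef i j) g;
  rep_act1 : rep_act 1%:M = 1%:M;
  rep_actM : forall g h, G g -> G h -> rep_act (g *m h) = rep_act g *m rep_act h
}.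

Definition rep_diff G N (rho : ratrep G N) (X : 'M[K]_n) : 'M[K]_N :=
  \matrix_(i, j) mxderiv1 (rep_coef rho i j) X.

Definition irreducible_rep G N (rho : ratrep G N) : Prop :=
  (0 < N)%N /\
  forall U : {vspace 'cV[K]_N},
    (forall g v, G g -> v \in U -> rep_act rho g *m v \in U) ->
    U = 0%VS \/ U = fullv.

Definition nilpotent_elt (G : 'M[K]_n -> Prop) (e : 'M[K]_n) : Prop :=
  forall (N : nat) (rho : ratrep G N), nilpotent_mx (rep_diff rho e).

End AlgebraicGroups.

Section SymmetricSquare.

Variable n : nat.

(* With v_0, ..., v_(n-1) the standard basis of K^n, the monomials v_i v_j with
   i <= j form a basis of the symmetric square. *)
Definition monom2 := {q : 'I_n * 'I_n | (q.1 <= q.2)%N}.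

Lemma sort_ord_proof (p : 'I_n * 'I_n) :
  let q := if (p.1 <= p.2)%N then p else (p.2, p.1) in (q.1 <= q.2)%N.
Proof. by case: leqP => //= /ltnW. Qed.

(* The basis monomial equal to v_(p.1) v_(p.2). *)
Definition sort_ord (p : 'I_n * 'I_n) : monom2 :=
  exist (fun q : 'I_n * 'I_n => (q.1 <= q.2)%N) _ (sort_ord_proof p).

(* The entry in row i and column j, for i and j the positions of the monomials
   r and q, is the coefficient of r in (A v_(q.1)) (A v_(q.2)). *)
Definition sym2_mx (R : comNzRingType) (A : 'M[R]_n) : 'M[R]_#|{: monom2}| :=
  \matrix_(i, j)
    \sum_(p : 'I_n * 'I_n | sort_ord p == enum_val i)
      A p.1 (val (enum_val j)).1 * A p.2 (val (enum_val j)).2.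

Lemma sort_ord_swap p : sort_ord (p.2, p.1) = sort_ord p.
Proof.
case: p => a b; apply: val_inj => /=.
by case: ltngtP => //= /val_inj ->.
Qed.

Lemma sort_ordK (q : monom2) : sort_ord (val q) = q.
Proof. by apply: val_inj; rewrite /= (valP q). Qed.

Lemma sym2_sum_sort (R : comNzRingType) (A : 'M[R]_n) (r : monom2) p :
  \sum_(q | sort_ord q == r)
    A q.1 (val (sort_ord p)).1 * A q.2 (val (sort_ord p)).2 =
  \sum_(q | sort_ord q == r) A q.1 p.1 * A q.2 p.2.
Proof.
rewrite /=; case: leqP => //= _.
have swapK : involutive (fun q : 'I_n * 'I_n => (q.2, q.1)) by case.
rewrite (reindex_inj (inv_inj swapK)); apply: eq_big => [q | q _].
  by rewrite sort_ord_swap.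
by rewrite mulrC.
Qed.

Lemma sym2_mx1 (R : comNzRingType) : sym2_mx (1%:M : 'M[R]_n) = 1%:M.
Proof.
apply/matrixP => i j; rewrite !mxE.
transitivity (\sum_(p | (sort_ord p == enum_val i) && (p == val (enum_val j)))
                 (1 : R)).
  rewrite [RHS]big_mkcondr; apply: eq_bigr => p _; rewrite !mxE.
  case: p (val _) => [a b] [c d]; rewrite xpair_eqE /= -natrM mulnb.
  by case: (_ && _).
case: (i =P j) => [-> | neq_ij].
  rewrite (eq_bigl (pred1 (val (enum_val j)))) ?big_pred1_eq // => p /=.
  by case: (p =P val (enum_val j)) => [-> | _]; rewrite ?andbF // sort_ordK eqxx.
rewrite big_pred0 // => p; apply/andP => -[/eqP eq_p /eqP def_p].
by apply: neq_ij; apply: enum_val_inj; rewrite -eq_p def_p sort_ordK.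
Qed.

Lemma sym2_mxM (R : comNzRingType) (A B : 'M[R]_n) :
  sym2_mx (A *m B) = sym2_mx A *m sym2_mx B.
Proof.
apply/matrixP => i j; rewrite !mxE; set s := val (enum_val j).
transitivity (\sum_(q : 'I_n * 'I_n)
    (\sum_(p | sort_ord p == enum_val i) A p.1 q.1 * A p.2 q.2)
      * (B q.1 s.1 * B q.2 s.2)); last first.
  rewrite (partition_big (enum_rank \o sort_ord) predT) //=.
  apply: eq_bigr => k _; rewrite !mxE mulr_sumr.
  apply: eq_big => [q | q /eqP <-].
    by rewrite -(inj_eq enum_val_inj) enum_rankK.
  by rewrite enum_rankK sym2_sum_sort.
under [RHS]eq_bigr do rewrite mulr_suml.
rewrite exchange_big /=; apply: eq_bigr => p _; rewrite !mxE mulr_suml.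
under [LHS]eq_bigr do rewrite mulr_sumr.
rewrite pair_big /=; apply: eq_bigr => q _; ring.
Qed.

Lemma map_sym2_mx (R S : comNzRingType) (f : {rmorphism R -> S}) (A : 'M[R]_n) :
  map_mx f (sym2_mx A) = sym2_mx (map_mx f A).
Proof.
apply/matrixP => i j; rewrite !mxE rmorph_sum.
by apply: eq_bigr => p _; rewrite rmorphM !mxE.
Qed.

Variable K : fieldType.

Definition generic_mx : 'M[mxfun K n]_n :=
  \matrix_(i, j) 'X_(mxvec_index i j).

Lemma eval_sym2 (g : 'M[K]_n) :
  \matrix_(i, j) mxeval (sym2_mx generic_mx i j) g = sym2_mx g.
Proof.
pose ev : {rmorphism mxfun K n -> K} := meval (fun k => mxvec g 0 k).
have -> : \matrix_(i, j) mxeval (sym2_mx generic_mx i j) g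
          = map_mx ev (sym2_mx generic_mx).
  by apply/matrixP => i j; rewrite !mxE.
rewrite map_sym2_mx; congr sym2_mx; apply/matrixP => i j.
by rewrite !mxE /= mevalXU mxvecE.
Qed.

Lemma eval_sym2_1 :
  \matrix_(i, j) mxeval (sym2_mx generic_mx i j) 1%:M = 1%:M :> 'M[K]_#|{: monom2}|.
Proof. by rewrite eval_sym2 sym2_mx1. Qed.

Lemma eval_sym2_M (G : 'M[K]_n -> Prop) g h : G g -> G h ->
  \matrix_(i, j) mxeval (sym2_mx generic_mx i j) (g *m h) =
  (\matrix_(i, j) mxeval (sym2_mx generic_mx i j) g) *m
  (\matrix_(i, j) mxeval (sym2_mx generic_mx i j) h) :> 'M[K]_#|{: monom2}|.
Proof. by rewrite !eval_sym2 sym2_mxM. Qed.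

Definition sym2_rep (G : 'M[K]_n -> Prop) : ratrep G #|{: monom2}| :=
  RatRep eval_sym2_1 (@eval_sym2_M G).

End SymmetricSquare.

Section QuadraticForms.

Variables (K : fieldType) (n : nat).

Implicit Type Q : 'cV[K]_n -> K.

Definition polar Q (x y : 'cV[K]_n) : K := Q (x + y) - Q x - Q y.

Definition quadratic_form Q : Prop :=
  [/\ forall a x, Q (a *: x) = a ^+ 2 * Q x,
      forall a x y z, polar Q (a *: x + y) z = a * polar Q x z + polar Q y z
    & forall a x y z, polar Q z (a *: x + y) = a * polar Q z x + polar Q z y].

(* The usual notion in characteristic not 2 (in characteristic 2 it would
   exclude odd n). *)
Definition nondegenerate_form Q : Prop :=
  forall x, (forall y, polar Q x y = 0) -> x = 0.

Definition SO Q (g : 'M[K]_n) : Prop :=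
  (forall x, Q (g *m x) = Q x) /\ \det g = 1.

End QuadraticForms.

Section Weights.

Variables (K : fieldType) (n : nat).

(* The columns w_0, ..., w_(n-1) of P form a basis in which the polar form is
   antidiagonal, with w_i dual to w_(n-1-i). Over an algebraically closed field
   of characteristic not 2, every nondegenerate form has such a basis. *)
Definition witt_basis (Q : 'cV[K]_n -> K) (P : 'M[K]_n) : Prop :=
  forall i j : 'I_n, polar Q (col i P) (col j P) = (i + j == n.-1)%N%:R.

(* The maximal torus of SO(Q) acting on w_i by t_i and on w_(n-1-i) by t_i^-1,
   for i < n/2, and fixing the middle vector when n is odd. *)
Definition torus_coord (t : 'I_n./2 -> K) (i : nat) : K :=
  if insub i is Some k then t k
  else if insub (n.-1 - i)%N is Some k then (t k)^-1
  else 1.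

Definition torus (P : 'M[K]_n) (t : 'I_n./2 -> K) : 'M[K]_n :=
  P *m diag_mx (\row_i torus_coord t i) *m invmx P.

(* The row lambda stands for the character \sum_i lambda_i eps_i, where eps_i
   maps the element of the torus with parameter t to t_i. *)
Definition weight := 'rV[int]_n./2.

Definition weight_val (lambda : weight) (t : 'I_n./2 -> K) : K :=
  \prod_i t i ^ lambda 0 i.

Definition is_weight (P : 'M[K]_n) (G : 'M[K]_n -> Prop) N (rho : ratrep G N)
    (mu : weight) : Prop :=
  exists2 v : 'cV[K]_N, v != 0 &
    forall t : 'I_n./2 -> K, (forall i, t i != 0) ->
      rep_act rho (torus P t) *m v = weight_val mu t *: v.

(* Base of the root system in Bourbaki's labelling, with indices shifted by
   one. With l = n/2, all but the last root are eps_i - eps_(i+1); the last one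
   is eps_l in type B_l (n odd) and eps_(l-1) + eps_l in type D_l (n even). *)
Definition simple_root (i : 'I_n./2) : weight :=
  \row_j (if (i.+1 < n./2)%N then (j == i)%:R - (j == i.+1 :> nat)%:R
          else if odd n then (j == i)%:R
          else (j == i)%:R + (j.+1 == i :> nat)%:R).

Definition wdot (x y : weight) : int := \sum_i x 0 i * y 0 i.

(* varpi is the k-th fundamental dominant weight, counting from 1:
   2 (varpi, alpha_j) / (alpha_j, alpha_j) is 1 if j = k and 0 otherwise. *)
Definition fundamental_weight (k : nat) (varpi : weight) : Prop :=
  forall j : 'I_n./2,
    2 * wdot varpi (simple_root j) =
    if j.+1 == k then wdot (simple_root j) (simple_root j) else 0.

Definition weight_le (mu lambda : weight) : Prop :=
  exists c : 'I_n./2 -> nat, lambda - mu = \sum_i simple_root i *+ c i.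

Definition highest_weight (P : 'M[K]_n) (G : 'M[K]_n -> Prop) N
    (rho : ratrep G N) (lambda : weight) : Prop :=
  is_weight P rho lambda /\ forall mu, is_weight P rho mu -> weight_le mu lambda.

(* rho is a model of L_G(lambda) *)
Definition is_L (P : 'M[K]_n) (G : 'M[K]_n -> Prop) N (rho : ratrep G N)
    (lambda : weight) : Prop :=
  irreducible_rep rho /\ highest_weight P rho lambda.

End Weights.

(* Main.v *)
Require Import Defs.
From HB Require Import structures.
From mathcomp Require Import all_boot all_order all_algebra.
From mathcomp Require Import mpoly.
From mathcomp Require Import ring zify.
From Stdlib Require Import Classical.

Set Implicit Arguments.
Unset Strict Implicit.
Unset Printing Implicit Defensive.

Import GRing.Theory.
Local Open Scope ring_scope.

(** Let J be the Gram matrix of the polar form. Since p > 2, S^2(V) is the space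
    S of symmetric matrices Y, on which e acts by E : Y |-> eY + Y e^T; right
    multiplication by J identifies S with the self-adjoint endomorphisms of V
    and E with ad e. Let S0 be the hyperplane tr(YJ) = 0.

    If phi and v are suitable vectors of L^* and L, then
    phi(g v) = (coefficient of w_0 in g w_0)^2 for all g in SO(Q): on the big
    cell because v is a highest weight vector, and everywhere by density. As L
    is irreducible, this coefficient determines it, and comparison with the
    matrices (g w_0)(g w_0)^T, which span S0, shows that L is
    S0 / (S0 :&: K J^-1). Therefore
    rank(e''^k) = dim E^k S0 - [J^-1 in E^k S0].

    If p does not divide n, then S is the direct sum of S0 and K J^-1. Suppose
    that p divides n and let q = p^alpha. The divided derivatives D_c, c < q, of
    K[x] act on V because q divides all d_r, and ad e (D_c) = D_(c-1). Hence
    E^(q-1) maps the symmetric part of D_(q-1) J^-1, which is in S0, to J^-1.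
    Moreover a block with p^(alpha+1) not dividing d_r gives a matrix B in S
    with E^q B = 0 and tr(BJ) <> 0. As E is skew for the form tr(XJYJ), it
    follows that rank(e''^k) is rank(e_0^k) - 2 for k < q and rank(e_0^k) for
    k >= q. The operators D_c also show that e_0 has no block of size less than
    q, and the second differences of the ranks count the blocks. *)
(** * Polynomial functions of one variable *)

(** [L] is an abstract irreducible representation, with no given map to or from the symmetric
    square, and [e] is known only through the polynomials that vanish on SO(Q). This is why the
    comparison rests on one matrix coefficient: it is a function on the group, determined by its
    values on a dense cell. The span of the pairs ((g w_0)(g w_0)^T, g v) then serves as the graph
    of the missing map. Its properties are linear statements tested on generators, and it is stable
    under [e] because a linear form evaluated along the orbit is a polynomial on the group.

    The two units of rank lost when p divides n are dual to each other. For the form tr(XJYJ),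
    tr(YJ) is the pairing of Y with J^-1; so it vanishes on ker E^k exactly when J^-1 lies in E^k S.
    The first property costs one dimension from S to S0, the second one from S0 to L. Both hold for
    k < q and fail from q on, so the difference of the ranks is a step function, and its second
    difference is concentrated at q - 1 and q. *)

Section PolyFun.

Variable K : fieldType.

(** Extensional, so that determinants, matrix products and evaluations can be recognized as
    polynomial in [s] without exhibiting the polynomial. *)
Definition poly_fun (f : K -> K) : Prop := exists p : {poly K}, f =1 horner p.

Lemma eq_poly_fun f g : f =1 g -> poly_fun f -> poly_fun g.
Proof. by move=> fg [p fp]; exists p => s; rewrite -fg. Qed.

Lemma poly_fun_cst c : poly_fun (fun=> c).
Proof. by exists c%:P => s; rewrite hornerC. Qed.

Lemma poly_fun_id : poly_fun id.
Proof. by exists 'X => s; rewrite hornerX. Qed.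

Lemma poly_funD f g : poly_fun f -> poly_fun g -> poly_fun (fun s => f s + g s).
Proof. by move=> [p fp] [q gq]; exists (p + q) => s; rewrite hornerD -fp -gq. Qed.

Lemma poly_funM f g : poly_fun f -> poly_fun g -> poly_fun (fun s => f s * g s).
Proof. by move=> [p fp] [q gq]; exists (p * q) => s; rewrite hornerM -fp -gq. Qed.

Lemma poly_funN f : poly_fun f -> poly_fun (fun s => - f s).
Proof. by move=> [p fp]; exists (- p) => s; rewrite hornerN -fp. Qed.

Lemma poly_funB f g : poly_fun f -> poly_fun g -> poly_fun (fun s => f s - g s).
Proof. by move=> hf hg; apply: poly_funD => //; apply: poly_funN. Qed.

Lemma poly_funX f k : poly_fun f -> poly_fun (fun s => f s ^+ k).
Proof. by move=> [p fp]; exists (p ^+ k) => s; rewrite horner_exp -fp. Qed.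

Lemma poly_fun_sum (I : Type) (r : seq I) (P : pred I) (f : I -> K -> K) :
  (forall i, poly_fun (f i)) -> poly_fun (fun s => \sum_(i <- r | P i) f i s).
Proof.
move=> hf; elim: r => [|i r IH].
  by apply: eq_poly_fun (poly_fun_cst 0) => s; rewrite big_nil.
apply: (@eq_poly_fun (fun s => (if P i then f i s else 0) +
                               \sum_(i <- r | P i) f i s)).
  by move=> s; rewrite big_cons; case: (P i); rewrite ?add0r.
by apply: poly_funD => //; case: (P i); [exact: hf | exact: poly_fun_cst].
Qed.

Lemma poly_fun_prod (I : Type) (r : seq I) (P : pred I) (f : I -> K -> K) :
  (forall i, poly_fun (f i)) -> poly_fun (fun s => \prod_(i <- r | P i) f i s).
Proof.
move=> hf; elim: r => [|i r IH].
  by apply: eq_poly_fun (poly_fun_cst 1) => s; rewrite big_nil.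
apply: (@eq_poly_fun (fun s => (if P i then f i s else 1) *
                               \prod_(i <- r | P i) f i s)).
  by move=> s; rewrite big_cons; case: (P i); rewrite ?mul1r.
by apply: poly_funM => //; case: (P i); [exact: hf | exact: poly_fun_cst].
Qed.

Definition poly_mx m n (A : K -> 'M[K]_(m, n)) : Prop :=
  forall i j, poly_fun (fun s => A s i j).

Lemma poly_mx_cst m n (A : 'M[K]_(m, n)) : poly_mx (fun=> A).
Proof. by move=> i j; apply: poly_fun_cst. Qed.

Lemma poly_mxD m n (A B : K -> 'M[K]_(m, n)) :
  poly_mx A -> poly_mx B -> poly_mx (fun s => A s + B s).
Proof.
move=> hA hB i j; apply: eq_poly_fun (poly_funD (hA i j) (hB i j)) => s.
by rewrite mxE.
Qed.

Lemma poly_mxZ m n f (A : K -> 'M[K]_(m, n)) :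
  poly_fun f -> poly_mx A -> poly_mx (fun s => f s *: A s).
Proof.
move=> hf hA i j; apply: eq_poly_fun (poly_funM hf (hA i j)) => s.
by rewrite mxE.
Qed.

Lemma poly_mxN m n (A : K -> 'M[K]_(m, n)) :
  poly_mx A -> poly_mx (fun s => - A s).
Proof.
by move=> hA i j; apply: eq_poly_fun (poly_funN (hA i j)) => s; rewrite mxE.
Qed.

Lemma poly_mxM m n k (A : K -> 'M[K]_(m, n)) (B : K -> 'M[K]_(n, k)) :
  poly_mx A -> poly_mx B -> poly_mx (fun s => A s *m B s).
Proof.
move=> hA hB i j.
apply: (@eq_poly_fun (fun s => \sum_l A s i l * B s l j)).
  by move=> s; rewrite mxE.
by apply: poly_fun_sum => l; apply: poly_funM.
Qed.

Lemma poly_mx_tr m n (A : K -> 'M[K]_(m, n)) :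
  poly_mx A -> poly_mx (fun s => (A s)^T).
Proof.
by move=> hA i j; apply: eq_poly_fun (hA j i) => s; rewrite mxE.
Qed.

Lemma poly_fun_det n (A : K -> 'M[K]_n) :
  poly_mx A -> poly_fun (fun s => \det (A s)).
Proof.
move=> hA; apply: poly_fun_sum => sg; apply: poly_funM.
  exact: poly_fun_cst.
by apply: poly_fun_prod => i; apply: hA.
Qed.

(** Denominators are cleared monomial by monomial: degree k in the entries of [h^-1 A] uses up
    [h ^+ k], and the remaining [h ^+ (D - k)] makes the exponent uniform although [F] is not
    homogeneous. *)
Lemma mxeval_scaled n (F : mxfun K n) (D : nat) (h : K -> K) (A : K -> 'M[K]_n) :
    (msize F <= D)%N -> poly_fun h -> poly_mx A ->
  exists2 f, poly_fun f &
    forall s, h s != 0 -> h s ^+ D * mxeval F ((h s)^-1 *: A s) = f s.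
Proof.
move=> leFD hh hA.
exists (fun s => \sum_(m <- msupp F)
   F@_m * (h s ^+ (D - mdeg m) * \prod_k (mxvec (A s) 0 k) ^+ m k)).
  apply: poly_fun_sum => m; apply: poly_funM; first exact: poly_fun_cst.
  apply: poly_funM; first exact: poly_funX.
  apply: poly_fun_prod => k; apply: poly_funX.
  case/mxvec_indexP: k => i j.
  by apply: eq_poly_fun (hA i j) => s; rewrite mxvecE.
move=> s hs; rewrite /mxeval mevalE mulr_sumr !big_seq.
apply: eq_bigr => m mF.
have lemD : (mdeg m <= D)%N by apply: leq_trans leFD; apply/ltnW/msize_mdeg_lt.
rewrite mulrCA; congr (_ * _).
under eq_bigr do rewrite linearZ /= mxE exprMn.
rewrite big_split /= prodrXr -mdegE mulrA; congr (_ * _).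
by rewrite exprVn -{1}(subnK lemD) exprD mulfK // expf_neq0.
Qed.

Lemma poly_fun_mxeval n (F : mxfun K n) (A : K -> 'M[K]_n) :
  poly_mx A -> poly_fun (fun s => mxeval F (A s)).
Proof.
move=> hA.
have [f hf fE] := mxeval_scaled (leqnn (msize F)) (poly_fun_cst 1) hA.
apply: eq_poly_fun hf => s; have := fE s (oner_neq0 _).
by rewrite expr1n mul1r invr1 scale1r => ->.
Qed.

Definition infinite_field : Prop := forall p : {poly K}, (forall s, p.[s] = 0) -> p = 0.

Hypothesis infK : infinite_field.

Lemma poly_fun_generic f h a :
    poly_fun f -> poly_fun h -> h a != 0 -> (forall s, h s != 0 -> f s = 0) ->
  forall s, f s = 0.
Proof.
move=> [p fp] [q hq] ha h0 s.
have /eqP : p * q = 0.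
  apply: infK => x; rewrite hornerM -fp -hq.
  by have [->|/h0->] := eqVneq (h x) 0; rewrite ?mulr0 ?mul0r.
rewrite mulf_eq0 => /orP[] /eqP e0; first by rewrite fp e0 horner0.
by move: ha; rewrite hq e0 horner0 eqxx.
Qed.

Lemma eq_poly_fun_nz f g : poly_fun f -> poly_fun g ->
  (forall s, s != 0 -> f s = g s) -> f =1 g.
Proof.
move=> hf hg fg s; apply/eqP; rewrite -subr_eq0; apply/eqP.
apply: (@poly_fun_generic (fun s => f s - g s) id 1) => //.
- exact: poly_funB.
- exact: poly_fun_id.
- exact: oner_neq0.
by move=> x /fg->; rewrite subrr.
Qed.

(** A regular function on the projective line is constant: with [m] the degree of [q], the product
    [p * 'X^m] is the reversed polynomial of [q], whose degree is at most [m]. *)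
Lemma poly_fun_inv_const f g : poly_fun f -> poly_fun g ->
  (forall s, s != 0 -> f s = g s^-1) -> forall s, f s = f 0.
Proof.
move=> [p fp] [q gq] fg.
pose m := (size q).-1.
pose r := \poly_(i < m.+1) q`_(m - i).
have qr s : s != 0 -> s ^+ m * q.[s^-1] = r.[s].
  move=> s0; rewrite (@horner_coef_wide _ m.+1); last by rewrite /m; case: (size q).
  rewrite horner_poly mulr_sumr (reindex_inj rev_ord_inj) /=.
  apply: eq_bigr => i _; rewrite subSS mulrCA; congr (_ * _).
  have lem : (i <= m)%N by rewrite -ltnS.
  by rewrite exprVn -{1}(subnKC lem) exprD mulfK // expf_neq0.
have pr : p * 'X^m = r.
  apply/eqP; rewrite -subr_eq0; apply/eqP/infK.
  move=> s; rewrite -[LHS]/((p * 'X^m - r).[s]).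
  apply: (@poly_fun_generic (fun s => (p * 'X^m - r).[s]) id 1) => //.
  - by exists (p * 'X^m - r).
  - exact: poly_fun_id.
  - exact: oner_neq0.
  move=> x x0; rewrite hornerD hornerN hornerM hornerXn -qr // -fp -gq -fg //.
  by rewrite mulrC subrr.
have : (size p <= 1)%N.
  have [->|p0] := eqVneq p 0; first by rewrite size_poly0.
  have := size_poly m.+1 (fun i => q`_(m - i)); rewrite -/r -pr.
  by rewrite size_mulXn // -[m.+1]addn1 leq_add2l.
by move=> /size1_polyC pE s; rewrite !fp pE !hornerC.
Qed.


Lemma poly5_eq0 (a b c d e : K) :
    (forall s, a + b * s + c * s ^+ 2 + d * s ^+ 3 + e * s ^+ 4 = 0) ->
  [/\ a = 0, b = 0, c = 0, d = 0 & e = 0].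
Proof.
move=> h; pose p := Poly [:: a; b; c; d; e].
have p0 : p = 0.
  apply: infK => s; rewrite horner_Poly /=; apply: etrans (h s); ring.
have E k : [:: a; b; c; d; e]`_k = 0 by rewrite -(coef_Poly _ k) -/p p0 coef0.
by split; [exact: (E 0)|exact: (E 1)|exact: (E 2)|exact: (E 3)|exact: (E 4)].
Qed.

End PolyFun.

(** If a nonzero [p] vanished everywhere, [p + 1] would have positive degree, hence a root, although
    its value is always 1. *)
Lemma closed_infinite (K : closedFieldType) : infinite_field K.
Proof.
move=> p p0; apply/eqP/negPn/negP => pn0.
have szp : (1 < size p)%N.
  rewrite ltnNge; apply/negP => /size1_polyC pE.
  by move: pn0 (p0 0); rewrite pE hornerC polyC_eq0 => /eqP.
have /closed_rootP[x] : size (p + 1) != 1.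
  by rewrite size_polyDl ?size_poly1 // neq_ltn szp orbT.
rewrite /root hornerD p0 hornerC add0r; exact/negP/oner_neq0.
Qed.

(** The two Schur complements of one block matrix have the same determinant. *)
Lemma det_1B_rank1 (R : comNzRingType) n (u : 'cV[R]_n) (v : 'rV[R]_n) :
  \det (1%:M - u *m v) = 1 - (v *m u) 0 0.
Proof.
pose L := block_mx 1%:M 0 v 1%:M : 'M[R]_(n + 1).
have e1 : block_mx 1%:M u v 1%:M = L *m block_mx 1%:M u 0 (1%:M - v *m u).
  by rewrite mulmx_block !mul1mx !mul0mx !addr0 mulmx1 addrC subrK.
have e2 : block_mx 1%:M u v 1%:M = block_mx (1%:M - u *m v) u 0 1%:M *m L.
  by rewrite mulmx_block !mulmx1 !mul1mx !mulmx0 !add0r subrK.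
have := congr1 determinant e1; rewrite e2 !det_mulmx !det_lblock !det_ublock.
by rewrite !det1 !mulr1 !mul1r => ->; rewrite det_mx11 !mxE eqxx.
Qed.

Lemma lin_fun_cVE (K : fieldType) n (f : 'cV[K]_n -> K) :
    (forall a x y, f (a *: x + y) = a * f x + f y) ->
  forall x, f x = \sum_i x i 0 * f (delta_mx i 0).
Proof.
move=> fl x.
have f0 : f 0 = 0.
  have := fl 1 0 0; rewrite scaler0 addr0 mul1r => /eqP.
  by rewrite -{1}[f 0]addr0 (inj_eq (addrI _)) eq_sym => /eqP.
have fD : {morph f : x y / x + y} by move=> u v; rewrite -[u]scale1r fl mul1r scale1r.
rewrite {1}[x]matrix_sum_delta (big_morph f fD f0); apply: eq_bigr => i _.
by rewrite big_ord1 -[_ *: _]addr0 fl f0 addr0.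
Qed.

Lemma mx_deltaE (R : pzSemiRingType) n m (M : 'M[R]_(n, m)) i j :
  ((delta_mx i 0 : 'cV_n)^T *m M *m (delta_mx j 0 : 'cV_m)) 0 0 = M i j.
Proof. by rewrite trmx_delta -rowE -colE !mxE. Qed.

Lemma mulmx_cV_inj (R : pzSemiRingType) n m (M M' : 'M[R]_(n, m)) :
  (forall x : 'cV_m, M *m x = M' *m x) -> M = M'.
Proof.
move=> eqM; apply/matrixP => i j.
by have /colP/(_ i) := eqM (delta_mx j 0); rewrite -!colE !mxE.
Qed.

(** * Quadratic forms and reflections *)

Section Form.

Variables (K : fieldType) (n : nat) (Q : 'cV[K]_n -> K).
Hypotheses (quadQ : quadratic_form Q) (two_neq0 : 2%:R != 0 :> K).

Definition gram : 'M[K]_n :=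
  \matrix_(i, j) polar Q (delta_mx i 0) (delta_mx j 0).

Local Notation J := gram.
Local Notation B := (polar Q).

Lemma polar_sym x y : B x y = B y x.
Proof. by rewrite /polar [x + y]addrC addrAC. Qed.

Lemma polarDl x y z : B (x + y) z = B x z + B y z.
Proof. by case: quadQ => _ h _; have := h 1 x y z; rewrite scale1r mul1r. Qed.

Lemma polar0l z : B 0 z = 0.
Proof.
apply/eqP; have /eqP := polarDl 0 0 z.
by rewrite addr0 -{1}[B 0 z]addr0 (inj_eq (addrI _)) eq_sym.
Qed.

Lemma polarZl a x z : B (a *: x) z = a * B x z.
Proof.
by case: quadQ => _ h _; have := h a x 0 z; rewrite addr0 polar0l addr0.
Qed.

Lemma polarDr x y z : B z (x + y) = B z x + B z y.
Proof. by rewrite polar_sym polarDl ![B _ z]polar_sym. Qed.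

Lemma polarZr a x z : B z (a *: x) = a * B z x.
Proof. by rewrite polar_sym polarZl polar_sym. Qed.

Lemma polarNl x z : B (- x) z = - B x z.
Proof. by rewrite -scaleN1r polarZl mulN1r. Qed.

Lemma polarNr x z : B z (- x) = - B z x.
Proof. by rewrite polar_sym polarNl polar_sym. Qed.

Lemma quadZ a x : Q (a *: x) = a ^+ 2 * Q x.
Proof. by case: quadQ => h _ _. Qed.

Lemma quadN x : Q (- x) = Q x.
Proof. by rewrite -scaleN1r quadZ sqrrN expr1n mul1r. Qed.

Lemma quadD x y : Q (x + y) = Q x + Q y + B x y.
Proof. rewrite /polar; ring. Qed.

Lemma polarxx x : B x x = 2%:R * Q x.
Proof. rewrite /polar -mulr2n -scaler_nat quadZ; ring. Qed.

Lemma polar_gram x y : x^T *m J *m y = (B x y)%:M.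
Proof.
apply/matrixP => i j; rewrite !ord1 [RHS]mxE mulr1n -mulmxA mxE.
rewrite (@lin_fun_cVE _ _ (fun x => B x y)) => [|a u v]; last first.
  by rewrite polarDl polarZl.
apply: eq_bigr => k _; rewrite !mxE; congr (_ * _).
rewrite (@lin_fun_cVE _ _ (fun y => B (delta_mx k 0) y)) => [|a u v].
  by apply: eq_bigr => l _; rewrite mxE mulrC.
by rewrite polarDr polarZr.
Qed.

Lemma polarE x y : B x y = (x^T *m J *m y) 0 0.
Proof. by rewrite polar_gram mxE mulr1n. Qed.

Lemma quadE x : Q x = 2%:R^-1 * B x x.
Proof. by rewrite polarxx mulKf. Qed.

Lemma gram_tr : J^T = J.
Proof. by apply/matrixP => i j; rewrite !mxE polar_sym. Qed.

Definition isometry (g : 'M[K]_n) : Prop := g^T *m J *m g = J.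

Lemma isometryP g : isometry g <-> forall x, Q (g *m x) = Q x.
Proof.
split=> [isog x | gQ].
  rewrite !quadE !polarE trmx_mul.
  by rewrite -!mulmxA (mulmxA J) (mulmxA g^T) (mulmxA g^T) isog.
have gB x y : B (g *m x) (g *m y) = B x y by rewrite /polar -mulmxDr !gQ.
apply/matrixP => i j.
by rewrite [RHS]mxE -gB polarE trmx_mul -[LHS]mx_deltaE !mulmxA.
Qed.

Lemma isometry_polar g x y : isometry g -> B (g *m x) (g *m y) = B x y.
Proof. by move/isometryP => gQ; rewrite /polar -mulmxDr !gQ. Qed.

Lemma SOP g : SO Q g <-> isometry g /\ \det g = 1.
Proof. by rewrite /SO isometryP. Qed.

Lemma isometry1 : isometry 1%:M.
Proof. by rewrite /isometry trmx1 mul1mx mulmx1. Qed.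

Lemma isometryM g h : isometry g -> isometry h -> isometry (g *m h).
Proof. by rewrite !isometryP => gQ hQ x; rewrite -mulmxA gQ hQ. Qed.

Lemma SO1 : SO Q 1%:M.
Proof. by rewrite SOP det1; split=> //; apply: isometry1. Qed.

Lemma SOM g h : SO Q g -> SO Q h -> SO Q (g *m h).
Proof.
rewrite !SOP det_mulmx => -[ig ->] [ih ->].
by rewrite mulr1; split=> //; apply: isometryM.
Qed.

Lemma SO_unit g : SO Q g -> g \in unitmx.
Proof. by case=> _ dg; rewrite unitmxE dg unitr1. Qed.

Lemma SOV g : SO Q g -> SO Q (invmx g).
Proof.
move=> gSO; have ug := SO_unit gSO; case: gSO => gQ dg; split=> [x|].
  by rewrite -[in RHS](mulKVmx ug x) gQ.
by rewrite det_inv dg invr1.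
Qed.

Definition reflection (a : 'cV[K]_n) : 'M[K]_n :=
  1%:M - (Q a)^-1 *: (a *m (a^T *m J)).

Lemma reflectionE a x : reflection a *m x = x - (B a x / Q a) *: a.
Proof.
rewrite mulmxBl mul1mx -scalemxAl -mulmxA polar_gram mul_mx_scalar.
by rewrite scalerA mulrC.
Qed.

Lemma reflection_isometry a : Q a != 0 -> isometry (reflection a).
Proof.
move=> a0; apply/isometryP => x; rewrite reflectionE quadD quadN quadZ.
by rewrite polarNr polarZr (polar_sym x a); field.
Qed.

Lemma det_reflection a : Q a != 0 -> \det (reflection a) = -1.
Proof.
move=> a0; rewrite /reflection scalemxAr det_1B_rank1 -scalemxAl mxE.
by rewrite -polarE polarxx mulrC mulfK //; ring.
Qed.

Lemma reflection_fix a x : B a x = 0 -> reflection a *m x = x.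
Proof. by move=> ax; rewrite reflectionE ax mul0r scale0r subr0. Qed.

Lemma reflection_self a : Q a != 0 -> reflection a *m a = - a.
Proof.
move=> a0; rewrite reflectionE polarxx mulfK // scaler_nat mulr2n opprD.
by rewrite addrA subrr add0r.
Qed.

Lemma reflection_invol a : Q a != 0 -> reflection a *m reflection a = 1%:M.
Proof.
move=> a0; apply: mulmx_cV_inj => x; rewrite -mulmxA mul1mx.
rewrite [reflection a *m x]reflectionE mulmxBr -scalemxAr reflection_self //.
by rewrite reflectionE scalerN opprK subrK.
Qed.

Lemma reflection_swap x y : Q x = Q y -> Q (y - x) != 0 ->
  reflection (y - x) *m y = x.
Proof.
move=> xy nz; rewrite reflectionE.
have -> : B (y - x) y = Q (y - x).
  rewrite polarDl polarNl polarxx quadD quadN polarNr xy (polar_sym y x); ring.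
by rewrite divff // scale1r opprB addrC subrK.
Qed.

Definition reflections (s : seq 'cV[K]_n) : 'M[K]_n :=
  foldr (fun a g => reflection a *m g) 1%:M s.

Lemma det_reflections s : all (fun a => Q a != 0) s ->
  \det (reflections s) = (-1) ^+ size s.
Proof.
elim: s => [|a s IH] /=; first by rewrite det1.
by case/andP=> a0 /IH h; rewrite det_mulmx h det_reflection // exprS.
Qed.

Lemma reflections_isometry s : all (fun a => Q a != 0) s ->
  isometry (reflections s).
Proof.
elim: s => [|a s IH] /=; first by move=> _; apply: isometry1.
by case/andP=> a0 /IH h; apply: isometryM => //; apply: reflection_isometry.
Qed.

(* Weak form of the Cartan-Dieudonne theorem. Each vector of an orthogonal
   basis is moved to its place with one or two reflections in vectors that are
   orthogonal to those already in place. *)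
Lemma isometry_reflections (A : 'M[K]_n) (d : 'rV[K]_n) :
    A^T *m J *m A = diag_mx d -> (forall i, d 0 i != 0) ->
  forall g, isometry g ->
  exists2 s, all (fun a => Q a != 0) s & g = reflections s.
Proof.
move=> AJA d0.
have BA i j : B (col i A) (col j A) = d 0 i *+ (i == j).
  rewrite polarE !colE trmx_mul mulmxA -(mulmxA _ A^T) -(mulmxA _ _ A).
  by rewrite AJA mx_deltaE mxE.
have uA : A \in unitmx.
  have : \det (A^T *m J *m A) != 0.
    by rewrite AJA det_diag; apply/prodf_neq0 => i _; apply: d0.
  by rewrite det_mulmx mulf_eq0 negb_or unitmxE unitfE => /andP[].
have QA i : Q (col i A) != 0.
  by rewrite quadE BA eqxx mulr1n mulf_neq0 ?invr_neq0 ?d0.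
have main k g : isometry g ->
    (forall i : 'I_n, (i + k < n)%N -> g *m col i A = col i A) ->
  exists2 s, all (fun a => Q a != 0) s & g = reflections s.
  elim: k g => [|k IH] g gI gA.
    exists [::] => //=; apply: (can_inj (mulmxK uA)); rewrite mul1mx.
    apply/matrixP => i j; have := ltn_ord j; rewrite -[in X in X -> _](addn0 j).
    by move/gA; rewrite {1}colE mulmxA -colE => /colP/(_ i); rewrite !mxE.
  have [ltkn|lenk] := ltnP k n; last first.
    apply: (IH g gI) => i; rewrite addnC ltnNge.
    by rewrite (leq_trans lenk) ?leq_addr.
  (* The first basis vector not yet known to be fixed; the later ones are left to the induction. *)
  pose i0 := Ordinal (rev_ord_proof (Ordinal ltkn)).
  have lt_i0 (i : 'I_n) : (i + k < n)%N -> i = i0 \/ (i + k.+1 < n)%N.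
    rewrite addnS; rewrite leq_eqVlt => /orP[/eqP ik|->]; last by right.
    by left; apply: val_inj; rewrite /=; apply: (@addIn k.+1); rewrite subnK // addnS.
  have gA0 (i : 'I_n) : (i + k.+1 < n)%N -> B (col i0 A) (col i A) = 0.
    move=> ik; rewrite BA; case: eqP => // i0i.
    by move: ik; rewrite -i0i /= subnK ?ltnn.
  set x := col i0 A in gA0 *; pose y := g *m x.
  have yA (i : 'I_n) : (i + k.+1 < n)%N -> B y (col i A) = 0.
    by move=> ik; rewrite /y -{1}(gA i ik) isometry_polar // gA0.
  have Qy : Q y = Q x by move/isometryP: gI => ->.
  have Qx : Q x != 0 by apply: QA.
  have [yx0|yxN0] := eqVneq (Q (y - x)) 0; last first.
    have [||s s0 gs] := IH (reflection (y - x) *m g).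
    - by apply: isometryM => //; apply: reflection_isometry.
    - move=> i /lt_i0[->|ik]; rewrite -mulmxA; first exact: reflection_swap.
      rewrite gA // reflection_fix // polarDl polarNl yA // gA0 //.
      by rewrite subrr.
    exists (y - x :: s); rewrite /= ?yxN0 // -gs mulmxA reflection_invol //.
    by rewrite mul1mx.
  (* By the parallelogram law [y - x] and [y + x] cannot both be isotropic. The reflection in
     [y + x] sends [y] to [- x], and the one in [x] then restores the sign. *)
  have yxN0 : Q (y + x) != 0.
    have e : Q (y + x) = 4%:R * Q x - Q (y - x).
      rewrite !quadD quadN polarNr Qy; ring.
    by rewrite e yx0 subr0 mulf_neq0 // (natrM _ 2 2) mulf_neq0.
  have [||s s0 gs] := IH (reflection x *m (reflection (y + x) *m g)).
  - by do 2?[apply: isometryM => //; first exact: reflection_isometry].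
  - move=> i /lt_i0[->|ik]; rewrite -!mulmxA.
      have -> : reflection (y + x) *m (g *m col i0 A) = - x.
        by rewrite -{1}[x]opprK reflection_swap ?quadN ?opprK.
      by rewrite mulmxN reflection_self // opprK.
    rewrite gA // [_ *m col i A]reflection_fix.
      by rewrite reflection_fix // gA0.
    by rewrite polarDl yA // gA0 // addr0.
  exists [:: y + x, x & s]; rewrite /= ?yxN0 ?Qx // -gs.
  rewrite (mulmxA (reflection x)) reflection_invol // mul1mx.
  by rewrite mulmxA reflection_invol // mul1mx.
move=> g gI; apply: (main n) => // i.
by rewrite ltnNge leq_addl.
Qed.

End Form.

(** * LU decomposition and the big cell *)

Section Triangular.

Variable K : fieldType.

Definition lower1 n (A : 'M[K]_n) : Prop :=
  forall i j : 'I_n, (i <= j)%N -> A i j = (i == j)%:R.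

Definition upper n (A : 'M[K]_n) : Prop :=
  forall i j : 'I_n, (j < i)%N -> A i j = 0.

Lemma lower1_block n (A : 'M[K]_n) (c : 'M_(1, n)) :
  lower1 A -> lower1 (block_mx A 0 c 1%:M).
Proof.
move=> lA i j; rewrite !mxE.
case: splitP => i' ii; rewrite ?mxE; case: splitP => j' jj; rewrite ?mxE.
- by rewrite -(inj_eq val_inj) /= ii jj => /lA->; rewrite -(inj_eq val_inj).
- by move=> _; rewrite -(inj_eq val_inj) /= ii jj ltn_eqF // ltn_addr.
- by rewrite ii jj leqNgt ltn_addr.
- by move=> _; rewrite -!(inj_eq val_inj) /= ii jj eqn_add2l.
Qed.

Lemma upper_block n (A : 'M[K]_n) b d :
  upper A -> upper (block_mx A b 0 d : 'M_(n + 1)).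
Proof.
move=> uA i j; rewrite !mxE.
case: splitP => i' ii; rewrite !mxE; case: splitP => j' jj; rewrite ?mxE //.
- by rewrite ii jj => /uA.
- by rewrite ii jj ltnNge ltnW // ltn_addr.
- by rewrite ii jj !ord1 ltnn.
Qed.

Lemma det_lower1 n (A : 'M[K]_n) : lower1 A -> \det A = 1.
Proof.
move=> lA; rewrite det_trig; last first.
  apply/is_trig_mxP => i j ij; rewrite (lA i j (ltnW ij)).
  by rewrite (_ : i == j = false) // -(inj_eq val_inj) /= ltn_eqF.
by rewrite big1 // => i _; rewrite (lA i i (leqnn i)) eqxx.
Qed.

Lemma lower1M n (A B : 'M[K]_n) : lower1 A -> lower1 B -> lower1 (A *m B).
Proof.
move=> lA lB i j ij; rewrite mxE (bigD1 i) //= lA // eqxx mul1r lB //.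
rewrite big1 ?addr0 // => k ki.
have [ik|] := leqP i k; first by rewrite lA // eq_sym (negPf ki) mul0r.
move=> ki'; rewrite lB ?(leq_trans (ltnW ki')) //.
have -> : (k == j) = false.
  by apply/negbTE/eqP => kj; move: ki'; rewrite kj ltnNge ij.
by rewrite mulr0.
Qed.

Lemma upperM n (A B : 'M[K]_n) : upper A -> upper B -> upper (A *m B).
Proof.
move=> uA uB i j ij; rewrite mxE big1 // => k _.
have [ki|ik] := ltnP k i; first by rewrite uA ?mul0r.
by rewrite uB ?mulr0 // (leq_trans ij).
Qed.

Lemma upperM_diag n (A B : 'M[K]_n) i : upper A -> upper B ->
  (A *m B) i i = A i i * B i i.
Proof.
move=> uA uB; rewrite mxE (bigD1 i) //= big1 ?addr0 // => k ki.
have [ki'|ik] := ltnP k i; first by rewrite uA ?mul0r.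
by rewrite uB ?mulr0 // ltn_neqAle eq_sym ki.
Qed.

(** The entries come from a function on all pairs of naturals, so that leading minors of every size
    are formed without casts. *)
Definition leading_mx (a : nat -> nat -> K) k : 'M[K]_k := \matrix_(i, j) a i j.

(** Induction by bordering: the new pivot [e] is a Schur complement, nonzero because it is the ratio
    of two consecutive minors. The inverses are carried along because their triangular shape is
    needed as well. *)
Lemma LU_decomposition n (a : nat -> nat -> K) :
    (forall k, (k <= n)%N -> \det (leading_mx a k) != 0) ->
  exists L Li U Ui : 'M[K]_n,
    [/\ leading_mx a n = L *m U, L *m Li = 1%:M /\ U *m Ui = 1%:M,
        lower1 L /\ lower1 Li & upper U /\ upper Ui].
Proof.
elim: n => [|n IH] minors.
  exists 1%:M, 1%:M, 1%:M, 1%:M.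
  split; [by apply/matrixP; case | by rewrite mulmx1 | |]; by split; case.
have [|L [Li [U [Ui [eLU [LLi UUi] [lL lLi] [uU uUi]]]]]] := IH.
  by move=> k kn; apply: minors; apply: leqW.
have {minors} := minors n.+1 (leqnn _); rewrite -[n.+1]addn1 => minor.
have LiL := mulmx1C LLi; have UiU := mulmx1C UUi.
pose b : 'M[K]_(n, 1) := \matrix_(i, j) a i n.
pose c : 'M[K]_(1, n) := \matrix_(i, j) a n j.
pose d : 'M[K]_1 := (a n n)%:M.
have eA : leading_mx a (n + 1) = block_mx (leading_mx a n) b c d.
  apply/matrixP => i j; rewrite !mxE.
  case: splitP => i' ii; rewrite !mxE; case: splitP => j' jj;
    by rewrite ?mxE ?ii ?jj ?ord1 /= ?addn0.
pose e : K := (d - c *m Ui *m (Li *m b)) 0 0.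
have eE : d - c *m Ui *m (Li *m b) = e%:M by rewrite -mx11_scalar.
have eLU' : leading_mx a (n + 1) =
    block_mx L 0 (c *m Ui) 1%:M *m block_mx U (Li *m b) 0 e%:M.
  rewrite mulmx_block !mul0mx !mul1mx !addr0 mulmxA LLi mul1mx.
  by rewrite -eE addrC subrK -[c *m Ui *m U]mulmxA UiU mulmx1 -eLU.
have e0 : e != 0.
  move: minor; rewrite eLU' det_mulmx det_lblock det_ublock !det_scalar1.
  by rewrite !mulf_eq0 !negb_or => /andP[_ /andP[]].
exists (block_mx L 0 (c *m Ui) 1%:M), (block_mx Li 0 (- (c *m Ui *m Li)) 1%:M).
exists (block_mx U (Li *m b) 0 e%:M),
  (block_mx Ui (- (Ui *m (Li *m b) *m (e^-1)%:M)) 0 (e^-1)%:M).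
split=> //.
- split; rewrite mulmx_block !mulmx0 !mul0mx ?mulmx1 ?mul1mx ?addr0 ?add0r.
    by rewrite LLi subrr -scalar_mx_block.
  rewrite UUi mulmxN !mulmxA UUi !mul1mx addNr -scalar_mxM mulfV //.
  by rewrite -scalar_mx_block.
- by split; apply: lower1_block.
- by split; apply: upper_block.
Qed.

End Triangular.

Section Witt.

Variables (K : fieldType) (n : nat).

Definition antidiag : 'M[K]_n := \matrix_(i, j) (i + j == n.-1)%N%:R.

Local Notation Jt := antidiag.

Lemma antidiagE i j : Jt i j = (j == rev_ord i)%:R.
Proof.
rewrite mxE -(inj_eq val_inj) /=; case: n i j => [[]//|m] i j /=.
have := ltn_ord i; have := ltn_ord j => ij ii.
by congr ((nat_of_bool _)%:R); lia.
Qed.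

Lemma antidiag_tr : Jt^T = Jt.
Proof. by apply/matrixP => i j; rewrite !mxE addnC. Qed.

Lemma mul_antidiag m (M : 'M[K]_(n, m)) i j : (Jt *m M) i j = M (rev_ord i) j.
Proof.
rewrite mxE (bigD1 (rev_ord i)) //= antidiagE eqxx mul1r big1 ?addr0 // => k.
by rewrite antidiagE => /negPf->; rewrite mul0r.
Qed.

Lemma mul_mx_antidiag m (M : 'M[K]_(m, n)) i j : (M *m Jt) i j = M i (rev_ord j).
Proof.
rewrite mxE (bigD1 (rev_ord j)) //= antidiagE rev_ordK eqxx mulr1 big1 ?addr0 // => k.
by rewrite antidiagE -(inj_eq rev_ord_inj) rev_ordK eq_sym => /negPf->; rewrite mulr0.
Qed.

Lemma antidiagK : Jt *m Jt = 1%:M.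
Proof.
apply/matrixP => i j; rewrite mul_antidiag antidiagE rev_ordK mxE.
by rewrite eq_sym.
Qed.

Fact adj_key : unit. Proof. by []. Qed.

(** Adjoint for the antidiagonal form, that is, reflection of the matrix in its antidiagonal. It
    therefore preserves lower and upper triangular shape, and isometries satisfy
    [adj M *m M = 1%:M]. *)
Definition adj (M : 'M[K]_n) : 'M[K]_n := locked_with adj_key (Jt *m M^T *m Jt).

Lemma adj_def M : adj M = Jt *m M^T *m Jt.
Proof. by rewrite /adj unlock. Qed.

Lemma adjE M i j : adj M i j = M (rev_ord j) (rev_ord i).
Proof. by rewrite adj_def mul_mx_antidiag mul_antidiag mxE. Qed.

Lemma adjM M N : adj (M *m N) = adj N *m adj M.
Proof.
by rewrite !adj_def trmx_mul !mulmxA -(mulmxA _ Jt Jt) antidiagK mulmx1.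
Qed.

Lemma adj1 : adj 1%:M = 1%:M.
Proof. by rewrite adj_def trmx1 mulmx1 antidiagK. Qed.



Lemma adj_lower1 M : lower1 M -> lower1 (adj M).
Proof.
move=> lM i j ij; rewrite adjE lM ?leq_sub2l //.
by rewrite (inj_eq rev_ord_inj) eq_sym.
Qed.

Lemma adj_upper M : upper M -> upper (adj M).
Proof. by move=> uM i j ij; rewrite adjE uM // /= ltn_sub2l // (leq_ltn_trans ij). Qed.

Lemma torus_coord_rev (t : 'I_n./2 -> K) (i : 'I_n) :
    (forall k, t k != 0) ->
  torus_coord t i * torus_coord t (rev_ord i) = 1.
Proof.
move=> t0; rewrite /torus_coord.
have lt_in := ltn_ord i.
have rE : (rev_ord i : nat) = (n.-1 - i)%N by rewrite /=; lia.
have rrE : (n.-1 - rev_ord i)%N = i by rewrite /=; lia.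
rewrite rrE rE; case: insubP => [k ki ek|nki]; case: insubP => [k' ki' ek'|nki'] //.
- by exfalso; lia.
- by rewrite mulfV.
- by rewrite mulVf.
- by rewrite mulr1.
Qed.

Lemma torus_coord_neq0 (t : 'I_n./2 -> K) (i : nat) :
  (forall k, t k != 0) -> torus_coord t i != 0.
Proof.
move=> t0; rewrite /torus_coord; case: insub => [k|] //.
by case: insub => [k|]; rewrite ?invr_neq0 ?oner_neq0.
Qed.

Lemma torus_coord_mid (t : 'I_n./2 -> K) (i : nat) :
  ~~ (i < n./2)%N -> ~~ (n.-1 - i < n./2)%N -> torus_coord t i = 1.
Proof. by move=> hi hj; rewrite /torus_coord !insubN. Qed.

Definition torus_mx (t : 'I_n./2 -> K) : 'M[K]_n :=
  diag_mx (\row_i torus_coord t i).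

Lemma det_torus_mx t : (forall k, t k != 0) -> \det (torus_mx t) = 1.
Proof.
move=> t0; rewrite det_diag; under eq_bigr do rewrite mxE.
rewrite (bigID (fun i : 'I_n => (i < n./2)%N)) /=.
rewrite [X in _ * X](reindex_inj rev_ord_inj) [X in X * _]big_mkcond.
rewrite [X in _ * X]big_mkcond -big_split big1 //= => i _.
have := ltn_ord i => lt_in.
have crev : torus_coord t (n - i.+1) = (torus_coord t i)^-1.
  apply: (mulfI (torus_coord_neq0 i t0)).
  by rewrite mulfV ?torus_coord_neq0 //; apply: (torus_coord_rev i t0).
rewrite crev; case: ltnP => h1; case: ltnP => h2 /=.
- by exfalso; lia.
- by rewrite mulfV ?torus_coord_neq0.
- by rewrite mulr1.
- by rewrite torus_coord_mid ?invr1 ?mulr1 //; lia.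
Qed.

Lemma adj_torus_mx t : (forall k, t k != 0) -> adj (torus_mx t) *m torus_mx t = 1%:M.
Proof.
move=> t0; apply/matrixP => i j; rewrite mul_mx_diag [LHS]mxE adjE !mxE.
rewrite (inj_eq rev_ord_inj) [j == i]eq_sym; case: eqP => _.
  by rewrite mulr1n mulrC; apply: torus_coord_rev.
by rewrite mulr0n mul0r.
Qed.

Definition entry_or0 (g : 'M[K]_n) (a b : nat) : K :=
  if insub a is Some i then if insub b is Some j then g i j else 0 else 0.

Lemma leading_nat_mx g : leading_mx (entry_or0 g) n = g.
Proof. by apply/matrixP => i j; rewrite mxE /entry_or0 !valK. Qed.

(* By uniqueness of the LU decomposition, the two factors of an isometry are
   isometries: both [L U] and [adj(L)^-1 adj(U)^-1] are such decompositions of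
   g. *)
Lemma big_cell g : adj g *m g = 1%:M -> \det g = 1 ->
    (forall k, (k <= n)%N -> \det (leading_mx (entry_or0 g) k) != 0) ->
  exists L t U, [/\ g = L *m torus_mx t *m U, forall k, t k != 0,
    lower1 L /\ adj L *m L = 1%:M & lower1 U^T /\ adj U *m U = 1%:M].
Proof.
move=> gI dg /LU_decomposition[L [Li [U [Ui []]]]].
rewrite leading_nat_mx => gLU [LLi UUi] [lL lLi] [uU uUi].
have LiL := mulmx1C LLi; have UiU := mulmx1C UUi.
have e1 : adj L *m L = adj Ui *m Ui.
  have : adj U *m (adj L *m L) *m U = 1%:M by rewrite -gI gLU adjM !mulmxA.
  move/(congr1 (fun M => adj Ui *m M *m Ui)) => /=.
  by rewrite !mulmxA -adjM UUi adj1 mul1mx mulmx1 -!mulmxA UUi mulmx1.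
have LI : adj L *m L = 1%:M.
  apply/matrixP => i j; have [ij|ji] := leqP i j.
    by rewrite (lower1M (adj_lower1 lL) lL) // mxE.
  rewrite e1 (upperM (adj_upper uUi) uUi) // mxE.
  by rewrite (_ : i == j = false) //; apply/eqP => ij; rewrite ij ltnn in ji.
have UI : adj U *m U = 1%:M.
  by rewrite -gI gLU adjM -mulmxA (mulmxA _ L) LI mul1mx.
pose d : 'rV[K]_n := \row_i U i i.
have dd i : d 0 i * d 0 (rev_ord i) = 1.
  rewrite mulrC !mxE -adjE -upperM_diag //; last exact: adj_upper.
  by rewrite UI mxE eqxx.
have d0 i : d 0 i != 0.
  by apply/eqP => di; have /eqP := dd i; rewrite di mul0r eq_sym oner_eq0.
have le_half : (n./2 <= n)%N by lia.
pose t (k : 'I_n./2) : K := d 0 (widen_ord le_half k).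
have t0 k : t k != 0 by apply: d0.
have tE (i : 'I_n) : (i < n./2)%N || (n.-1 - i < n./2)%N -> torus_coord t i = d 0 i.
  move=> hi; have lt_in := ltn_ord i; rewrite /torus_coord.
  case: insubP => [k ki ek|nki].
    by congr (d 0 _); apply: val_inj.
  case: insubP => [k ki ek|nki']; last by rewrite (negPf nki) (negPf nki') in hi.
  rewrite (_ : t k = d 0 (rev_ord i)).
    by rewrite -[LHS]mul1r -(dd i) mulfK.
  by congr (d 0 _); apply: val_inj => /=; rewrite ek /=; lia.
have dP : \prod_i d 0 i = 1.
  have dL := det_lower1 lL.
  have dU : \det U = \prod_i d 0 i.
    rewrite -det_tr det_trig; first by apply: eq_bigr => i _; rewrite !mxE.
    by apply/is_trig_mxP => i j ij; rewrite mxE uU.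
  by rewrite -dU -dg gLU det_mulmx dL mul1r.
(* For odd n, being an isometry only makes the square of the middle coordinate equal to 1; the
   determinant excludes the value -1. *)
have dE : d = \row_i torus_coord t i.
  apply/rowP => i; rewrite [RHS]mxE.
  have [hi|] := boolP ((i < n./2)%N || (n.-1 - i < n./2)%N); first by rewrite tE.
  rewrite negb_or => /andP[hi hi']; have lt_in := ltn_ord i.
  have := etrans (det_torus_mx t0) (esym dP); rewrite det_diag (bigD1 i) //= [RHS](bigD1 i) //=.
  rewrite (eq_bigr (fun j => d 0 j)) => [|j ji].
    have X0 : \prod_(j < n | j != i) d 0 j != 0 by apply/prodf_neq0 => j _; apply: d0.
    by move=> h; rewrite -(mulIf X0 h) mxE.
  rewrite mxE tE //; have lt_jn := ltn_ord j; move: ji; rewrite -(inj_eq val_inj) /=.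
  by move: hi hi'; lia.
pose D := torus_mx t; pose Di := torus_mx (fun k => (t k)^-1).
have DE : D = diag_mx d by rewrite /D /torus_mx -dE.
pose V : 'M_n := \matrix_(i, j) ((d 0 i)^-1 * U i j).
have UV : U = D *m V.
  apply/matrixP => i j; rewrite DE mul_diag_mx !mxE mulrA mulfV ?mul1r //.
  by have := d0 i; rewrite mxE.
exists L, t, V; split => //; first by rewrite -mulmxA -/D -UV.
split.
  move=> i j ij; rewrite !mxE; case: eqP => [->|/eqP ne].
    by rewrite mulVf //; have := d0 j; rewrite mxE.
  have lt_ij : (i < j)%N by rewrite ltn_neqAle ij andbT.
  by rewrite (uU j i lt_ij) mulr0.
have DI : adj D *m D = 1%:M by apply: adj_torus_mx.
by rewrite -UI UV adjM -mulmxA (mulmxA (adj D)) DI mul1mx.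
Qed.

End Witt.

(** * Density of the big cell in SO(Q) *)

Section WittBasis.

Variables (K : fieldType) (n : nat) (Q : 'cV[K]_n -> K) (P : 'M[K]_n).
Hypotheses (quadQ : quadratic_form Q) (two_neq0 : 2%:R != 0 :> K).
Hypothesis wittP : witt_basis Q P.

Local Notation J := (gram Q).
Local Notation Jt := (antidiag K n).

Lemma witt_gram : P^T *m J *m P = Jt.
Proof.
apply/matrixP => i j; rewrite [RHS]mxE -wittP (polarE quadQ) !colE.
by rewrite -[LHS]mx_deltaE trmx_mul !mulmxA.
Qed.

Lemma witt_unit : P \in unitmx.
Proof.
have : \det (Jt *m Jt) != 0 by rewrite antidiagK det1 oner_neq0.
rewrite det_mulmx -witt_gram !det_mulmx !mulf_eq0 !negb_or unitmxE unitfE.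
by case/andP=> /andP[].
Qed.

Lemma witt_gram_inv : (invmx P)^T *m Jt *m invmx P = J.
Proof.
have uP := witt_unit.
by rewrite -witt_gram !mulmxA -trmx_mul mulmxV // trmx1 mul1mx mulmxK.
Qed.

Definition witt_conj (M : 'M[K]_n) : 'M[K]_n := P *m M *m invmx P.

Lemma witt_conjK g : witt_conj (invmx P *m g *m P) = g.
Proof.
have uP := witt_unit.
by rewrite /witt_conj !mulmxA mulmxV // mul1mx mulmxK.
Qed.

Lemma witt_conjM M N : witt_conj (M *m N) = witt_conj M *m witt_conj N.
Proof.
have uP := witt_unit.
by rewrite /witt_conj !mulmxA mulmxKV.
Qed.

Lemma witt_conj1 : witt_conj 1%:M = 1%:M.
Proof. by rewrite /witt_conj mulmx1 mulmxV // witt_unit. Qed.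

Lemma det_witt_conj M : \det (witt_conj M) = \det M.
Proof.
have uP := witt_unit; rewrite /witt_conj !det_mulmx det_inv mulrAC mulrV ?mul1r //.
Qed.

Definition witt_SO (M : 'M[K]_n) : Prop := adj M *m M = 1%:M /\ \det M = 1.

Lemma SO_witt_conj M : SO Q (witt_conj M) <-> witt_SO M.
Proof.
have uP := witt_unit; rewrite (SOP quadQ two_neq0) det_witt_conj.
suff -> : isometry Q (witt_conj M) <-> adj M *m M = 1%:M by [].
rewrite /isometry -witt_gram_inv /witt_conj !trmx_mul adj_def; set X := invmx P.
have PX : P *m X = 1%:M by rewrite mulmxV.
have XP : X *m P = 1%:M by rewrite mulVmx.
have XPt : X^T *m P^T = 1%:M by rewrite -trmx_mul PX trmx1.
have PXt : P^T *m X^T = 1%:M by rewrite -trmx_mul XP trmx1.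
have k1 m (A : 'M_(m, n)) : A *m P^T *m X^T = A by rewrite -mulmxA PXt mulmx1.
have k2 m (A : 'M_(m, n)) : A *m X *m P = A by rewrite -mulmxA XP mulmx1.
have -> : X^T *m (M^T *m P^T) *m (X^T *m Jt *m X) *m (P *m M *m X) =
          X^T *m (M^T *m Jt *m M) *m X by rewrite !mulmxA k1 k2.
split=> [h | h].
  have {}h : M^T *m Jt *m M = Jt.
    move/(congr1 (fun Y => P^T *m Y *m P)): h => /=.
    by rewrite !mulmxA PXt !mul1mx !k2.
  by rewrite -!mulmxA (mulmxA M^T) h antidiagK.
have -> // : M^T *m Jt *m M = Jt.
by move/(congr1 (mulmx Jt)): h; rewrite mulmx1 !mulmxA antidiagK mul1mx.
Qed.

Lemma witt_SOM M N : witt_SO M -> witt_SO N -> witt_SO (M *m N).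
Proof. by rewrite -!SO_witt_conj witt_conjM; apply: SOM. Qed.

Lemma witt_SO_torus t : (forall k, t k != 0) -> witt_SO (torus_mx t).
Proof. by move=> t0; split; [apply: adj_torus_mx | apply: det_torus_mx]. Qed.

Lemma witt_SO_lower1 M : lower1 M -> adj M *m M = 1%:M -> witt_SO M.
Proof.
by move=> lM MI; split=> //; apply: det_lower1.
Qed.

Lemma witt_SO_upper1 M : lower1 M^T -> adj M *m M = 1%:M -> witt_SO M.
Proof.
by move=> lM MI; split=> //; rewrite -det_tr; apply: det_lower1.
Qed.

(** The vectors [w_i + w_(n-1-i)] and [w_i - w_(n-1-i)], up to sign, and the middle vector for odd
    n. The polar form takes the values 2, -2 and 1 on them; [ep] is the sign of the second term. *)
Lemma orthogonal_basis_exists :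
  exists (A : 'M[K]_n) (d : 'rV[K]_n), A^T *m J *m A = diag_mx d /\ forall i, d 0 i != 0.
Proof.
pose ep (i : 'I_n) : K := if (i < rev_ord i)%N then 1 else if (rev_ord i < i)%N then -1 else 0.
pose E : 'M[K]_n := diag_mx (\row_(i < n) ep i).
pose d : 'rV[K]_n := \row_i (ep i *+ 2 + (rev_ord i == i)%:R).
exists (P *m (1%:M + Jt *m E)), d; split; last first.
  move=> i; rewrite mxE /ep -(inj_eq val_inj).
  case: ltngtP => h; rewrite ?addr0 ?mul0rn ?add0r ?oner_neq0 //.
  by rewrite mulNrn oppr_eq0.
pose C : 'M[K]_n := 1%:M + Jt *m E; rewrite -/C.
have -> : (P *m C)^T *m J *m (P *m C) = C^T *m Jt *m C.
  by rewrite -witt_gram trmx_mul !mulmxA.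
have -> : C^T *m Jt *m C = Jt + E + E + E *m Jt *m E.
  have -> : C^T = 1%:M + E *m Jt.
    by rewrite linearD /= trmx1 trmx_mul tr_diag_mx antidiag_tr.
  rewrite mulmxDl mul1mx -mulmxA antidiagK mulmx1 mulmxDr mulmx1 mulmxDl.
  by rewrite mulmxA antidiagK mul1mx mulmxA !addrA.
apply/matrixP => i j.
have eE : E i j = ep i *+ (i == j) by rewrite !mxE.
have eEJE : (E *m Jt *m E) i j = ep i * (j == rev_ord i)%:R * ep j.
  by rewrite /E mul_mx_diag mxE mul_diag_mx mxE -antidiagE !mxE.
have -> : (Jt + E + E + E *m Jt *m E) i j =
    (j == rev_ord i)%:R + E i j + E i j + (E *m Jt *m E) i j.
  by rewrite mxE; congr (_ + _); rewrite mxE; congr (_ + _); rewrite mxE antidiagE.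
rewrite eE eEJE !mxE [rev_ord i == i]eq_sym.
have [->|ij] := eqVneq j (rev_ord i); rewrite ?eqxx.
  have -> : ep (rev_ord i) = - ep i.
    by rewrite /ep rev_ordK; case: ltngtP => _; rewrite ?opprK ?oppr0.
  have [ei|ni] := eqVneq i (rev_ord i); last first.
    have -> : ep i * true%:R * - ep i = -1.
      move: ni; rewrite -(inj_eq val_inj) /ep /=.
      by case: ltngtP => // _ _; rewrite mulr1 ?mulrNN ?mul1r // mulrNN mulr1.
    by rewrite !mulr0n !addr0 subrr.
  by rewrite /ep -ei ltnn !mulr1n !mul0r !addr0 mul0rn add0r.
rewrite mulr0n mulr0 mul0r addr0 add0r -mulrnDl -mulr2n.
have [eij|//] := eqVneq i j.
by rewrite -eij in ij; rewrite (negPf ij) addr0 !mulr1n.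
Qed.

Hypothesis infK : infinite_field K.

Definition segment (c a : 'cV[K]_n) (s : K) : 'cV[K]_n := (1 - s) *: a + s *: c.

Lemma poly_mx_segment c a : poly_mx (segment c a).
Proof.
apply: poly_mxD; apply: poly_mxZ; rewrite /=; try exact: poly_mx_cst.
  by apply: poly_funB; [exact: poly_fun_cst | exact: poly_fun_id].
exact: poly_fun_id.
Qed.

Lemma poly_fun_quad c a : poly_fun (fun s => Q (segment c a s)).
Proof.
apply: (@eq_poly_fun _ (fun s =>
   2%:R^-1 * ((segment c a s)^T *m J *m segment c a s) 0 0)).
  by move=> s; rewrite (quadE quadQ two_neq0) (polarE quadQ).
apply: poly_funM; first exact: poly_fun_cst.
have hs := poly_mx_segment c a.
suff h : poly_mx (fun s => (segment c a s)^T *m J *m segment c a s) by apply: h.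
apply: poly_mxM => //; apply: poly_mxM; last exact: poly_mx_cst.
exact: poly_mx_tr.
Qed.

(** Each reflection is rational in [s] with denominator [Q (segment c a s)]; [h] is the product of
    these denominators and [G] the polynomial numerator. *)
Lemma reflections_segment c (rs : seq 'cV[K]_n) :
  exists h G, [/\ poly_fun h, poly_mx G,
    forall s, (h s != 0) = all (fun a => Q (segment c a s) != 0) rs &
    forall s, h s != 0 ->
      (h s)^-1 *: G s = reflections Q [seq segment c a s | a <- rs]].
Proof.
elim: rs => [|a rs [h [G [hh hG hE GE]]]].
  exists (fun=> 1), (fun=> 1%:M); split; first exact: poly_fun_cst.
  - exact: poly_mx_cst.
  - by move=> s /=; rewrite oner_neq0.
  - by move=> s _; rewrite invr1 scale1r.
exists (fun s => Q (segment c a s) * h s), (fun s =>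
  (Q (segment c a s) *: 1%:M -
    segment c a s *m ((segment c a s)^T *m J)) *m G s); split.
- by apply: poly_funM => //; apply: poly_fun_quad.
- apply: poly_mxM => //; apply: poly_mxD.
    by apply: poly_mxZ; [exact: poly_fun_quad | exact: poly_mx_cst].
  apply: poly_mxN; have hs := poly_mx_segment c a; apply: poly_mxM => //.
  by apply: poly_mxM; [exact: poly_mx_tr | exact: poly_mx_cst].
- by move=> s; rewrite mulf_eq0 negb_or hE.
move=> s; rewrite mulf_eq0 negb_or => /andP[q0 h0] /=.
rewrite -GE // invfM -scalerA scalemxAr scalemxAl /reflection; congr (_ *m _).
by rewrite scalerBr scalerA mulVf // scale1r.
Qed.

Lemma SO_curve g : (0 < n)%N -> SO Q g ->
  exists h G, [/\ poly_fun h, poly_mx G,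
    h 0 != 0 /\ (h 0)^-1 *: G 0 = g,
    h 1 != 0 /\ (h 1)^-1 *: G 1 = 1%:M &
    forall s, h s != 0 -> SO Q ((h s)^-1 *: G s)].
Proof.
move=> n_gt0 gSO; have [A [d [AJA d0]]] := orthogonal_basis_exists.
have /(SOP quadQ two_neq0)[gI dg] := gSO.
have [rs Qrs gE] := isometry_reflections quadQ two_neq0 AJA d0 gI.
pose c := col (Ordinal n_gt0) A.
have Qc : Q c != 0.
  rewrite (quadE quadQ two_neq0) (polarE quadQ) /c colE trmx_mul mulmxA.
  rewrite -(mulmxA _ A^T) -(mulmxA _ _ A) AJA mx_deltaE mxE eqxx mulr1n.
  by rewrite mulf_neq0 ?invr_neq0 ?d0.
(* Determinant 1 makes the number of reflections even. At s = 1, where every vector has become [c],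
   they cancel in pairs. *)
have even_rs : ~~ odd (size rs).
  apply/negP => odd_rs; move: dg; rewrite gE (det_reflections quadQ) //.
  rewrite -signr_odd odd_rs expr1 => /eqP; rewrite eq_sym -subr_eq0 opprK.
  exact/negP.
have [h [G [hh hG hE GE]]] := reflections_segment c rs.
have seg0 a : segment c a 0 = a by rewrite /segment subr0 scale1r scale0r addr0.
have seg1 a : segment c a 1 = c by rewrite /segment subrr scale1r scale0r add0r.
have h0 : h 0 != 0 by rewrite hE (eq_all (fun a => congr1 (fun x => Q x != 0) (seg0 a))).
have h1 : h 1 != 0.
  rewrite hE (eq_all (fun a => congr1 (fun x => Q x != 0) (seg1 a))).
  by apply/allP => a _ /=.
exists h, G; split=> //; first split=> //.
- by rewrite GE // (eq_map seg0) map_id.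
- split=> //; rewrite GE // (eq_map seg1).
  have -> : [seq c | _ <- rs] = nseq (size rs) c by elim: (rs) => //= ? ? ->.
  rewrite -(odd_double_half (size rs)) (negPf even_rs) add0n.
  elim: (size rs)./2 => //= k IH; rewrite IH mulmx1.
  exact: reflection_invol.
move=> s hs; rewrite GE //; apply/(SOP quadQ two_neq0); rewrite hE in hs.
rewrite -(all_map (segment c ^~ s) (fun a => Q a != 0)) in hs.
split; first exact: reflections_isometry.
by rewrite (det_reflections quadQ) // size_map -signr_odd (negPf even_rs).
Qed.

Definition in_big_cell (g : 'M[K]_n) : Prop :=
  forall k, (k <= n)%N -> \det (leading_mx (entry_or0 (invmx P *m g *m P)) k) != 0.

Lemma leading_scale c g k :
  leading_mx (entry_or0 (c *: g : 'M[K]_n)) k = c *: leading_mx (entry_or0 g) k.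
Proof.
apply/matrixP => i j; rewrite !mxE /entry_or0.
by case: insub => [?|]; [case: insub => [?|] |]; rewrite ?mxE ?mulr0.
Qed.

Lemma leading_1 k : (k <= n)%N -> leading_mx (entry_or0 (1%:M : 'M[K]_n)) k = 1%:M.
Proof.
move=> lekn; apply/matrixP => i j; rewrite !mxE /entry_or0.
rewrite (insubT (fun i => (i < n)%N) (leq_trans (ltn_ord i) lekn)).
by rewrite (insubT (fun i => (i < n)%N) (leq_trans (ltn_ord j) lekn)) mxE.
Qed.

(* SO(Q) is connected by rational curves, because each even product of
   reflections is joined to 1 by moving all the vectors to the same one; and
   the big cell is open and contains 1. *)
Lemma SO_density (F : mxfun K n) : (0 < n)%N ->
    (forall g, SO Q g -> in_big_cell g -> mxeval F g = 0) ->
  forall g, SO Q g -> mxeval F g = 0.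
Proof.
move=> n_gt0 F0 g /(SO_curve n_gt0)[h [G [hh hG [h0 <-] [h1 G1] GSO]]].
have [f hf fE] := mxeval_scaled (leqnn (msize F)) hh hG.
pose m k s := \det (leading_mx (entry_or0 (invmx P *m G s *m P)) k).
have hm k : poly_fun (m k).
  apply: poly_fun_det => i j.
  apply: (@eq_poly_fun _ (fun s => entry_or0 (invmx P *m G s *m P) i j)).
    by move=> s; rewrite mxE.
  rewrite /entry_or0; case: insub => [i'|]; last exact: poly_fun_cst.
  case: insub => [j'|]; last exact: poly_fun_cst.
  suff hPG : poly_mx (fun s => invmx P *m G s *m P) by apply: hPG.
  by apply: poly_mxM; [apply: poly_mxM => // |]; apply: poly_mx_cst.
pose H s := h s * \prod_(k < n.+1) m k s.
suff f0 : f 0 = 0.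
  have /eqP := fE 0 h0; rewrite f0 mulf_eq0 expf_eq0 (negPf h0) andbF.
  by move/eqP.
apply: (@poly_fun_generic _ infK f H 1) => //.
- by apply: poly_funM => //; apply: poly_fun_prod.
- rewrite mulf_neq0 //; apply/prodf_neq0 => k _.
  have GE1 : G 1 = h 1 *: 1%:M by rewrite -G1 scalerA mulfV // scale1r.
  rewrite /m GE1 -scalemxAr mulmx1 -scalemxAl mulVmx ?witt_unit //.
  by rewrite leading_scale leading_1 -1?ltnS // detZ det1 mulr1 expf_neq0.
move=> s; rewrite mulf_eq0 negb_or => /andP[hs /prodf_neq0 ms].
rewrite -fE // F0 ?mulr0 //; first exact: GSO.
move=> k lekn; rewrite -scalemxAr -scalemxAl leading_scale detZ.
rewrite mulf_neq0 ?expf_neq0 ?invr_neq0 //.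
by have := ms (inord k) isT; rewrite /m inordK.
Qed.

End WittBasis.

(** * Weights and highest weight vectors *)

Section MatrixPolynomials.

Variable K : fieldType.
Hypothesis infK : infinite_field K.

(** Every larger bound is allowed, so that several curves can be expanded to a common length. *)
Lemma poly_mx_expand m n (A : K -> 'M[K]_(m, n)) : poly_mx A ->
  exists d (M : nat -> 'M[K]_(m, n)), forall d', (d <= d')%N ->
    forall s, A s = \sum_(k < d') s ^+ k *: M k.
Proof.
move=> hA.
have [p pE] : exists p : 'I_m -> 'I_n -> {poly K}, forall i j s, A s i j = (p i j).[s].
  have h i : exists q : 'I_n -> {poly K}, forall j s, A s i j = (q j).[s].
    by apply: (fin_all_exists (P := fun j q => forall s, A s i j = q.[s])) => j; apply: hA.
  exact: (fin_all_exists (P := fun i q => forall j s, A s i j = (q j).[s])).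
exists (\max_i \max_j size (p i j)), (fun k => \matrix_(i, j) (p i j)`_k).
move=> d' led s; apply/matrixP => i j; rewrite pE summxE.
rewrite (@horner_coef_wide _ d'); first by apply: eq_bigr => k _; rewrite !mxE mulrC.
apply: leq_trans led; apply: leq_trans (leq_bigmax i).
exact: (leq_bigmax (F := fun j => size (p i j)) j).
Qed.

Lemma mx_poly_eq m n d (A B : nat -> 'M[K]_(m, n)) :
    (forall s, s != 0 ->
      \sum_(k < d) s ^+ k *: A k = \sum_(k < d) s ^+ k *: B k) ->
  forall k, (k < d)%N -> A k = B k.
Proof.
move=> eqAB k ltkd; apply/matrixP => i j.
pose p (M : nat -> 'M[K]_(m, n)) := \poly_(k < d) M k i j.
have pE M s : (p M).[s] = (\sum_(k < d) s ^+ k *: M k) i j.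
  rewrite horner_poly summxE; apply: eq_bigr => l _.
  by rewrite mxE mulrC.
have eq_p : p A = p B.
  apply/eqP; rewrite -subr_eq0; apply/eqP/infK => s.
  apply: (@poly_fun_generic _ infK (fun s => (p A - p B).[s]) id 1).
  - by exists (p A - p B).
  - exact: poly_fun_id.
  - exact: oner_neq0.
  by move=> x x0; rewrite hornerD hornerN !pE eqAB // subrr.
by have /(congr1 (fun q : {poly K} => q`_k)) := eq_p; rewrite !coef_poly ltkd.
Qed.

End MatrixPolynomials.

Section Torus.

Variables (K : fieldType) (n : nat).

Implicit Type t : 'I_n./2 -> K.

Lemma torus_coord_cases (i : nat) :
  [\/ exists k, forall t, torus_coord t i = t k,
      exists k, forall t, torus_coord t i = (t k)^-1
    | forall t, torus_coord t i = 1].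
Proof.
rewrite /torus_coord; case: insub => [k|]; first by constructor 1; exists k.
by case: insub => [k|]; [constructor 2; exists k | constructor 3].
Qed.

Lemma eq_torus_mx t t' : t =1 t' -> torus_mx t = torus_mx t' :> 'M_n.
Proof.
move=> tt'; congr diag_mx; apply/rowP => i; rewrite !mxE.
by case: (torus_coord_cases i) => [[k E]|[k E]|E]; rewrite !E ?tt'.
Qed.

Lemma torus_mxM t t' :
  torus_mx t *m torus_mx t' = torus_mx (fun k => t k * t' k) :> 'M_n.
Proof.
rewrite mulmx_diag; congr diag_mx; apply/rowP => i; rewrite !mxE.
by case: (torus_coord_cases i) => [[k E]|[k E]|E]; rewrite !E ?mulr1 // invfM.
Qed.

Lemma torus_mx1 : torus_mx (fun=> 1) = 1%:M :> 'M[K]_n.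
Proof.
rewrite -[RHS]diag_const_mx; congr diag_mx; apply/rowP => i; rewrite !mxE.
by case: (torus_coord_cases i) => [[k E]|[k E]|E]; rewrite !E ?invr1.
Qed.

Definition one_param (j : 'I_n./2) (s : K) (k : 'I_n./2) : K :=
  if k == j then s else 1.

Lemma one_param_neq0 j s k : s != 0 -> one_param j s k != 0.
Proof. by move=> s0; rewrite /one_param; case: (k == j); rewrite ?oner_neq0. Qed.

Lemma poly_mx_one_param j : exists2 G : K -> 'M[K]_n, poly_mx G &
  forall s, s != 0 -> torus_mx (one_param j s) = s^-1 *: G s.
Proof.
pose c (i : nat) s : K :=
  if insub i is Some k then (if k == j then s * s else s)
  else if insub (n.-1 - i)%N is Some k then (if k == j then 1 else s) else s.
exists (fun s => diag_mx (\row_(i < n) c i s)).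
  move=> i k; apply: (@eq_poly_fun _ (fun s => c i s *+ (i == k))).
    by move=> s; rewrite !mxE.
  have ps := @poly_fun_id K; have p1 := @poly_fun_cst K 1.
  case: eqP => _; last exact: poly_fun_cst.
  rewrite /c; case: insub => [l|]; first by case: (l == j) => //; apply: poly_funM.
  by case: insub => [l|] //; case: (l == j).
move=> s s0; apply/matrixP => i k; rewrite !mxE; case: eqP => _; last by rewrite !mulr0n mulr0.
rewrite !mulr1n /torus_coord /one_param /c.
case: insub => [l|]; first by case: (l == j); rewrite ?mulKf ?mulVf.
case: insub => [l|]; last by rewrite mulVf.
by case: (l == j); rewrite ?mulr1 ?invr1 ?mulVf.
Qed.

(* A cocharacter that is positive on all simple roots. *)
Definition rho_param (s : K) (k : 'I_n./2) : K := s ^+ (n.-1 - k.*2).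

(** The exponent of [s] with which [rho_param s] acts on vectors of weight [mu]. *)
Definition degree (mu : weight n) : int :=
  \sum_(k < n./2) mu 0 k * (n.-1 - k.*2)%N%:Z.

Lemma weight_val_rho mu s : s != 0 -> weight_val mu (rho_param s) = s ^ degree mu.
Proof.
move=> s0; rewrite /weight_val /degree /rho_param.
elim/big_rec2: _ => [|k x y _ ->]; first by rewrite expr0z.
by rewrite expfzDr // [mu 0 k * _]mulrC -exprz_exp.
Qed.

End Torus.

Section Representation.

Variables (K : fieldType) (n : nat) (Q : 'cV[K]_n -> K) (P : 'M[K]_n).
Hypotheses (quadQ : quadratic_form Q) (two_neq0 : 2%:R != 0 :> K).
Hypotheses (wittP : witt_basis Q P) (infK : infinite_field K).
Variables (N : nat) (L : ratrep (SO Q) N).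

Definition rho_mx (M : 'M[K]_n) : 'M[K]_N := rep_act L (witt_conj P M).

Lemma rhoM A B : witt_SO A -> witt_SO B -> rho_mx (A *m B) = rho_mx A *m rho_mx B.
Proof.
move=> hA hB; rewrite /rho_mx (witt_conjM quadQ wittP).
by apply: rep_actM; apply/(SO_witt_conj quadQ two_neq0 wittP).
Qed.

Lemma rho1 : rho_mx 1%:M = 1%:M.
Proof. by rewrite /rho_mx (witt_conj1 quadQ wittP) rep_act1. Qed.

Lemma rho_torusM t t' : (forall k, t k != 0) -> (forall k, t' k != 0) ->
  rho_mx (torus_mx (fun k => t k * t' k)) = rho_mx (torus_mx t) *m rho_mx (torus_mx t').
Proof. by move=> t0 t'0; rewrite -torus_mxM rhoM //; apply: witt_SO_torus. Qed.

Lemma poly_mx_rho A : poly_mx A -> poly_mx (fun s => rho_mx (A s)).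
Proof.
move=> hA i j; apply: (@eq_poly_fun _ (fun s => mxeval (rep_coef L i j) (witt_conj P (A s)))).
  by move=> s; rewrite /rho_mx mxE.
apply: poly_fun_mxeval; apply: poly_mxM; last exact: poly_mx_cst.
by apply: poly_mxM => //; apply: poly_mx_cst.
Qed.

Lemma rho_one_param j : exists D d (M : nat -> 'M[K]_N),
  forall d', (d <= d')%N -> forall s, s != 0 ->
    s ^+ D *: rho_mx (torus_mx (one_param j s)) = \sum_(k < d') s ^+ k *: M k.
Proof.
have [G hG GE] := @poly_mx_one_param K n j.
pose D := (\max_i \max_k msize (rep_coef L i k))%N.
have hPG : poly_mx (fun s => witt_conj P (G s)).
  apply: poly_mxM; last exact: poly_mx_cst.
  by apply: poly_mxM => //; apply: poly_mx_cst.
have [A AE] : exists A : 'I_N -> 'I_N -> K -> K, forall i k, poly_fun (A i k) /\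
    forall s, s != 0 -> s ^+ D * mxeval (rep_coef L i k) (s^-1 *: witt_conj P (G s)) = A i k s.
  apply: (fin_all_exists (P := fun i (B : 'I_N -> K -> K) => forall k, poly_fun (B k) /\
    forall s, s != 0 -> s ^+ D * mxeval (rep_coef L i k) (s^-1 *: witt_conj P (G s)) = B k s)) => i.
  apply: (fin_all_exists (P := fun k f => poly_fun f /\ forall s, s != 0 ->
    s ^+ D * mxeval (rep_coef L i k) (s^-1 *: witt_conj P (G s)) = f s)) => k.
  have [|f hf fE] := @mxeval_scaled _ _ (rep_coef L i k) D id _ _ (poly_fun_id K) hPG.
    apply: leq_trans (leq_bigmax (F := fun i => \max_k msize (rep_coef L i k)) i).
    exact: (leq_bigmax (F := fun k => msize (rep_coef L i k)) k).
  by exists f.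
have hA : poly_mx (fun s => \matrix_(i, k) A i k s).
  move=> i k; apply: (@eq_poly_fun _ (A i k)); first by move=> s; rewrite mxE.
  by case: (AE i k).
have [d [M ME]] := poly_mx_expand hA.
exists D, d, M => d' led s s0; rewrite -ME //; apply/matrixP => i k.
rewrite !mxE; have [_ <-] := AE i k => //.
by rewrite /witt_conj GE // -scalemxAr -scalemxAl.
Qed.

(** Write R(s) for the image of the one-parameter subgroup. Comparing coefficients of powers of t in
    R(s) R(t) = R(st) shows that R(s) acts on the image of [M k] by s^(k - D); the value at s = 1
    gives the partition of unity. *)
Lemma rho_one_param_eigen j D d (M : nat -> 'M[K]_N) :
    (forall s, s != 0 ->
      s ^+ D *: rho_mx (torus_mx (one_param j s)) = \sum_(k < d) s ^+ k *: M k) ->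
  \sum_(k < d) M k = 1%:M /\
  forall k s, (k < d)%N -> s != 0 ->
    s ^+ D *: (rho_mx (torus_mx (one_param j s)) *m M k) = s ^+ k *: M k.
Proof.
move=> ME; split.
  have := ME 1 (oner_neq0 _); rewrite expr1n scale1r.
  under eq_bigr do rewrite expr1n scale1r.
  move=> <-; rewrite (@eq_torus_mx _ _ _ (fun=> 1)) ?torus_mx1 ?rho1 // => k.
  by rewrite /one_param if_same.
move=> k s ltkd s0.
apply: (@mx_poly_eq _ infK _ _ d
  (fun k => s ^+ D *: (rho_mx (torus_mx (one_param j s)) *m M k))
  (fun k => s ^+ k *: M k)) => // t t0.
have -> : \sum_(l < d) t ^+ l *: (s ^+ D *: (rho_mx (torus_mx (one_param j s)) *m M l)) =
    s ^+ D *: (rho_mx (torus_mx (one_param j s)) *m \sum_(l < d) t ^+ l *: M l).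
  rewrite mulmx_sumr scaler_sumr; apply: eq_bigr => l _.
  by rewrite -scalemxAr !scalerA mulrC.
rewrite -ME // -scalemxAr scalerA -exprMn -rho_torusM; last 2 first.
- by move=> l; apply: one_param_neq0.
- by move=> l; apply: one_param_neq0.
rewrite (@eq_torus_mx _ _ _ (one_param j (s * t))) => [|l]; last first.
  by rewrite /one_param; case: (l == j); rewrite ?mulr1.
rewrite ME ?mulf_neq0 //; apply: eq_bigr => l _.
by rewrite scalerA -exprMn mulrC.
Qed.

(* Products of the spectral projections of the one-parameter subgroups
   [t |-> torus_mx (one_param j t)], which commute. *)
Lemma weight_decomposition :
  exists (I : finType) (mu : I -> weight n) (E : I -> 'M[K]_N),
    \sum_i E i = 1%:M /\
    forall i t, (forall k, t k != 0) ->
      rho_mx (torus_mx t) *m E i = weight_val (mu i) t *: E i.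
Proof.
have [D0 D0E] : exists D : 'I_n./2 -> nat, forall j, exists d (M : nat -> 'M[K]_N),
  forall d', (d <= d')%N -> forall s, s != 0 ->
    s ^+ D j *: rho_mx (torus_mx (one_param j s)) = \sum_(k < d') s ^+ k *: M k.
  exact: (fin_all_exists rho_one_param).
have [d0 {}D0E] := fin_all_exists D0E; have [M {}D0E] := fin_all_exists D0E.
pose d := (\max_j d0 j)%N.
have ME j : forall s, s != 0 ->
    s ^+ D0 j *: rho_mx (torus_mx (one_param j s)) = \sum_(k < d) s ^+ k *: M j k.
  by apply: D0E; apply: leq_bigmax.
have eigen j := rho_one_param_eigen (@ME j).
pose R j s := rho_mx (torus_mx (one_param j s)).
(* Whatever commutes with a one-parameter subgroup commutes with its coefficients; hence each
   subgroup commutes with the projections of the others. *)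
have RC j X : (forall t, t != 0 -> X *m R j t = R j t *m X) ->
    forall k, (k < d)%N -> X *m M j k = M j k *m X.
  move=> XC k ltkd.
  apply: (@mx_poly_eq _ infK _ _ d (fun k => X *m M j k) (fun k => M j k *m X)) => // t t0.
  transitivity (X *m \sum_(k < d) t ^+ k *: M j k).
    by rewrite mulmx_sumr; apply: eq_bigr => l _; rewrite scalemxAr.
  rewrite -ME // -scalemxAr XC // scalemxAl ME // mulmx_suml.
  by apply: eq_bigr => l _; rewrite scalemxAl.
have RR i j s t : s != 0 -> t != 0 -> R i s *m R j t = R j t *m R i s.
  move=> s0 t0; have s0' k := one_param_neq0 i k s0.
  have t0' k := one_param_neq0 j k t0.
  rewrite /R -(rho_torusM s0' t0') -(rho_torusM t0' s0').
  by congr rho_mx; apply: eq_torus_mx => k; rewrite mulrC.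
exists {ffun 'I_n./2 -> 'I_d},
  (fun f : {ffun 'I_n./2 -> 'I_d} => \row_j ((f j)%:Z - (D0 j)%:Z)),
  (fun f : {ffun 'I_n./2 -> 'I_d} => \prod_j (M j (f j) : 'M[K]_N)).
split.
  (* The sum of all the products is the product over [j] of the partitions of unity
     [\sum_k M j k = 1]. *)
  rewrite -(bigA_distr_bigA (fun j k => M j (nat_of_ord k))) big1 //.
  by move=> j _; have [-> _] := eigen j.
move=> f t t0; set E := \prod_j _.
have RE j s : s != 0 -> s ^+ D0 j *: (R j s *m E) = s ^+ f j *: E.
  move=> s0; rewrite /E.
  have : j \in index_enum 'I_n./2 by rewrite mem_index_enum.
  elim: (index_enum _) => // a r IH; rewrite inE big_cons.
  have [<- _|_ /= jr] := eqVneq j a.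
    have e : s ^+ D0 j *: (R j s *m M j (f j)) = s ^+ f j *: M j (f j).
      exact: (proj2 (eigen j)).
    by rewrite -!mulmxE mulmxA scalemxAl e -scalemxAl.
  rewrite -!mulmxE mulmxA (RC a) // => [|t1 t10]; last exact: RR.
  by rewrite -mulmxA scalemxAr IH // scalemxAr.
have main r : uniq r -> (\prod_(j <- r) t j ^+ D0 j) *:
    (rho_mx (torus_mx (fun k => if k \in r then t k else 1)) *m E) =
    (\prod_(j <- r) t j ^+ f j) *: E.
  elim: r => [_|a r IH /= /andP[anr ur]].
    by rewrite !big_nil !scale1r torus_mx1 rho1 mul1mx.
  rewrite !big_cons.
  have -> : torus_mx (fun k => if k \in a :: r then t k else 1) =
      torus_mx (fun k => one_param a (t a) k * if k \in r then t k else 1) :> 'M_n.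
    apply: eq_torus_mx => k; rewrite inE /one_param.
    by have [->|] := eqVneq k a; rewrite ?(negPf anr) ?mulr1 ?mul1r.
  rewrite rho_torusM => [||k]; last 2 first.
  - by move=> k; apply: one_param_neq0.
  - by case: ifP; rewrite ?oner_neq0.
  rewrite -mulmxA -scalerA scalemxAr IH // -scalemxAr !scalerA.
  by rewrite mulrC -!scalerA RE // !scalerA mulrC.
have := main _ (index_enum_uniq 'I_n./2).
rewrite (@eq_torus_mx _ _ _ t) => [eqE|k]; last by rewrite mem_index_enum.
have p0 : \prod_j t j ^+ D0 j != 0.
  by apply/prodf_neq0 => j _; rewrite expf_neq0.
apply: (can_inj (scalerK p0)); rewrite eqE scalerA; congr (_ *: _).
rewrite /weight_val -big_split; apply: eq_bigr => j _ /=.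
by rewrite mxE addrC expfzDr // -invr_expz mulVKf // expf_neq0.
Qed.

End Representation.

Section Degree.

Import Order.TTheory Num.Theory.

Variable n : nat.

Lemma degreeD (x y : weight n) : degree (x + y) = degree x + degree y.
Proof.
by rewrite /degree -big_split; apply: eq_bigr => k _; rewrite mxE mulrDl.
Qed.

Lemma degree0 : degree (0 : weight n) = 0.
Proof. by rewrite /degree big1 // => k _; rewrite mxE mul0r. Qed.

Lemma degree_simple_root_ge0 (i : 'I_n./2) : 0 <= degree (simple_root i).
Proof.
rewrite /degree; have [lti|gei] := ltnP i.+1 n./2; last first.
  apply: sumr_ge0 => k _; rewrite mxE ltnNge gei /=.
  by apply: mulr_ge0 => //; case: odd => //; rewrite addr_ge0.
pose i' : 'I_n./2 := Ordinal lti.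
have i'i : i != i' by rewrite -(inj_eq val_inj) /= ltn_eqF.
rewrite (bigD1 i) //= (bigD1 i') ?(eq_sym i') //= big1 ?addr0 => [|k /andP[ki ki']].
  rewrite !mxE lti !eqxx (eq_sym i') (negPf i'i) /= ltn_eqF // subr0 mul1r.
  by rewrite add0r mulN1r subr_ge0 lez_nat leq_sub2l // leq_double.
by rewrite mxE lti (negPf ki) -[_ == _ :> nat]/(val k == val i') (inj_eq val_inj)
  (negPf ki') subrr mul0r.
Qed.

(** Simple roots have nonnegative degree, so subtracting them cannot raise it. This turns the
    dominance order into an inequality between exponents of [s]. *)
Lemma degree_weight_le (mu la : weight n) : weight_le mu la -> degree mu <= degree la.
Proof.
move=> [c e]; have -> : la = mu + \sum_i simple_root i *+ c i by rewrite -e addrC subrK.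
rewrite degreeD lerDl (big_morph _ degreeD degree0); apply: sumr_ge0 => i _.
elim: (c i) => [|k IH]; first by rewrite mulr0n degree0.
by rewrite mulrS degreeD addr_ge0 // degree_simple_root_ge0.
Qed.

End Degree.

Section Contraction.

Variables (K : fieldType) (n : nat).

Lemma rho_param_neq0 s (k : 'I_n./2) : s != 0 -> rho_param s k != 0 :> K.
Proof. by move=> s0; rewrite expf_neq0. Qed.

Lemma torus_coord_rho (s : K) (i j : 'I_n) : s != 0 -> (i <= j)%N ->
  torus_coord (rho_param s : 'I_n./2 -> K) i =
  s ^+ (j - i).*2 * torus_coord (rho_param s : 'I_n./2 -> K) j.
Proof.
move=> s0 ij; have lt_jn := ltn_ord j.
pose c (i : nat) : K := s ^ ((n.-1)%:Z - (i.*2)%:Z).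
have cE (k : 'I_n) : torus_coord (rho_param s : 'I_n./2 -> K) k = c k.
  have lt_kn := ltn_ord k; rewrite /torus_coord.
  case: insubP => [l kl lE|nk]; first by rewrite /rho_param lE /c subzn //; lia.
  case: insubP => [l kl lE|nk'].
    rewrite /rho_param lE /c exprnP invr_expz; congr (_ ^ _).
    rewrite -subzn; last by lia.
    by rewrite opprB; lia.
  by rewrite /c (_ : k.*2 = n.-1) ?subrr ?expr0z //; lia.
rewrite !cE /c exprnP -expfzDr //; congr (_ ^ _); lia.
Qed.

(** Conjugate of an upper unitriangular [U] by [rho_param s], written so that s = 0 makes sense: the
    truncated difference [j - i] gives exponent 0 on and below the diagonal, and the limit is the
    identity. *)
Definition contract (U : 'M[K]_n) (s : K) : 'M[K]_n :=
  \matrix_(i, j) (s ^+ (j - i).*2 * U i j).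

Lemma poly_mx_contract U : poly_mx (contract U).
Proof.
move=> i j; apply: (@eq_poly_fun _ (fun s => s ^+ (j - i).*2 * U i j)).
  by move=> s; rewrite mxE.
by apply: poly_funM; [apply/poly_funX/poly_fun_id | apply: poly_fun_cst].
Qed.

Lemma contract1 U : contract U 1 = U.
Proof. by apply/matrixP => i j; rewrite mxE expr1n mul1r. Qed.

Lemma contract0 U : lower1 U^T -> contract U 0 = 1%:M.
Proof.
move=> lU; apply/matrixP => i j; rewrite !mxE expr0n double_eq0 subn_eq0.
have := lU j i; rewrite mxE; case: ltngtP => [ij|ij|/val_inj->] h.
- by rewrite h ?mul1r 1?ltnW // eq_sym.
- by rewrite mul0r (_ : i == j = false) // -(inj_eq val_inj) /= ltn_eqF.
- by rewrite h // mul1r.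
Qed.

Lemma contractP U s : lower1 U^T -> s != 0 ->
  torus_mx (rho_param s) *m U = contract U s *m torus_mx (rho_param s).
Proof.
move=> lU s0; apply/matrixP => i j; rewrite mul_diag_mx mul_mx_diag !mxE.
have [ij|ji] := leqP i j; first by rewrite (torus_coord_rho s0 ij); ring.
have -> : U i j = 0.
  have := lU j i (ltnW ji); rewrite mxE => ->.
  by rewrite (_ : j == i = false) // -(inj_eq val_inj) /= ltn_eqF.
by rewrite !mulr0 mul0r.
Qed.

Lemma contract_trP L s : lower1 L -> s != 0 ->
  L *m torus_mx (rho_param s) = torus_mx (rho_param s) *m (contract L^T s)^T.
Proof.
move=> lL s0; have lLt : lower1 L^T^T by rewrite trmxK.
have := congr1 trmx (contractP lLt s0); rewrite !trmx_mul trmxK.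
by rewrite tr_diag_mx.
Qed.

End Contraction.

Section HighestWeight.

Import Order.TTheory Num.Theory.

Variables (K : fieldType) (n : nat) (Q : 'cV[K]_n -> K) (P : 'M[K]_n).
Hypotheses (quadQ : quadratic_form Q) (two_neq0 : 2%:R != 0 :> K).
Hypotheses (wittP : witt_basis Q P) (infK : infinite_field K).
Variables (N : nat) (L : ratrep (SO Q) N) (la : weight n).
Hypothesis laP : highest_weight P L la.

Local Notation R := (rho_mx P L).
Local Notation h s := (torus_mx (rho_param s)).

Lemma torus_mxV (t : 'I_n./2 -> K) : (forall k, t k != 0) ->
  torus_mx t *m torus_mx (fun k => (t k)^-1) = 1%:M :> 'M_n.
Proof.
move=> t0; rewrite torus_mxM -torus_mx1; apply: eq_torus_mx => k.
by rewrite mulfV.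
Qed.

Lemma witt_SO_contract (U : 'M[K]_n) s : lower1 U^T -> adj U *m U = 1%:M -> s != 0 ->
  witt_SO (contract U s).
Proof.
move=> lU UI s0; have t0 (k : 'I_n./2) := rho_param_neq0 k s0.
have -> : contract U s = h s *m U *m torus_mx (fun k => (rho_param s k)^-1).
  by rewrite contractP // -mulmxA torus_mxV // mulmx1.
apply: (witt_SOM quadQ two_neq0 wittP); last first.
  by apply: witt_SO_torus => k; rewrite invr_neq0.
apply: (witt_SOM quadQ two_neq0 wittP); first exact: witt_SO_torus.
exact: witt_SO_upper1.
Qed.

Lemma witt_SO_contract_tr (M : 'M[K]_n) s : lower1 M -> adj M *m M = 1%:M -> s != 0 ->
  witt_SO (contract M^T s)^T.
Proof.
move=> lM MI s0; have t0 (k : 'I_n./2) := rho_param_neq0 k s0.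
have -> : (contract M^T s)^T = torus_mx (fun k => (rho_param s k)^-1) *m (M *m h s).
  by rewrite contract_trP // mulmxA (mulmx1C (torus_mxV t0)) mul1mx.
apply: (witt_SOM quadQ two_neq0 wittP).
  by apply: witt_SO_torus => k; rewrite invr_neq0.
apply: (witt_SOM quadQ two_neq0 wittP); last exact: witt_SO_torus.
exact: witt_SO_lower1.
Qed.

(* Conjugation by [h s] contracts U to 1 as s tends to 0, while it multiplies
   the weight components of [R U v] by nonpositive powers of s; hence
   [R U v = v]. Likewise the component of top degree of [R M v] is v. *)
Lemma highest_weight_coef : exists (phi : 'rV[K]_N) (v : 'cV[K]_N),
  forall M t U, (forall k, t k != 0) ->
    lower1 M -> adj M *m M = 1%:M -> lower1 U^T -> adj U *m U = 1%:M ->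
  phi *m R (M *m torus_mx t *m U) *m v = (weight_val la t)%:M.
Proof.
have [[v v0 vE] la_max] := laP.
have {}vE t : (forall k, t k != 0) -> R (torus_mx t) *m v = weight_val la t *: v.
  by move=> t0; apply: vE.
have [I [mu [E [sumE EE]]]] := weight_decomposition quadQ two_neq0 wittP infK L.
have degE i : E i = 0 \/ degree (mu i) <= degree la.
  have [->|Ei] := eqVneq (E i) 0; [by left | right].
  apply/degree_weight_le/la_max.
  have [j Eij] : exists j, col j (E i) != 0.
    apply/existsP; apply: contraR Ei; rewrite negb_exists => /forallP colE0.
    apply/eqP/matrixP => a b; have /eqP/colP/(_ a) := negbNE (colE0 b).
    by rewrite !mxE.
  exists (col j (E i)) => // t t0.
  by rewrite colE mulmxA (EE i t t0) scalemxAl.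
(* The absolute value only turns a nonnegative difference into a natural number: [degE] bounds the
   degree whenever [E i] is nonzero. *)
pose e i := `|degree la - degree (mu i)|%N.
have eE i s : s != 0 -> R (h s) *m E i *+ 1 = (s ^ degree la * s^-1 ^+ e i) *: E i.
  move=> s0; rewrite mulr1n EE => [|k]; last exact: rho_param_neq0.
  rewrite weight_val_rho //; case: (degE i) => [->|le_deg]; first by rewrite !scaler0.
  congr (_ *: _); rewrite exprVn exprnP invr_expz -expfzDr //.
  by rewrite gez0_abs ?subr_ge0 // opprB addrC subrK.
have RhE y s : s != 0 ->
    R (h s) *m y = s ^ degree la *: \sum_i s^-1 ^+ e i *: (E i *m y).
  move=> s0; rewrite -[y in LHS]mul1mx -sumE mulmx_suml mulmx_sumr scaler_sumr.
  apply: eq_bigr => i _; have := eE i s s0; rewrite mulr1n => eEi.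
  by rewrite mulmxA eEi -scalemxAl scalerA.
have hSO s : s != 0 -> witt_SO (h s) by move=> s0; apply: witt_SO_torus => k; apply: rho_param_neq0.
have hv s : s != 0 -> R (h s) *m v = s ^ degree la *: v.
  by move=> s0; rewrite vE ?weight_val_rho // => k; apply: rho_param_neq0.
have RU U : lower1 U^T -> adj U *m U = 1%:M -> R U *m v = v.
  move=> lU UI; apply/colP => a.
  pose f s := (R (contract U s) *m v) a 0.
  pose g s := \sum_i s ^+ e i * (E i *m (R U *m v)) a 0.
  have hf : poly_fun f.
    suff hm : poly_mx (fun s => R (contract U s) *m v) by apply: hm.
    apply: poly_mxM; last exact: poly_mx_cst.
    exact/poly_mx_rho/poly_mx_contract.
  have hg : poly_fun g.
    apply: poly_fun_sum => i; apply: poly_funM; last exact: poly_fun_cst.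
    exact/poly_funX/poly_fun_id.
  have fg s : s != 0 -> f s = g s^-1.
    move=> s0; have sd : s ^ degree la != 0 by rewrite expfz_eq0 (negPf s0) andbF.
    have key : R (contract U s) *m v = \sum_i s^-1 ^+ e i *: (E i *m (R U *m v)).
      apply: (can_inj (scalerK sd)); rewrite -RhE // mulmxA.
      rewrite -(rhoM quadQ two_neq0 wittP) //; [|exact: hSO|exact: witt_SO_upper1].
      rewrite contractP // (rhoM quadQ two_neq0 wittP).
      - by rewrite -mulmxA hv // scalemxAr.
      - exact: witt_SO_contract.
      - exact: hSO.
    rewrite /f key summxE /g; apply: eq_bigr => i _.
    by rewrite mxE.
  have := poly_fun_inv_const infK hf hg fg 1.
  by rewrite /f contract1 contract0 // (rho1 quadQ wittP) mul1mx.
have RM M : lower1 M -> adj M *m M = 1%:M ->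
    \sum_(i | e i == 0%N) E i *m (R M *m v) = v.
  move=> lM MI; apply/colP => a.
  pose f s := (R (contract M^T s)^T *m v) a 0.
  pose g s := \sum_i s ^+ e i * (E i *m (R M *m v)) a 0.
  have hf : poly_fun f.
    suff hm : poly_mx (fun s => R (contract M^T s)^T *m v) by apply: hm.
    apply: poly_mxM; last exact: poly_mx_cst.
    exact/poly_mx_rho/poly_mx_tr/poly_mx_contract.
  have hg : poly_fun g.
    apply: poly_fun_sum => i; apply: poly_funM; last exact: poly_fun_cst.
    exact/poly_funX/poly_fun_id.
  have fg s : s != 0 -> f s = g s.
    move=> s0; have s0' : s^-1 != 0 by rewrite invr_neq0.
    have key : R (contract M^T s)^T *m v = \sum_i s ^+ e i *: (E i *m (R M *m v)).
      have hh : h s^-1 *m h s = 1%:M :> 'M_n.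
        rewrite torus_mxM -torus_mx1; apply: eq_torus_mx => k.
        by rewrite /rho_param -exprMn mulVf // expr1n.
      have sMs := witt_SO_contract_tr lM MI s0.
      have e1 : R (h s^-1) *m (R M *m (R (h s) *m v)) = R (contract M^T s)^T *m v.
        rewrite (mulmxA (R M)) -(rhoM quadQ two_neq0 wittP) //; last 2 first.
        - exact: witt_SO_lower1.
        - exact: hSO.
        rewrite contract_trP // (rhoM quadQ two_neq0 wittP) //; last exact: hSO.
        rewrite mulmxA (mulmxA (R (h s^-1))) -(rhoM quadQ two_neq0 wittP) ?hh.
        - by rewrite (rho1 quadQ wittP) mul1mx.
        - exact: hSO.
        - exact: hSO.
      rewrite -e1 hv // -!scalemxAr RhE // invrK scalerA -expfzMl mulfV //.
      by rewrite exp1rz scale1r.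
    rewrite /f key summxE /g; apply: eq_bigr => i _.
    by rewrite mxE.
  have := eq_poly_fun_nz infK hf hg fg 0.
  rewrite /f contract0 ?trmxK // trmx1 (rho1 quadQ wittP) mul1mx => ->.
  rewrite /g summxE [RHS](bigID (fun i => e i == 0%N)) /= [X in _ = _ + X]big1.
    rewrite addr0; apply: eq_bigr => i /eqP->.
    by rewrite expr0 mul1r.
  by move=> i /negPf ei; rewrite expr0n ei mul0r.
have /existsP[a va] : [exists a, v a 0 != 0].
  apply: contraR v0; rewrite negb_exists => /forallP va.
  by apply/eqP/colP => a; rewrite mxE; apply/eqP/negbNE.
(* Projection onto the components of top degree. It sends [R M *m v] to [v], so one of its rows,
   normalized at a nonzero coordinate of [v], is the required form. *)
pose pi := \sum_(i | e i == 0%N) E i.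
exists ((v a 0)^-1 *: row a pi), v => M t U t0 lM MI lU UI.
rewrite (rhoM quadQ two_neq0 wittP); last 2 first.
- by apply: (witt_SOM quadQ two_neq0 wittP); [apply: witt_SO_lower1 | apply: witt_SO_torus].
- exact: witt_SO_upper1.
rewrite -mulmxA -(mulmxA _ (R U)) RU //.
rewrite (rhoM quadQ two_neq0 wittP) //; [|exact: witt_SO_lower1|exact: witt_SO_torus].
rewrite -(mulmxA (R M)) vE // -!scalemxAr -scalemxAl -row_mul mulmx_suml RM //.
by apply/matrixP => i j; rewrite !ord1 !mxE mulVf // mulr1 eqxx mulr1n.
Qed.

End HighestWeight.

Section FundamentalWeight.

Variable n : nat.
Hypothesis n_ge5 : (5 <= n)%N.

Lemma wdot_simple_root (x : weight n) (i j : 'I_n./2) : j = i.+1 :> nat ->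
  wdot x (simple_root i) = x 0 i - x 0 j.
Proof.
move=> ji; have lti : (i.+1 < n./2)%N by rewrite -ji.
have ij : i != j by rewrite -(inj_eq val_inj) /= ji ltn_eqF.
rewrite /wdot (bigD1 i) //= (bigD1 j) ?(eq_sym j) //= big1 => [|k /andP[ki kj]].
  rewrite !mxE lti !eqxx -!ji (eq_sym j) (negPf ij) /= eqxx (inj_eq val_inj) (negPf ij).
  by rewrite addr0 subr0 mulr1 add0r mulrN1.
by rewrite mxE lti (negPf ki) -ji (inj_eq val_inj) (negPf kj) subrr mulr0.
Qed.

Lemma wdot_simple_root_last (x : weight n) (i : 'I_n./2) : i.+1 = n./2 ->
  odd n -> wdot x (simple_root i) = x 0 i.
Proof.
move=> il on; rewrite /wdot (bigD1 i) //= big1 ?addr0 => [|k ki].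
  by rewrite mxE il ltnn on eqxx mulr1.
by rewrite mxE il ltnn on (negPf ki) mulr0.
Qed.

Lemma wdot_simple_root_lastD (x : weight n) (i j : 'I_n./2) : i.+1 = n./2 ->
  j.+1 = i -> ~~ odd n -> wdot x (simple_root i) = x 0 i + x 0 j.
Proof.
move=> il ji on; have ij : i != j by rewrite -(inj_eq val_inj) /= -ji gtn_eqF.
rewrite /wdot (bigD1 i) //= (bigD1 j) ?(eq_sym j) //= big1 => [|k /andP[ki kj]].
  rewrite !mxE il ltnn (negPf on) !eqxx ji eqxx (eq_sym j) (negPf ij) /=.
  by rewrite gtn_eqF // !addr0 add0r !mulr1.
rewrite mxE il ltnn (negPf on) (negPf ki) -ji eqSS.
by rewrite (inj_eq val_inj) (negPf kj) addr0 mulr0.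
Qed.

(** All coordinates after the first are equal by the middle roots, and the last root makes them 0:
    directly in type B, and in type D because two equal coordinates have sum 0. That argument needs
    rank at least 3 in type D, which n >= 5 ensures. The first root then gives 1. *)
Lemma fundamental_weight1 (varpi : weight n) : fundamental_weight 1 varpi ->
  forall k : 'I_n./2, varpi 0 k = (k == 0 :> nat)%:R.
Proof.
move=> fw.
have step (i j : 'I_n./2) : j = i.+1 :> nat -> (0 < i)%N -> varpi 0 i = varpi 0 j.
  move=> ji i0; have := fw i; rewrite (wdot_simple_root _ ji) eqSS gtn_eqF //.
  by move/eqP; rewrite mulf_eq0 /= subr_eq0 => /eqP.
have w0 m (k : 'I_n./2) : (k + m.+1 = n./2)%N -> (0 < k)%N -> varpi 0 k = 0.
  elim: m k => [|m IH] k km k0; last first.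
    have lt_k : (k.+1 < n./2)%N by clear -km; lia.
    rewrite (step k (Ordinal lt_k)) //; apply: IH => //=; lia.
  rewrite addn1 in km; have := fw k; rewrite eqSS gtn_eqF //.
  have [on|en] := boolP (odd n).
    by rewrite wdot_simple_root_last // => /eqP; rewrite mulf_eq0 /= => /eqP.
  have lt_j : (k.-1 < n./2)%N by lia.
  pose j := Ordinal lt_j.
  have jk : k = j.+1 :> nat by rewrite /= prednK.
  have j0 : (0 < j)%N.
    by rewrite /=; have := odd_double_half n; rewrite (negPf en) add0n; clear -km n_ge5; lia.
  have kl : k.+1 = n./2 := km.
  rewrite (wdot_simple_root_lastD _ kl (esym jk) en) (step j k jk j0).
  by move: (varpi 0 j) => x; lia.
move=> k; have [k0|] := posnP k; last first.
  move=> k0; rewrite (w0 (n./2 - k.+1)%N) //; have := ltn_ord k; lia.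
have lt1 : (1 < n./2)%N by lia.
pose k1 := Ordinal lt1.
have kk : k1 = k.+1 :> nat by rewrite k0.
have := fw k; rewrite k0 eqxx !(wdot_simple_root _ kk) // !mxE.
have -> : varpi 0 k1 = 0 by apply: (w0 (n./2 - 2)%N) => //=; lia.
rewrite k0 /= lt1 -!(inj_eq val_inj) /= k0 /= subr0 => e.
by have /eqP := e; rewrite (_ : 1%:R - 0%:R - (0%:R - 1%:R) = 2 * 1 :> int) //
  (inj_eq (mulfI _)) // => /eqP.
Qed.

End FundamentalWeight.

Section Coefficient.

Variables (K : fieldType) (n : nat) (Q : 'cV[K]_n -> K) (P : 'M[K]_n).
Hypotheses (quadQ : quadratic_form Q) (two_neq0 : 2%:R != 0 :> K).
Hypotheses (wittP : witt_basis Q P) (infK : infinite_field K).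
Hypothesis n_ge5 : (5 <= n)%N.
Variables (varpi1 : weight n) (varpi1P : fundamental_weight 1 varpi1).
Variables (N : nat) (L : ratrep (SO Q) N).
Hypothesis LP : highest_weight P L (varpi1 *+ 2).

Lemma irreducible_coef (i0 : 'I_n) : i0 = 0 :> nat ->
  exists (phi : 'rV[K]_N) (v : 'cV[K]_N), forall g, SO Q g ->
    phi *m rep_act L g *m v = ((invmx P *m g *m P) i0 i0 ^+ 2)%:M.
Proof.
move=> i00.
have [phi [v hw]] := highest_weight_coef quadQ two_neq0 wittP infK LP.
exists phi, v => g gSO; apply/matrixP => a b; rewrite !ord1 [RHS]mxE eqxx mulr1n.
apply/eqP; rewrite -subr_eq0; apply/eqP.
pose FA : mxfun K n := \sum_a \sum_b (phi 0 b * v a 0) *: rep_coef L b a.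
pose FB : mxfun K n := \sum_a \sum_b (invmx P i0 b * P a i0) *: 'X_(mxvec_index b a).
pose F := FA - FB ^+ 2.
have FE x : mxeval F x = (phi *m rep_act L x *m v) 0 0 -
                         (invmx P *m x *m P) i0 i0 ^+ 2.
  rewrite /mxeval /F mevalB rmorphXn /=; congr (_ - _ ^+ 2).
    rewrite raddf_sum mxE; apply: eq_bigr => c _.
    rewrite raddf_sum mxE mulr_suml; apply: eq_bigr => d _ /=.
    by rewrite mevalZ mxE mulrAC.
  rewrite raddf_sum mxE; apply: eq_bigr => c _.
  rewrite raddf_sum mxE mulr_suml; apply: eq_bigr => d _ /=.
  by rewrite mevalZ mevalXU mxvecE mulrAC.
rewrite -FE; move: g gSO.
apply: (SO_density quadQ two_neq0 wittP infK); first by apply: leq_trans n_ge5.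
move=> g gSO cell; rewrite FE.
set x := invmx P *m g *m P in cell *.
have gx : g = witt_conj P x by rewrite (witt_conjK quadQ wittP).
have [xI dx] : witt_SO x by apply/(SO_witt_conj quadQ two_neq0 wittP); rewrite -gx.
have [M [t [U [xE t0 [lM MI] [lU UI]]]]] := big_cell xI dx cell.
have -> : rep_act L g = rho_mx P L x by rewrite gx.
rewrite xE hw // mxE eqxx mulr1n.
have lt0 : (0 < n./2)%N by lia.
have -> : (M *m torus_mx t *m U) i0 i0 = t (Ordinal lt0).
  have MT k : (M *m torus_mx t) i0 k = (i0 == k)%:R * torus_coord t k.
    by rewrite mul_mx_diag !mxE lM // i00.
  rewrite mxE (bigD1 i0) //= big1 => [|k ki]; last first.
    by rewrite MT eq_sym (negPf ki) !mul0r.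
  rewrite MT eqxx mul1r addr0; have := lU i0 i0 (leqnn _); rewrite mxE eqxx => ->.
  rewrite mulr1 /torus_coord i00; case: insubP => [k _ k0|/negP//].
  by congr t; apply: val_inj.
rewrite /weight_val (bigD1 (Ordinal lt0)) //= big1 => [|k k0].
  by rewrite mulr1 mulmxnE fundamental_weight1 // eqxx subrr.
have kn0 : (k == 0 :> nat) = false by apply/negbTE.
by rewrite mulmxnE fundamental_weight1 // kn0 mul0rn expr0z.
Qed.

End Coefficient.

(** * Symmetric matrices modulo the form as a model of L(2 varpi_1) *)

Section LinearAlgebra.

Variable K : fieldType.

Lemma linfun_linE (aT rT : vectType K) (f : aT -> rT) (lf : linear f) :
  linfun f =1 f.
Proof.
pose g : {linear aT -> rT} := HB.pack f (GRing.isLinear.Build K aT rT *:%R f lf).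
exact: (lfunE g).
Qed.

Lemma subvP_img (aT rT : vectType K) (f : aT -> rT) (lf : linear f)
    (U : {vspace aT}) (W : {vspace rT}) :
  (forall x, x \in U -> f x \in W) -> (linfun f @: U <= W)%VS.
Proof.
move=> fUW; apply/subvP => y /memv_imgP[x xU ->].
by rewrite (linfun_linE lf) fUW.
Qed.

(** A finite family in [Pd] is enlarged until it spans or exceeds the dimension. As [Pd] is an
    arbitrary proposition, each step decides by excluded middle. *)
Lemma span_exists (vT : vectType K) (Pd : vT -> Prop) :
  exists U : {vspace vT}, (forall x, Pd x -> x \in U) /\
    forall W : {vspace vT}, (forall x, Pd x -> x \in W) -> (U <= W)%VS.
Proof.
have step k : exists s : seq vT, (forall x, x \in s -> Pd x) /\
    ((forall x, Pd x -> x \in <<s>>%VS) \/ (k <= \dim <<s>>)%N).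
  elim: k => [|k [s [sP [all_s|dim_s]]]].
  - by exists [::]; split=> //; right.
  - by exists s; split=> //; left.
  have [[x [Px xs]]|nex] := classic (exists x, Pd x /\ x \notin <<s>>%VS).
    exists (x :: s); split=> [y|]; first by rewrite inE => /predU1P[->|/sP].
    right; rewrite span_cons; apply: leq_ltn_trans dim_s _.
    rewrite ltnNge; apply: contra xs => le_dim.
    have /eqP -> : (<<s>> == <[x]> + <<s>>)%VS by rewrite eqEdim addvSr.
    by apply: (subvP (addvSl _ _)); apply: memv_line.
  exists s; split=> //; left => x Px; apply/negPn/negP => xs.
  by apply: nex; exists x.
have [s [sP [all_s|]]] := step (\dim {:vT}).+1; last first.
  by rewrite ltnNge dimvS ?subvf.
exists <<s>>%VS; split=> // W WP; apply/span_subvP => x xs.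
by apply: WP; apply: sP.
Qed.

Lemma separating_form (vT : vectType K) (U : {vspace vT}) x : x \notin U ->
  exists f : vT -> K, [/\ forall a u w, f (a *: u + w) = a * f u + f w,
    forall u, u \in U -> f u = 0 & f x != 0].
Proof.
move=> xU; pose r u := u - projv U u.
have rl : linear r.
  by move=> a u w; rewrite /r linearP /= opprD addrACA -scalerBr.
pose b := vbasis {:vT}.
have /existsP[i ri] : [exists i, coord b i (r x) != 0].
  apply: contraR xU; rewrite negb_exists => /forallP r0.
  have rx0 : r x = 0.
    rewrite (coord_vbasis (memvf (r x))) big1 // => i _.
    by move/negPn: (r0 i) => /eqP->; rewrite scale0r.
  by move/eqP: rx0; rewrite subr_eq0 => /eqP->; apply: memv_proj.
exists (fun u => coord b i (r u)); split=> [a u w|u uU|//].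
  by rewrite rl linearP.
by rewrite /r projv_id // subrr linear0.
Qed.

Lemma rank_limg m n (A : 'M[K]_(m, n)) :
  \rank A = \dim (linfun (mulmx A : 'cV_n -> 'cV_m) @: fullv).
Proof.
have lin a b (B : 'M[K]_(a, b)) : linear (mulmx B : 'cV_b -> 'cV_a).
  by move=> c x y; rewrite mulmxDr scalemxAr.
pose f := linfun (mulmx (col_base A) : 'cV_(\rank A) -> 'cV_m).
have f0 : lker f == 0%VS.
  apply/lker0P => x y; rewrite /f !(linfun_linE (lin _ _ _)) => exy.
  have /row_fullP[B BA] := col_base_full A.
  by rewrite -[x]mul1mx -BA -mulmxA exy mulmxA BA mul1mx.
have -> : (linfun (mulmx A : 'cV_n -> 'cV_m) @: fullv = f @: fullv)%VS.
  apply/eqP; rewrite eqEsubv; apply/andP; split.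
    apply: (subvP_img (lin _ _ _)) => x _.
    have -> : A *m x = f (row_base A *m x).
      by rewrite /f (linfun_linE (lin _ _ _)) mulmxA mulmx_base.
    by apply: memv_img; apply: memvf.
  apply: (subvP_img (lin _ _ _)) => x _.
  have /row_freeP[B AB] := row_base_free A.
  have -> : col_base A *m x = linfun (mulmx A : 'cV_n -> 'cV_m) (B *m x).
    rewrite (linfun_linE (lin _ _ _)).
    transitivity (col_base A *m (row_base A *m B) *m x); first by rewrite AB mulmx1.
    by rewrite (mulmxA (col_base A)) mulmx_base -mulmxA.
  by apply: memv_img; apply: memvf.
rewrite limg_dim_eq; first by rewrite dimvf dim_matrix mulr1.
by rewrite (eqP f0) capv0.
Qed.

End LinearAlgebra.

(** * Values and derivatives at the identity of matrices of polynomial functions *)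

Section LieAlgebra.

Variables (K : fieldType) (n : nat) (G : 'M[K]_n -> Prop) (e : 'M[K]_n).

Local Notation ev := (fun F : mxfun K n => mxeval F 1%:M).
Local Notation dv := (fun F : mxfun K n => mxderiv1 F e).

Definition ev_mx a b (A : 'M[mxfun K n]_(a, b)) := map_mx ev A.
Definition dv_mx a b (A : 'M[mxfun K n]_(a, b)) := map_mx dv A.

Lemma mxderiv1D F H : mxderiv1 (F + H) e = mxderiv1 F e + mxderiv1 H e.
Proof.
rewrite /mxderiv1 -big_split; apply: eq_bigr => k _ /=.
by rewrite mderivD mevalD mulrDl.
Qed.

Lemma mxderiv1C c : mxderiv1 c%:MP e = 0.
Proof. by rewrite /mxderiv1 big1 // => k _; rewrite mderivC meval0 mul0r. Qed.

Lemma mxderiv1Z c F : mxderiv1 (c *: F) e = c * mxderiv1 F e.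
Proof.
rewrite /mxderiv1 mulr_sumr; apply: eq_bigr => k _.
by rewrite mderivZ mevalZ mulrA.
Qed.

Lemma mxderiv1M F H :
  mxderiv1 (F * H) e = mxderiv1 F e * mxeval H 1%:M + mxeval F 1%:M * mxderiv1 H e.
Proof.
rewrite /mxderiv1 mulr_suml mulr_sumr -big_split; apply: eq_bigr => k _ /=.
rewrite mderivM mevalD !mevalM mulrDl -/(mxeval H _) -/(mxeval F _); congr (_ + _).
  by rewrite mulrAC.
by rewrite mulrA.
Qed.

Lemma mxderiv1X i j : mxderiv1 ('X_(mxvec_index i j) : mxfun K n) e = e i j.
Proof.
rewrite /mxderiv1 (bigD1 (mxvec_index i j)) //= big1 => [|k kij].
  by rewrite mderivX mnmE eqxx scale1r mevalX mxvecE addr0 big1 ?mul1r // => l _;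
    rewrite mnmBE subnn expr0.
by rewrite mderivX mnmE eq_sym (negPf kij) scale0r meval0 mul0r.
Qed.

Lemma dv_mxD a b (A B : 'M[mxfun K n]_(a, b)) : dv_mx (A + B) = dv_mx A + dv_mx B.
Proof. by apply/matrixP => i j; rewrite !mxE mxderiv1D. Qed.

Lemma mxderiv1_sum (I : Type) (r : seq I) (Pr : pred I) (F : I -> mxfun K n) :
  mxderiv1 (\sum_(i <- r | Pr i) F i) e = \sum_(i <- r | Pr i) mxderiv1 (F i) e.
Proof.
by apply: (big_morph dv mxderiv1D); rewrite -[0](@mpolyC0 _ _) mxderiv1C.
Qed.

Lemma dv_mxM a b c (A : 'M[mxfun K n]_(a, b)) (B : 'M_(b, c)) :
  dv_mx (A *m B) = dv_mx A *m ev_mx B + ev_mx A *m dv_mx B.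
Proof.
apply/matrixP => i j; rewrite !mxE mxderiv1_sum -big_split.
by apply: eq_bigr => k _; rewrite mxderiv1M !mxE.
Qed.

Lemma dv_mxC a b (A : 'M[K]_(a, b)) : dv_mx (map_mx (@mpolyC _ _) A) = 0.
Proof. by apply/matrixP => i j; rewrite !mxE mxderiv1C. Qed.

Lemma ev_mxC a b (A : 'M[K]_(a, b)) : ev_mx (map_mx (@mpolyC _ _) A) = A.
Proof. by apply/matrixP => i j; rewrite !mxE /mxeval mevalC. Qed.

Lemma ev_mxM a b c (A : 'M[mxfun K n]_(a, b)) (B : 'M_(b, c)) :
  ev_mx (A *m B) = ev_mx A *m ev_mx B.
Proof. exact: (map_mxM (meval (fun k => mxvec (1%:M : 'M[K]_n) 0 k))). Qed.

Lemma dv_generic : dv_mx (generic_mx n K) = e.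
Proof. by apply/matrixP => i j; rewrite !mxE mxderiv1X. Qed.

Lemma eval_generic (g : 'M[K]_n) : map_mx (fun F => mxeval F g) (generic_mx n K) = g.
Proof. by apply/matrixP => i j; rewrite !mxE /mxeval mevalXU mxvecE. Qed.

Lemma eval_mxM (g : 'M[K]_n) a b c (A : 'M[mxfun K n]_(a, b)) (B : 'M_(b, c)) :
  map_mx (fun F => mxeval F g) (A *m B) =
  map_mx (fun F => mxeval F g) A *m map_mx (fun F => mxeval F g) B.
Proof. exact: (map_mxM (meval (fun k => mxvec g 0 k))). Qed.

Lemma eval_mxD (g : 'M[K]_n) a b (A B : 'M[mxfun K n]_(a, b)) :
  map_mx (fun F => mxeval F g) (A + B) =
  map_mx (fun F => mxeval F g) A + map_mx (fun F => mxeval F g) B.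
Proof. exact: (map_mxD (meval (fun k => mxvec g 0 k))). Qed.

Lemma eval_mxC (g : 'M[K]_n) a b (A : 'M[K]_(a, b)) :
  map_mx (fun F => mxeval F g) (map_mx (@mpolyC _ _) A) = A.
Proof. by apply/matrixP => i j; rewrite !mxE /mxeval mevalC. Qed.

Hypothesis e_lie : lie_algebra G e.

Lemma dv_mx_vanish a b (A : 'M[mxfun K n]_(a, b)) :
  (forall g, G g -> map_mx (fun F => mxeval F g) A = 0) -> dv_mx A = 0.
Proof.
move=> A0; apply/matrixP => i j; rewrite !mxE; apply: e_lie => g Gg.
by have /matrixP/(_ i j) := A0 g Gg; rewrite !mxE.
Qed.

End LieAlgebra.

(** * Symmetric forms that vanish on the orbit of an isotropic vector *)

Section Orbit.

Variables (K : fieldType) (n : nat) (Q : 'cV[K]_n -> K).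
Hypotheses (quadQ : quadratic_form Q) (two_neq0 : 2%:R != 0 :> K).
Hypothesis infK : infinite_field K.
Variables (f1 f2 z : 'cV[K]_n).

Local Notation B := (polar Q).
Local Notation J := (gram Q).

Definition hyperbolic_triple : Prop :=
  [/\ Q f1 = 0, Q f2 = 0, B f1 f2 = 1, Q z != 0 & B z f1 = 0 /\ B z f2 = 0].

Hypothesis hyp : hyperbolic_triple.

(** The reflection in [f1 - y] sends [f1] to [y]. A first reflection in [z], which fixes [f1], makes
    the determinant 1. *)
Lemma SO_transitive y : Q y = 0 -> B f1 y != 0 -> exists2 g, SO Q g & g *m f1 = y.
Proof.
have [Qf1 _ _ Qz [Bzf1 _]] := hyp => Qy By.
have Qfy : Q (f1 - y) != 0.
  by rewrite (quadD Q) (quadN quadQ) Qf1 Qy !add0r (polarNr quadQ) oppr_eq0.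
exists (reflection Q (f1 - y) *m reflection Q z).
  rewrite (SOP quadQ two_neq0) det_mulmx !(det_reflection quadQ) // mulrNN mulr1.
  by split=> //; apply: isometryM => //; apply: reflection_isometry.
by rewrite -mulmxA [_ *m f1]reflection_fix // reflection_swap // Qf1.
Qed.

Local Notation F Z x y := ((x^T *m Z *m y) 0 0).

(* The isotropic vectors [f2 + s x - s^2 Q(x) f1], with x orthogonal to f1 and
   f2, are in the orbit of f1. *)
Lemma form_vanishing_on_orbit (Z : 'M[K]_n) : Z^T = Z ->
    (forall g, SO Q g -> F Z (g *m f1) (g *m f1) = 0) ->
  exists c, Z = c *: J.
Proof.
move=> Zsym ZO.
have [Qf1 Qf2 Bf Qz [Bz1 Bz2]] := hyp.
have Fsym (x y : 'cV[K]_n) : F Z x y = F Z y x.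
  by rewrite -[x^T *m Z *m y]trmxK mxE !trmx_mul trmxK Zsym mulmxA.
have FDl (x y w : 'cV[K]_n) : F Z (x + y) w = F Z x w + F Z y w.
  by rewrite linearD /= !mulmxDl mxE.
have FZl a (x w : 'cV[K]_n) : F Z (a *: x) w = a * F Z x w.
  by rewrite linearZ /= -!scalemxAl mxE.
have FDr (x y w : 'cV[K]_n) : F Z w (x + y) = F Z w x + F Z w y by rewrite mulmxDr mxE.
have FZr a (x w : 'cV[K]_n) : F Z w (a *: x) = a * F Z w x by rewrite -scalemxAr mxE.
pose c : K := F Z f1 f2; exists c.
(* Along the isotropic curve [Z] is a polynomial of degree 4 in [s] that vanishes identically; its
   five coefficients yield the five conclusions. *)
have perp x : B x f1 = 0 -> B x f2 = 0 ->
  [/\ F Z f2 f2 = 0, F Z f2 x = 0, F Z x x = c * B x x, Q x * F Z x f1 = 0 &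
      Q x ^+ 2 * F Z f1 f1 = 0].
  move=> x1 x2.
  have h s : F Z f2 f2 + (2%:R * F Z f2 x) * s
      + (F Z x x - 2%:R * Q x * F Z f1 f2) * s ^+ 2
      + (- (2%:R * (Q x * F Z x f1))) * s ^+ 3
      + (Q x ^+ 2 * F Z f1 f1) * s ^+ 4 = 0.
    pose y : 'cV[K]_n := f2 + s *: x + (- (s ^+ 2 * Q x)) *: f1.
    have [||g gSO gy] := @SO_transitive y.
    - rewrite /y !(quadD Q) !(quadZ quadQ) Qf1 Qf2 (polarDl quadQ).
      rewrite !(polarZr quadQ) !(polarZl quadQ) x1 (polar_sym Q f2 f1) Bf.
      by rewrite (polar_sym Q f2 x) x2; ring.
    - rewrite /y !(polarDr quadQ) !(polarZr quadQ) (polarxx quadQ) Qf1.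
      by rewrite (polar_sym Q f1 x) x1 !mulr0 !addr0 Bf oner_neq0.
    have := ZO g gSO; rewrite gy /y !(FDl, FDr, FZl, FZr).
    rewrite (Fsym x f2) (Fsym f1 f2) (Fsym f1 x) (Fsym f2 f1) => h.
    apply: etrans h; ring.
  have [h0 h1 h2 h3 h4] := poly5_eq0 infK h; split=> //.
  - by move/eqP: h1; rewrite mulf_eq0 (negPf two_neq0) => /eqP.
  - by rewrite (polarxx quadQ) /c; move/eqP: h2; rewrite subr_eq0 => /eqP->; ring.
  - by move/eqP: h3; rewrite oppr_eq0 mulf_eq0 (negPf two_neq0) => /eqP.
have [Ff22 _ _ _ /eqP] := perp z Bz1 Bz2.
rewrite mulf_eq0 expf_eq0 (negPf Qz) andbF /= => /eqP Ff11.
have Fx1 x : B x f1 = 0 -> B x f2 = 0 -> F Z x f1 = 0.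
  move=> x1 x2; have [Qx|Qx] := eqVneq (Q x) 0; last first.
    by have [_ _ _ /eqP] := perp x x1 x2; rewrite mulf_eq0 (negPf Qx) => /eqP.
  have Fz1 : F Z z f1 = 0.
    by have [_ _ _ /eqP] := perp z Bz1 Bz2; rewrite mulf_eq0 (negPf Qz) => /eqP.
  have nz a : Q (x + a *: z) != 0 -> F Z x f1 = 0.
    have y1 : B (x + a *: z) f1 = 0.
      by rewrite (polarDl quadQ) (polarZl quadQ) x1 Bz1 mulr0 addr0.
    have y2 : B (x + a *: z) f2 = 0.
      by rewrite (polarDl quadQ) (polarZl quadQ) x2 Bz2 mulr0 addr0.
    move=> nz; have [_ _ _ /eqP] := perp _ y1 y2.
    by rewrite mulf_eq0 (negPf nz) FDl FZl Fz1 mulr0 addr0 => /eqP.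
  have Qa a : Q (x + a *: z) = a ^+ 2 * Q z + a * B x z.
    by rewrite (quadD Q) Qx add0r (quadZ quadQ) (polarZr quadQ).
  (* An isotropic [x] is perturbed: [Q (x + z)] and [Q (x - z)] add up to [2 Q z], so one of them is
     nonzero. *)
  have [q1|] := eqVneq (Q (x + 1 *: z)) 0; last exact: nz.
  have [q2|] := eqVneq (Q (x + (-1) *: z)) 0; last exact: nz.
  have /eqP : 2%:R * Q z = 0.
    have <- : Q (x + 1 *: z) + Q (x + (-1) *: z) = 2%:R * Q z by rewrite !Qa; ring.
    by rewrite q1 q2 addr0.
  by rewrite mulf_eq0 (negPf two_neq0) (negPf Qz).
have diag x : F Z x x = c * B x x.
  pose a := B x f2; pose b := B x f1; pose y : 'cV[K]_n := x - a *: f1 - b *: f2.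
  have y1 : B y f1 = 0.
    rewrite /y !(polarDl quadQ) !(polarNl quadQ) !(polarZl quadQ) (polarxx quadQ).
    by rewrite Qf1 (polar_sym Q f2 f1) Bf /b; ring.
  have y2 : B y f2 = 0.
    rewrite /y !(polarDl quadQ) !(polarNl quadQ) !(polarZl quadQ) (polarxx quadQ).
    by rewrite Qf2 Bf /a; ring.
  have xE : x = y + a *: f1 + b *: f2 by rewrite /y addrAC !subrK.
  clearbody y; clearbody a b.
  have [_ Fy2 Fyy _ _] := perp y y1 y2; have Fy1 := Fx1 y y1 y2.
  have Bxx : B x x = B y y + 2%:R * a * b.
    rewrite xE !(polarDl quadQ, polarDr quadQ, polarZl quadQ, polarZr quadQ).
    rewrite (polar_sym Q f2 f1) (polar_sym Q f1 y) (polar_sym Q f2 y) y1 y2 Bf.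
    by rewrite !(polarxx quadQ f1) !(polarxx quadQ f2) Qf1 Qf2; ring.
  rewrite Bxx mulrDr -Fyy xE !(FDl, FDr, FZl, FZr).
  rewrite (Fsym f2 f1) (Fsym f1 y) (Fsym y f2) Fy1 Fy2 Ff11 Ff22 -/c; ring.
apply/matrixP => i j; rewrite mxE.
have main x y : F Z x y = c * B x y.
  apply: (mulfI two_neq0).
  have := diag (x + y); rewrite !(FDl, FDr) !(polarDl quadQ) !(polarDr quadQ) !diag.
  rewrite (Fsym y x) (polar_sym Q y x) => h; apply/eqP; rewrite -subr_eq0; apply/eqP.
  have := congr1 (fun u => u - c * (B x x + B x y + (B x y + B y y))) h => /=.
  by rewrite subrr => {}h; apply: etrans h; ring.
by have := main (delta_mx i 0) (delta_mx j 0); rewrite mx_deltaE => ->; rewrite mxE.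
Qed.

End Orbit.

Section Action.

Variables (K : fieldType) (n : nat).

Definition sym_act (e Y : 'M[K]_n) : 'M[K]_n := e *m Y + Y *m e^T.

Lemma sym_act_linear e : linear (sym_act e).
Proof.
move=> a X Y; rewrite /sym_act mulmxDr mulmxDl -scalemxAl -scalemxAr.
by rewrite scalerDr addrACA.
Qed.

Lemma iter_linear (vT : vectType K) (f : vT -> vT) k :
  linear f -> linear (iter k f).
Proof.
move=> lf; elim: k => // k IH a x y.
exact: (etrans (congr1 f (IH a x y)) (lf _ _ _)).
Qed.

Definition sym_space : {vspace 'M[K]_n} := lker (linfun (fun Y : 'M[K]_n => Y - Y^T)).

Lemma sym_spaceP Y : reflect (Y^T = Y) (Y \in sym_space).
Proof.
have lin : linear (fun Y : 'M[K]_n => Y - Y^T).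
  by move=> a X Z; rewrite linearP /= opprD addrACA -scalerBr.
rewrite memv_ker (linfun_linE lin) subr_eq0 eq_sym; exact: eqP.
Qed.

Definition traceless_space (J : 'M[K]_n) : {vspace 'M[K]_n} :=
  (sym_space :&: lker (linfun (fun Y : 'M[K]_n => \tr (Y *m J) : K^o)))%VS.

Lemma traceless_spaceP J Y :
  reflect (Y^T = Y /\ \tr (Y *m J) = 0) (Y \in traceless_space J).
Proof.
have lin : linear (fun Y : 'M[K]_n => \tr (Y *m J) : K^o).
  by move=> a X Z; rewrite mulmxDl -scalemxAl linearP.
rewrite memv_cap memv_ker (linfun_linE lin).
apply: (iffP andP) => [[/sym_spaceP-> /eqP->]|[hY hJ]] //.
by split; [apply/sym_spaceP | apply/eqP].
Qed.

End Action.

(** * The graph of the map from traceless symmetric matrices to L *)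

Section Intertwiner.

Variables (K : fieldType) (n : nat) (Q : 'cV[K]_n -> K).
Hypotheses (quadQ : quadratic_form Q) (two_neq0 : 2%:R != 0 :> K).
Hypothesis infK : infinite_field K.
Hypothesis nondegQ : gram Q \in unitmx.
Variables (f1 f2 z : 'cV[K]_n).
Hypotheses (hyp12 : hyperbolic_triple Q f1 f2 z).
Variables (N : nat) (L : ratrep (SO Q) N).
Hypothesis irrL : irreducible_rep L.
Variables (phi : 'rV[K]_N) (v : 'cV[K]_N).

Local Notation B := (polar Q).
Local Notation J := (gram Q).
Local Notation R := (rep_act L).

Hypothesis phi_coef : forall g, SO Q g ->
  phi *m R g *m v = (B f2 (g *m f1) ^+ 2)%:M.

Variable e : 'M[K]_n.
Hypothesis e_lie : lie_algebra (SO Q) e.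

Local Notation VT := ('M[K]_n * 'cV[K]_N)%type.

Lemma hyp21 : hyperbolic_triple Q f2 f1 z.
Proof.
by have [h1 h2 h3 h4 [h5 h6]] := hyp12; split=> //; rewrite polar_sym.
Qed.

Lemma rep_SO_M g h : SO Q g -> SO Q h -> R (g *m h) = R g *m R h.
Proof. exact: rep_actM. Qed.

(** The translates of [x] span a subrepresentation on which [phi] vanishes. It is not everything,
    because [phi *m v] is [B f2 f1 ^+ 2 = 1]; so it is 0 by irreducibility. *)
Lemma rep_form_eq0 (x : 'cV[K]_N) : (forall h, SO Q h -> phi *m R h *m x = 0) -> x = 0.
Proof.
move=> x0.
have [U [UP Umin]] := span_exists (fun y => exists2 h, SO Q h & y = R h *m x).
have linM (g : 'M[K]_N) : linear (mulmx g : 'cV_N -> 'cV_N).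
  by move=> c y w; rewrite mulmxDr scalemxAr.
have [|U0|U1] := (proj2 irrL) U.
- move=> g y gSO yU; rewrite -(linfun_linE (linM (R g))) memv_preim.
  apply: (subvP (Umin _ _)) yU => w [h hSO ->].
  rewrite -memv_preim (linfun_linE (linM (R g))); apply: UP.
  by exists (g *m h); [apply: SOM | rewrite mulmxA rep_SO_M].
- have : x \in U by apply: UP; exists 1%:M; [apply: SO1 | rewrite rep_act1 mul1mx].
  by rewrite U0 memv0 => /eqP.
have linp : linear (fun y : 'cV[K]_N => (phi *m y) 0 0 : K^o).
  by move=> c y w; rewrite mulmxDr -scalemxAr !mxE.
have : v \in lker (linfun (fun y : 'cV[K]_N => (phi *m y) 0 0 : K^o)).
  have : v \in U by rewrite U1 memvf.
  apply: subvP; apply: Umin => y [h hSO ->].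
  by rewrite memv_ker (linfun_linE linp) mulmxA x0 // mxE.
rewrite memv_ker (linfun_linE linp).
have := phi_coef (SO1 quadQ two_neq0); rewrite rep_act1 mulmx1 mul1mx => ->.
have [_ _ Bf _ _] := hyp21.
by rewrite Bf expr1n mxE oner_eq0.
Qed.

Definition graph_gen (g : 'M[K]_n) : VT := ((g *m f1) *m (g *m f1)^T, R g *m v).

(* M is the graph of an SO(Q)-equivariant surjection from the symmetric matrices
   Y with tr(YJ) = 0 to L, whose kernel is spanned by J^-1 if tr 1 = 0 and is 0
   otherwise. *)
Definition graph_spec (M : {vspace VT}) : Prop :=
  (forall g, SO Q g -> graph_gen g \in M) /\
  forall W : {vspace VT}, (forall g, SO Q g -> graph_gen g \in W) -> (M <= W)%VS.

Lemma graph_exists : exists M, graph_spec M.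
Proof.
have [M [M1 M2]] := span_exists (fun p : VT => exists2 g, SO Q g & p = graph_gen g).
exists M; split=> [g gSO|W WP]; first by apply: M1; exists g.
by apply: M2 => p [g gSO ->]; apply: WP.
Qed.

Variable M : {vspace VT}.
Hypothesis MP : graph_spec M.

Lemma graph_ind (f : VT -> K) : (forall a p q, f (a *: p + q) = a * f p + f q) ->
  (forall g, SO Q g -> f (graph_gen g) = 0) -> forall p, p \in M -> f p = 0.
Proof.
move=> fl f0 p pM.
have lf : linear (f : VT -> K^o) by [].
have : p \in lker (linfun (f : VT -> K^o)).
  by apply: (subvP (proj2 MP _ _)) pM => g gSO; rewrite memv_ker (linfun_linE lf) f0.
by rewrite memv_ker (linfun_linE lf) => /eqP.
Qed.

Lemma graph_stable (f : VT -> VT) : linear f ->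
  (forall g, SO Q g -> f (graph_gen g) \in M) -> forall p, p \in M -> f p \in M.
Proof.
move=> lf fM p pM; rewrite -(linfun_linE lf) memv_preim.
apply: (subvP (proj2 MP _ _)) pM => g gSO.
by rewrite -memv_preim (linfun_linE lf) fM.
Qed.

(** On the generators both sides are [B f2 (h *m g *m f1) ^+ 2]. As the left sides separate the
    points of L, the matrix component of [p] determines its vector component. *)
Lemma graph_coef h p : SO Q h -> p \in M ->
  phi *m R h *m p.2 = f2^T *m J *m h *m p.1 *m (f2^T *m J *m h)^T.
Proof.
move=> hSO pM; apply/matrixP => i j; rewrite !ord1; apply/eqP; rewrite -subr_eq0.
pose f (p : VT) := (phi *m R h *m p.2) 0 0 -
  (f2^T *m J *m h *m p.1 *m (f2^T *m J *m h)^T) 0 0.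
apply/eqP; move: p pM; rewrite -/(f _); apply: (@graph_ind f) => [a p q|g gSO].
  by rewrite /f /= !mulmxDr mulmxDl -!scalemxAr -scalemxAl !mxE; ring.
rewrite /f /= mulmxA -(mulmxA phi) -rep_SO_M // phi_coef; last exact: SOM.
have e1 : f2^T *m J *m h *m (g *m f1) = (B f2 (h *m g *m f1))%:M.
  by rewrite -(polar_gram quadQ) !mulmxA.
have -> (u : 'rV[K]_n) (y : 'cV[K]_n) : u *m (y *m y^T) *m u^T = u *m y *m (u *m y)^T.
  by rewrite trmx_mul !mulmxA.
by rewrite e1 tr_scalar_mx -scalar_mxM expr2 subrr.
Qed.

Lemma graph_sym p : p \in M -> p.1 \in traceless_space J.
Proof.
move=> pM; apply/traceless_spaceP; split.
  apply/matrixP => i j; apply/eqP; rewrite -subr_eq0; apply/eqP.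
  move: p pM; apply: (@graph_ind (fun p => p.1^T i j - p.1 i j)) => [a p q|g gSO] /=.
    by rewrite !mxE; ring.
  by rewrite trmx_mul trmxK subrr.
move: p pM; apply: (@graph_ind (fun p => \tr (p.1 *m J))) => [a p q|g gSO] /=.
  by rewrite mulmxDl -scalemxAl mxtraceD mxtraceZ.
rewrite -mulmxA mxtrace_mulC (polar_gram quadQ) (polarxx quadQ).
have -> : Q (g *m f1) = 0 by case: gSO => -> _; case: hyp12.
by rewrite mulr0 mxtrace_scalar mul0rn.
Qed.

Lemma graph_functional x : (0, x) \in M -> x = 0.
Proof.
move=> xM; apply: rep_form_eq0 => h hSO.
by rewrite (graph_coef hSO xM) /= mulmx0 mul0mx.
Qed.

Lemma SO_gram_inv h : SO Q h -> h *m invmx J *m h^T = invmx J.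
Proof.
move=> /(SOP quadQ two_neq0)[hI _].
have e1 : invmx J *m h^T *m J *m h = 1%:M by rewrite -!mulmxA (mulmxA h^T) hI mulVmx.
have := mulmx1C e1 => /(congr1 (mulmxr (invmx J))) /=.
by rewrite !mulmxA mulmxK // mul1mx.
Qed.

(** J^-1 is invariant under SO(Q), so every coefficient in [graph_coef] is [B f2 f2], which is 0
    because [f2] is isotropic. *)
Lemma graph_gram x : (invmx J, x) \in M -> x = 0.
Proof.
move=> xM; apply: rep_form_eq0 => h hSO.
rewrite (graph_coef hSO xM) /= trmx_mul trmx_mul trmxK gram_tr.
have -> : f2^T *m J *m h *m invmx J *m (h^T *m (J *m f2)) =
    f2^T *m J *m (h *m invmx J *m h^T) *m J *m f2 by rewrite !mulmxA.
rewrite SO_gram_inv // mulmxK // (polar_gram quadQ) (polarxx quadQ).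
by have [_ -> _ _ _] := hyp12; rewrite mulr0 raddf0.
Qed.

(** By [graph_coef] the form [J *m Y *m J] vanishes on the orbit of [f2], hence is a multiple of J;
    the roles of [f1] and [f2] are exchanged here. *)
Lemma graph_kernel Y : (Y, 0) \in M -> exists c, Y = c *: invmx J.
Proof.
move=> YM; have /traceless_spaceP[Ysym _] := graph_sym YM.
have JYJsym : (J *m Y *m J)^T = J *m Y *m J.
  by rewrite !trmx_mul (gram_tr Q) Ysym mulmxA.
have [g gSO|c JYJ] := form_vanishing_on_orbit quadQ two_neq0 infK hyp21 JYJsym.
  have gJ : (g *m f2)^T *m J = f2^T *m J *m invmx g.
    have /(SOP quadQ two_neq0)[gI _] := gSO; have ug := SO_unit gSO.
    by rewrite -{2}gI trmx_mul !mulmxA mulmxK.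
  have := graph_coef (SOV gSO) YM; rewrite /= mulmx0 -gJ.
  by rewrite (trmx_mul _ J) trmxK (gram_tr Q) !mulmxA => <-; rewrite mxE.
exists c; rewrite -[Y](mulmxK nondegQ) -[Y *m J](mulKmx nondegQ) (mulmxA J Y J) JYJ.
by rewrite -scalemxAr mulVmx // -scalemxAl mul1mx.
Qed.

(** A linear form that vanishes on the projection of [M] is [X |-> \tr (X *m A^T)], and the
    symmetric form [A + A^T] vanishes on the orbit of [f1]. So [A + A^T] is a multiple of J, and the
    linear form kills every traceless [Y]. *)
Lemma traceless_graph Y : Y \in traceless_space J -> exists x, (Y, x) \in M.
Proof.
case/traceless_spaceP => Ysym trY.
have lin1 : linear (fst : VT -> 'M[K]_n) by [].
have [|YX] := boolP (Y \in (linfun (fst : VT -> 'M[K]_n) @: M)%VS).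
  by case/memv_imgP=> -[Y' x] pM; rewrite (linfun_linE lin1) => ->; exists x.
have [f [fl fX /eqP[]]] := separating_form YX.
pose A : 'M[K]_n := \matrix_(i, j) f (delta_mx i j).
have f0 : f 0 = 0 by apply: fX; apply: mem0v.
have fD : {morph f : x y / x + y} by move=> x y; rewrite -[x]scale1r fl mul1r scale1r.
have fE X : f X = \sum_i \sum_j X i j * A i j.
  rewrite {1}[X]matrix_sum_delta (big_morph f fD f0); apply: eq_bigr => i _.
  rewrite (big_morph f fD f0); apply: eq_bigr => j _.
  by rewrite -[_ *: _]addr0 fl f0 addr0 /A mxE.
have ftr X : f X = \tr (X *m A^T).
  by rewrite fE; apply: eq_bigr => i _; rewrite mxE; apply: eq_bigr => j _; rewrite !mxE.
have Zsym : (A + A^T)^T = A + A^T by rewrite linearD /= trmxK addrC.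
have [g gSO|c ZE] := form_vanishing_on_orbit quadQ two_neq0 infK hyp12 Zsym.
  have fg : f ((g *m f1) *m (g *m f1)^T) = 0.
    apply: fX; rewrite -[X in X \in _]/(fst (graph_gen g)) -(linfun_linE lin1).
    by apply: memv_img; apply: (proj1 MP).
  have tr2 (B' : 'M[K]_n) (y : 'cV[K]_n) : (y^T *m B' *m y) 0 0 = \tr (y *m y^T *m B').
    by rewrite -[in RHS]mulmxA mxtrace_mulC trace_mx11.
  rewrite tr2 mulmxDr mxtraceD -ftr fg addr0 -mxtrace_tr trmx_mul mxtrace_mulC.
  by rewrite trmx_mul trmxK -ftr fg.
apply: (mulfI two_neq0); rewrite mulr0 mulr_natl mulr2n {1}ftr ftr.
rewrite -{1}Ysym -trmx_mul mxtrace_tr mxtrace_mulC -mxtraceD -mulmxDr ZE.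
by rewrite -scalemxAr mxtraceZ trY mulr0.
Qed.

Definition diff_act (p : VT) : VT := (sym_act e p.1, rep_diff L e *m p.2).

Lemma diff_act_linear : linear diff_act.
Proof.
move=> a p q; rewrite /diff_act /= sym_act_linear mulmxDr -scalemxAr.
by [].
Qed.

(* A linear form vanishing on M gives a polynomial vanishing on SO(Q), and its
   derivative in the direction e is the form evaluated at [diff_act]. *)
Lemma graph_diff p : p \in M -> diff_act p \in M.
Proof.
move: p; apply: (graph_stable diff_act_linear) => g gSO.
apply/negPn/negP => /separating_form[f [fl fM /eqP[]]].
pose Y0 := (graph_gen g).1; pose x0 := (graph_gen g).2.
pose al i j := f (delta_mx i j, 0); pose be a := f (0, delta_mx a 0).
have f0 : f 0 = 0 by apply: fM; apply: mem0v.
have fD : {morph f : x y / x + y} by move=> x y; rewrite -[x]scale1r fl mul1r scale1r.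
have fZ a x : f (a *: x) = a * f x by rewrite -[a *: x]addr0 fl f0 addr0.
have fE Y x : f (Y, x) = \sum_i \sum_j al i j * Y i j + \sum_a be a * x a 0.
  have -> : (Y, x) = (Y, 0) + (0, x) :> VT by congr pair; rewrite /= ?addr0 ?add0r.
  rewrite fD; congr (_ + _).
    have fD1 : {morph (fun Y => f (Y, 0)) : x y / x + y}.
      by move=> X1 X2; rewrite -fD; congr f; congr pair; rewrite /= addr0.
    rewrite {1}[Y]matrix_sum_delta (big_morph _ fD1 f0); apply: eq_bigr => i _.
    rewrite (big_morph _ fD1 f0); apply: eq_bigr => j _.
    rewrite mulrC -fZ; congr f; congr pair; by rewrite /= scaler0.
  have fD2 : {morph (fun x => f (0, x)) : x y / x + y}.
    by move=> X1 X2; rewrite -fD; congr f; congr pair; rewrite /= addr0.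
  rewrite {1}[x]matrix_sum_delta (big_morph _ fD2 f0); apply: eq_bigr => i _.
  rewrite big_ord1 mulrC -fZ; congr f; congr pair; by rewrite /= scaler0.
pose X := generic_mx n K.
pose A : 'M[mxfun K n]_n := X *m map_mx (@mpolyC _ _) Y0 *m X^T.
pose Rp : 'M[mxfun K n]_N := \matrix_(i, j) rep_coef L i j.
pose C : 'cV[mxfun K n]_N := Rp *m map_mx (@mpolyC _ _) x0.
pose H : mxfun K n := \sum_i \sum_j al i j *: A i j + \sum_a be a *: C a 0.
have HE h : mxeval H h = f (h *m Y0 *m h^T, R h *m x0).
  rewrite fE /mxeval /H mevalD !raddf_sum; congr (_ + _).
    apply: eq_bigr => i _; rewrite raddf_sum; apply: eq_bigr => j _ /=.
    rewrite mevalZ; congr (_ * _).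
    have : map_mx (fun F => mxeval F h) A = h *m Y0 *m h^T.
      by rewrite !eval_mxM eval_mxC -map_trmx eval_generic.
    by move/matrixP/(_ i j); rewrite mxE.
  apply: eq_bigr => a _ /=; rewrite mevalZ; congr (_ * _).
  have : map_mx (fun F => mxeval F h) C = R h *m x0.
    rewrite eval_mxM eval_mxC; congr (_ *m _).
    by apply/matrixP => i j; rewrite !mxE.
  by move/matrixP/(_ a 0); rewrite mxE.
have dH : mxderiv1 H e = f (diff_act (graph_gen g)).
  rewrite fE mxderiv1D !mxderiv1_sum; congr (_ + _).
    apply: eq_bigr => i _; rewrite mxderiv1_sum; apply: eq_bigr => j _.
    rewrite mxderiv1Z; congr (_ * _).
    have : dv_mx e A = sym_act e Y0.
      rewrite !dv_mxM dv_mxC mulmx0 addr0 ev_mxM ev_mxC.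
      rewrite /dv_mx /ev_mx -!map_trmx -/(dv_mx e X) -/(ev_mx X) dv_generic.
      by rewrite /ev_mx eval_generic trmx1 mulmx1 mul1mx.
    by move/matrixP/(_ i j); rewrite mxE.
  apply: eq_bigr => a _; rewrite mxderiv1Z; congr (_ * _).
  have : dv_mx e C = rep_diff L e *m x0.
    rewrite dv_mxM dv_mxC mulmx0 addr0 ev_mxC; congr (_ *m _).
    by apply/matrixP => i j; rewrite !mxE.
  by move/matrixP/(_ a 0); rewrite mxE.
rewrite -dH; apply: e_lie => h hSO; rewrite HE; apply: fM.
have -> : (h *m Y0 *m h^T, R h *m x0) = graph_gen (h *m g).
  by rewrite /graph_gen /Y0 /x0 /= rep_SO_M // !trmx_mul !mulmxA.
by apply: (proj1 MP); apply: SOM.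
Qed.

Local Notation E k := (linfun (iter k (sym_act e))).
Local Notation S0 := (traceless_space J).

Lemma iter_diff_act k p :
  iter k diff_act p = (iter k (sym_act e) p.1, (rep_diff L e) ^+ k *m p.2).
Proof.
elim: k => [|k IH]; first by rewrite expr0 mul1mx; case: p.
by rewrite iterS IH exprS -mulmxE -mulmxA.
Qed.

(** The second projection of [M] is a subrepresentation that contains the nonzero vector [v]. *)
Lemma graph_full x : exists Y, (Y, x) \in M.
Proof.
have lin2 : linear (snd : VT -> 'cV[K]_N) by [].
pose U := (linfun (snd : VT -> 'cV[K]_N) @: M)%VS.
have UP y : y \in U -> exists Y, (Y, y) \in M.
  by case/memv_imgP=> -[Y y'] pM; rewrite (linfun_linE lin2) => ->; exists Y.
have MU p : p \in M -> p.2 \in U.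
  by move=> pM; rewrite -(linfun_linE lin2); apply: memv_img.
apply: (UP); have [|U0|->] := (proj2 irrL) U; last exact: memvf.
  move=> h y hSO /UP[Y YM].
  pose t (p : VT) : VT := (h *m p.1 *m h^T, R h *m p.2).
  have tl : linear t.
    move=> a p q; rewrite /t /= !mulmxDr mulmxDl -!scalemxAr -scalemxAl.
    by [].
  apply: (MU (t (Y, y))); move: YM; apply: (graph_stable tl) => g gSO.
  have -> : t (graph_gen g) = graph_gen (h *m g).
    by rewrite /t /graph_gen /= rep_SO_M // !trmx_mul !mulmxA.
  by apply: (proj1 MP); apply: SOM.
have : v \in U.
  have := MU _ (proj1 MP _ (SO1 quadQ two_neq0)).
  by rewrite /graph_gen /= rep_act1 mul1mx.
rewrite U0 memv0 => /eqP v0.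
have := phi_coef (SO1 quadQ two_neq0); rewrite v0 mulmx0 mul1mx => /matrixP/(_ 0 0).
have [_ _ Bf _ _] := hyp21.
by rewrite Bf expr1n !mxE => /esym/eqP; rewrite oner_eq0.
Qed.

(** The space [Mk] of k-fold images under [diff_act] projects bijectively onto [E k @: S0]. Its
    other projection is the image of the k-th power on L, with kernel the part of the line of J^-1
    that lies in [E k @: S0]. *)
Lemma rank_rep_diff k :
  (\rank ((rep_diff L e) ^+ k) + (invmx J \in (E k @: S0)%VS) =
   \dim (E k @: S0))%N.
Proof.
have lin1 : linear (fst : VT -> 'M[K]_n) by [].
have lin2 : linear (snd : VT -> 'cV[K]_N) by [].
have linE := iter_linear k (@sym_act_linear K n e).
have linD := iter_linear k diff_act_linear.
have linR : linear (mulmx ((rep_diff L e) ^+ k) : 'cV_N -> 'cV_N).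
  by move=> a x y; rewrite mulmxDr scalemxAr.
pose p1 := linfun (fst : VT -> 'M[K]_n); pose p2 := linfun (snd : VT -> 'cV[K]_N).
pose Mk := (linfun (iter k diff_act) @: M)%VS.
have MkM p : p \in Mk -> p \in M.
  case/memv_imgP=> q qM ->; rewrite (linfun_linE linD).
  by elim: (k) => //= l IH; apply: graph_diff.
have Mk1 : (p1 @: Mk = E k @: S0)%VS.
  apply/eqP; rewrite eqEsubv; apply/andP; split; apply/subvP => y /memv_imgP[q qM ->].
    move: qM; rewrite (linfun_linE lin1) => /memv_imgP[r rM ->].
    rewrite (linfun_linE linD) iter_diff_act -(linfun_linE linE).
    by apply: memv_img; apply: graph_sym.
  have [x qxM] := traceless_graph qM.
  rewrite (linfun_linE linE) -[X in X \in _]/((iter k (sym_act e) (q, x).1, 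
    (rep_diff L e) ^+ k *m (q, x).2).1) -iter_diff_act -(linfun_linE lin1).
  by apply: memv_img; rewrite -(linfun_linE linD); apply: memv_img.
have Mk2 : (p2 @: Mk = linfun (mulmx ((rep_diff L e) ^+ k) : 'cV_N -> 'cV_N) @: fullv)%VS.
  apply/eqP; rewrite eqEsubv; apply/andP; split; apply/subvP => y /memv_imgP[q qM ->].
    move: qM; rewrite (linfun_linE lin2) => /memv_imgP[r rM ->].
    rewrite (linfun_linE linD) iter_diff_act -(linfun_linE linR).
    by apply: memv_img; apply: memvf.
  have [Y YqM] := graph_full q.
  rewrite (linfun_linE linR) -[X in X \in _]/((iter k (sym_act e) (Y, q).1, 
    (rep_diff L e) ^+ k *m (Y, q).2).2) -iter_diff_act -(linfun_linE lin2).
  by apply: memv_img; rewrite -(linfun_linE linD); apply: memv_img.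
have dim1 : \dim (E k @: S0) = \dim Mk.
  rewrite -Mk1; apply: limg_dim_eq; apply/eqP; rewrite -subv0; apply/subvP.
  move=> [Y x]; rewrite memv_cap memv_ker (linfun_linE lin1) /= => /andP[/MkM pM /eqP Y0].
  by rewrite Y0 in pM *; rewrite (graph_functional pM) memv0.
rewrite dim1 -(limg_ker_dim p2 Mk) Mk2 -rank_limg addnC; congr (_ + _)%N.
have [JE|JE] := boolP (invmx J \in _).
  have : (invmx J, 0) \in Mk.
    move: (JE); rewrite -Mk1 => /memv_imgP[[Y x] qM]; rewrite (linfun_linE lin1) /= => eY.
    by rewrite -eY in qM; rewrite -(graph_gram (MkM _ qM)).
  pose j0 : VT := (invmx J, 0); rewrite -/j0 => JMk.
  have -> : (Mk :&: lker p2 = <[j0]>)%VS.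
    apply/eqP; rewrite eqEsubv; apply/andP; split; last first.
      by rewrite -memvE memv_cap JMk memv_ker (linfun_linE lin2) /= eqxx.
    apply/subvP => -[Y x]; rewrite memv_cap memv_ker (linfun_linE lin2) /=.
    case/andP=> YMk /eqP x0; rewrite x0 in YMk *.
    have [c ->] := graph_kernel (MkM _ YMk).
    by apply/vlineP; exists c; congr pair; rewrite /= scaler0.
  rewrite dim_vline; have -> // : j0 != 0.
  apply/eqP => -[J0]; have [_ _ Bf _ _] := hyp12.
  move/eqP: Bf; rewrite (polarE quadQ) -[f1^T]mulmx1 -(mulmxV nondegQ) J0.
  by rewrite !mulmx0 !mul0mx mxE eq_sym oner_eq0.
suff -> : (Mk :&: lker p2 = 0)%VS by rewrite dimv0.
apply/eqP; rewrite -subv0; apply/subvP => -[Y x].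
rewrite memv_cap memv_ker (linfun_linE lin2) /= => /andP[YMk /eqP x0].
rewrite x0 in YMk *; have [c YE] := graph_kernel (MkM _ YMk).
have YEk : Y \in (E k @: S0)%VS.
  by rewrite -Mk1 -[Y]/((Y, 0 : 'cV[K]_N).1) -(linfun_linE lin1); apply: memv_img.
have [c0|c0] := eqVneq c 0; first by rewrite YE c0 scale0r memv0.
by move: JE; rewrite -[invmx J](scalerK c0) -YE memvZ ?YEk.
Qed.

End Intertwiner.

(** * The symmetric square *)

Section SymmetricSquareBasis.

Variable n : nat.

Local Notation dS := #|{: monom2 n}|.

(** The image of [v_a v_b] is [v_a v_b^T + v_b v_a^T], so a square goes to twice a diagonal unit.
    The map is equivariant without any division, and it becomes an isomorphism onto the symmetric
    matrices when 2 is invertible. *)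
Definition monom2_mx (R : pzRingType) (i : 'I_dS) : 'M[R]_n :=
  let q := val (enum_val i) in delta_mx q.1 q.2 + delta_mx q.2 q.1.

Definition sym2_to_mx (R : pzRingType) (x : 'cV[R]_dS) : 'M[R]_n :=
  \sum_i x i 0 *: monom2_mx R i.

Lemma sym2_to_mxE (R : pzRingType) (x : 'cV[R]_dS) a b :
  sym2_to_mx x a b = x (enum_rank (sort_ord (a, b))) 0 *+ (1 + (a == b)).
Proof.
rewrite summxE (bigD1 (enum_rank (sort_ord (a, b)))) //= big1 => [|i ip].
  rewrite addr0 !mxE enum_rankK /=.
  have [->|ab] := eqVneq a b; first by rewrite leqnn /= !eqxx mulrDr mulr1 mulr2n.
  by case: leqP => _ /=; rewrite !eqxx !(negPf ab) ?(eq_sym b a) ?(negPf ab) /= ?addr0 ?add0r mulr1.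
rewrite !mxE; set q := val (enum_val i).
have nq p : sort_ord p = sort_ord (a, b) -> q != p.
  move=> pab; apply: contra ip => /eqP qp.
  by rewrite -pab -qp sort_ordK enum_valK.
have := nq (a, b) erefl; have := nq (b, a) (sort_ord_swap (a, b)).
rewrite !(eq_sym a) !(eq_sym b) [q]surjective_pairing !xpair_eqE.
by rewrite andbC => /negPf-> /negPf->; rewrite addr0 mulr0.
Qed.

(** The ring is arbitrary so that [g] may be the generic matrix; the derivative of the identity at 1
    then compares [sym_act] with the differential of the symmetric square. *)
Lemma sym2_mx_conj (R : comNzRingType) (g : 'M[R]_n) (k : 'I_dS) :
  g *m monom2_mx R k *m g^T = \sum_i sym2_mx g i k *: monom2_mx R i.
Proof.
have -> : \sum_i sym2_mx g i k *: monom2_mx R i = sym2_to_mx (col k (sym2_mx g)).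
  by apply: eq_bigr => i _; congr (_ *: _); rewrite [RHS]mxE.
pose q := val (enum_val k).
have colE a b : col k (sym2_mx g) (enum_rank (sort_ord (a, b))) 0 =
    \sum_(p | sort_ord p == sort_ord (a, b)) g p.1 q.1 * g p.2 q.2.
  by rewrite !mxE enum_rankK.
apply/matrixP => a b; rewrite sym2_to_mxE colE /monom2_mx -/q.
have dE (i j : 'I_n) : (g *m delta_mx i j *m g^T) a b = g a i * g b j.
  rewrite mxE (bigD1 j) //= big1 => [|l lj].
    rewrite addr0 mxE (bigD1 i) //= big1 => [|l li]; first by rewrite !mxE !eqxx mulr1 addr0.
    by rewrite mxE (negPf li) mulr0.
  by rewrite mxE big1 ?mul0r // => m _; rewrite mxE (negPf lj) andbF mulr0.
rewrite mulmxDr mulmxDl [LHS]mxE !dE.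
have [ab|ab] := eqVneq a b.
  rewrite -ab (big_pred1 (a, a)) /= => [|p]; first by rewrite mulrC mulr2n.
  apply/eqP/eqP => [|-> //] /(congr1 val) /=; rewrite leqnn.
  by case: p => x y /=; case: leqP => _ [-> ->].
rewrite addn0 mulr1n (bigD1 (a, b)) //= (bigD1 (b, a)) /=; last first.
  by rewrite (sort_ord_swap (a, b)) eqxx xpair_eqE (negPf ab) andbF.
rewrite big1 ?addr0 => [|p /andP[/andP[/eqP/(congr1 val) /= ep p1] p2]].
  by congr (_ + _); rewrite mulrC.
exfalso; move: ep p1 p2; case: p => x y /=.
by case: leqP => _; case: leqP => _ [-> ->]; rewrite ?eqxx.
Qed.

Variables (K : fieldType) (G : 'M[K]_n -> Prop) (e : 'M[K]_n).
Hypothesis two_neq0 : 2%:R != 0 :> K.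

Local Notation dE := (rep_diff (sym2_rep G) e).

Lemma map_monom2_mx k : map_mx (@mpolyC _ _) (monom2_mx K k) = monom2_mx (mxfun K n) k.
Proof.
by apply/matrixP => i j; rewrite !mxE mpolyCD !mpolyC_nat.
Qed.

Lemma sym_act_monom2 k : sym_act e (monom2_mx K k) = \sum_i dE i k *: monom2_mx K i.
Proof.
pose X := generic_mx n K.
have evX : ev_mx X = 1%:M by apply: eval_generic.
have evXT : ev_mx X^T = 1%:M by rewrite /ev_mx -map_trmx -/(ev_mx X) evX trmx1.
have dvXT : dv_mx e X^T = e^T by rewrite /dv_mx -map_trmx -/(dv_mx e X) dv_generic.
have := congr1 (@dv_mx _ _ e _ _) (sym2_mx_conj X k).
rewrite -map_monom2_mx !dv_mxM dv_mxC mulmx0 addr0 ev_mxM ev_mxC evX evXT dvXT.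
rewrite dv_generic mulmx1 mul1mx -/(sym_act e _) => ->.
apply/matrixP => a b; rewrite mxE !summxE mxderiv1_sum; apply: eq_bigr => i _.
rewrite -map_monom2_mx.
have -> : (sym2_mx X i k *: map_mx (@mpolyC _ _) (monom2_mx K i)) a b =
    sym2_mx X i k * (monom2_mx K i a b)%:MP by rewrite mxE [X in _ * X]mxE.
have -> : (dE i k *: monom2_mx K i) a b =
    mxderiv1 (sym2_mx X i k) e * monom2_mx K i a b by rewrite mxE [X in X * _]mxE.
by rewrite mxderiv1M mxderiv1C mulr0 addr0 /mxeval mevalC.
Qed.

Lemma sym2_to_mx_linear : linear (@sym2_to_mx K).
Proof.
move=> a x y; rewrite scaler_sumr -big_split; apply: eq_bigr => i _ /=.
by rewrite !mxE scalerDl scalerA.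
Qed.

Lemma sym2_to_mx_act x : sym_act e (sym2_to_mx x) = sym2_to_mx (dE *m x).
Proof.
pose f := linfun (sym_act e); have fE := linfun_linE (@sym_act_linear K n e).
rewrite -fE linear_sum /=.
transitivity (\sum_k \sum_i (x k 0 * dE i k) *: monom2_mx K i).
  apply: eq_bigr => k _; rewrite linearZ /= fE sym_act_monom2 scaler_sumr.
  by apply: eq_bigr => i _; rewrite scalerA.
rewrite exchange_big; apply: eq_bigr => i _ /=.
rewrite -scaler_suml mxE; congr (_ *: _); apply: eq_bigr => k _.
by rewrite mulrC.
Qed.

Lemma rank_sym2_diff k :
  \rank (dE ^+ k) = \dim (linfun (iter k (sym_act e)) @: sym_space K n).
Proof.
have lin := sym2_to_mx_linear.
have linE := iter_linear k (@sym_act_linear K n e).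
have linM : linear (mulmx (dE ^+ k) : 'cV_dS -> 'cV_dS).
  by move=> a x y; rewrite mulmxDr scalemxAr.
have nz (a b : 'I_n) : (1 + (a == b))%:R != 0 :> K.
  by case: (a == b); rewrite ?oner_neq0 // addn0 oner_neq0.
pose io := linfun (@sym2_to_mx K).
have ioE : io =1 @sym2_to_mx K by apply: linfun_linE.
have io0 : lker io == 0%VS.
  apply/lker0P => x y; rewrite !ioE => exy; apply/colP => i.
  have /matrixP/(_ (val (enum_val i)).1 (val (enum_val i)).2) := exy.
  rewrite !sym2_to_mxE -surjective_pairing sort_ordK enum_valK.
  by rewrite -mulr_natr -[RHS]mulr_natr => /(mulIf (nz _ _)).
have io_sym : (io @: fullv = sym_space K n)%VS.
  apply/eqP; rewrite eqEsubv; apply/andP; split; apply/subvP => Y.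
    case/memv_imgP => x _ ->; rewrite ioE; apply/sym_spaceP/matrixP => a b.
    by rewrite mxE !sym2_to_mxE -(sort_ord_swap (a, b)) eq_sym.
  move=> /sym_spaceP Ysym.
  pose x : 'cV[K]_dS := \col_i (let q := val (enum_val i) in
    Y q.1 q.2 / (1 + (q.1 == q.2))%:R).
  have -> : Y = io x; last by apply: memv_img; apply: memvf.
  apply/matrixP => a b; rewrite ioE sym2_to_mxE mxE enum_rankK /=.
  have dK (y : K) : y / (1 + (a == b))%:R *+ (1 + (a == b)) = y.
    by rewrite -[LHS]mulr_natr divfK.
  case: leqP => _ /=; first by rewrite dK.
  by rewrite (eq_sym b) dK -[in RHS]Ysym mxE.
have io_act x : iter k (sym_act e) (io x) = io (dE ^+ k *m x).
  rewrite !ioE; elim: (k) => [|l IH]; first by rewrite expr0 mul1mx.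
  by rewrite iterS IH sym2_to_mx_act exprS -mulmxE mulmxA.
rewrite rank_limg -io_sym.
have -> : (linfun (iter k (sym_act e)) @: (io @: fullv) =
           io @: (linfun (mulmx (dE ^+ k) : 'cV_dS -> 'cV_dS) @: fullv))%VS.
  apply/eqP; rewrite eqEsubv; apply/andP; split; apply/subvP => Y.
    case/memv_imgP => _ /memv_imgP[x _ ->] ->.
    rewrite (linfun_linE linE) io_act -(linfun_linE linM).
    by apply/memv_img/memv_img/memvf.
  case/memv_imgP => _ /memv_imgP[x _ ->] ->.
  rewrite (linfun_linE linM) -io_act -(linfun_linE linE).
  by apply/memv_img/memv_img/memvf.
have cap0 : (linfun (mulmx (dE ^+ k) : 'cV_dS -> 'cV_dS) @: fullv :&: lker io = 0)%VS.
  by rewrite (eqP io0) capv0.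
by rewrite (limg_dim_eq cap0).
Qed.

End SymmetricSquareBasis.

(** * Jordan blocks and commutators *)

Section JordanRank.

Variable K : fieldType.

Lemma mul_mxdiag k (p_ : 'I_k -> nat) (A B : forall i, 'M[K]_(p_ i)) :
  \mxdiag_i A i *m \mxdiag_i B i = \mxdiag_i (A i *m B i).
Proof.
rewrite {2}/mxdiag mul_mxdiag_mxblock /mxdiag; apply/eq_mxblock => i j.
by case: eqVneq => [->|_]; rewrite ?conform_mx_id ?mulmx0.
Qed.

Lemma mxdiagX k (p_ : 'I_k -> nat) (A : forall i, 'M[K]_(p_ i)) m :
  (\mxdiag_i A i) ^+ m = \mxdiag_i (A i ^+ m).
Proof.
elim: m => [|m IH].
  by rewrite expr0 -[LHS](mxdiagZ 1); apply: eq_mxdiag => i; rewrite expr0.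
by rewrite exprS IH -mulmxE mul_mxdiag; apply: eq_mxdiag => i; rewrite exprS.
Qed.

Lemma jordan_blockX d m : jordan_block K d ^+ m = \matrix_(i, j) (i + m == j)%N%:R.
Proof.
elim: m => [|m IH]; apply/matrixP => i j.
  by rewrite expr0 !mxE addn0.
rewrite exprS IH -mulmxE !mxE; have [ltid|leid] := ltnP i.+1 d.
  rewrite (bigD1 (Ordinal ltid)) //= big1 => [|l li].
    by rewrite !mxE /= eqxx mul1r addr0 addSnnS.
  by rewrite !mxE (_ : i.+1 == l = false) ?mul0r //; apply: contraNF li => /eqP il;
    apply/eqP/val_inj.
rewrite big1 => [|l _]; last first.
  by rewrite !mxE (_ : i.+1 == l = false) ?mul0r //; have := ltn_ord l => ?; lia.
by rewrite (_ : (i + m.+1 == j)%N = false) //; have := ltn_ord j => ?; lia.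
Qed.

Lemma rank_jordan_blockX d m : \rank (jordan_block K d ^+ m) = (d - m)%N.
Proof.
rewrite jordan_blockX; apply/eqP; rewrite eqn_leq; apply/andP; split.
  have -> : \matrix_(i, j) (i + m == j)%N%:R =
      (\matrix_(i < d, l < d - m) (i == l :> nat)%:R) *m
      (\matrix_(l < d - m, j < d) (l + m == j)%N%:R) :> 'M[K]_d.
    apply/matrixP => i j; rewrite !mxE; have [lti|lei] := ltnP i (d - m).
      rewrite (bigD1 (Ordinal lti)) //= big1 => [|l li].
        by rewrite !mxE /= eqxx mul1r addr0.
      by rewrite !mxE (_ : i == l :> nat = false) ?mul0r //; apply: contraNF li => /eqP il;
        apply/eqP/val_inj.
    rewrite big1 => [|l _]; last first.
      by rewrite !mxE (_ : i == l :> nat = false) ?mul0r //; have := ltn_ord l => ?; lia.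
    by rewrite (_ : (i + m == j)%N = false) //; have := ltn_ord j => ?; lia.
  by apply: leq_trans (mxrankM_maxl _ _) _; apply: rank_leq_col.
pose C : 'M[K]_(d - m, d) := \matrix_(i, j) (i == j :> nat)%:R.
pose D : 'M[K]_(d, d - m) := \matrix_(i, j) (i == j + m :> nat)%N%:R.
have <- : \rank (C *m (\matrix_(i, j) (i + m == j)%N%:R) *m D) = (d - m)%N.
  rewrite (_ : _ *m _ = 1%:M) ?mxrank1 //; apply/matrixP => i j.
  have lti : (i < d)%N by have := ltn_ord i; lia.
  have ltj : (j + m < d)%N by have := ltn_ord j; lia.
  rewrite !mxE (bigD1 (Ordinal ltj)) //= big1 => [|l lj]; last first.
    rewrite [X in _ * X]mxE (_ : l == (j + m)%N :> nat = false) ?mulr0 //.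
    by apply: contraNF lj => /eqP il; apply/eqP/val_inj.
  rewrite [X in _ * X]mxE /= eqxx mulr1 addr0 mxE (bigD1 (Ordinal lti)) //= big1 => [|l li].
    by rewrite !mxE /= eqxx mul1r addr0 eqn_add2r.
  by rewrite !mxE (_ : i == l :> nat = false) ?mul0r //; apply: contraNF li => /eqP il;
    apply/eqP/val_inj.
by apply: leq_trans (mxrankM_maxl _ _) _; apply: mxrankM_maxr.
Qed.

Lemma jordan_rank N (A : 'M[K]_N) s m : jordan_sizes A s ->
  \rank (A ^+ m) = (\sum_(x <- s) (x - m))%N.
Proof.
move=> [_ [P [Q [PQ QP ->]]]]; set X := jordan_mx K s.
have powE k : (P *m X *m Q) ^+ k = P *m X ^+ k *m Q.
  elim: k => [|k IH]; first by rewrite !expr0 mulmx1.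
  rewrite !exprS IH -!mulmxE !mulmxA -(mulmxA _ Q P) QP mulmx1.
  by [].
have -> : \rank ((P *m X *m Q) ^+ m) = \rank (X ^+ m).
  rewrite powE; apply/eqP; rewrite eqn_leq; apply/andP; split.
    by apply: leq_trans (mxrankM_maxl _ _) _; apply: mxrankM_maxr.
  have {1}-> : X ^+ m = Q *m (P *m X ^+ m *m Q) *m P.
    by rewrite !mulmxA QP mul1mx -mulmxA QP mulmx1.
  by apply: leq_trans (mxrankM_maxl _ _) _; apply: mxrankM_maxr.
rewrite /X /jordan_mx mxdiagX rank_mxdiag (big_nth 0%N) big_mkord.
by apply: eq_bigr => i _; apply: rank_jordan_blockX.
Qed.

(** As a function of [m], the truncated difference [x - m] has second difference 1 at [m = x] and 0
    at the other positive [m]. The identity is written additively to avoid subtraction of ranks. *)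
Lemma jordan_count N (A : 'M[K]_N) s m : jordan_sizes A s -> (0 < m)%N ->
  (count_mem m s + 2 * \rank (A ^+ m) = \rank (A ^+ m.-1) + \rank (A ^+ m.+1))%N.
Proof.
move=> js m0; rewrite !(jordan_rank _ js).
elim: s {js} => [|x s IH]; first by rewrite !big_nil.
rewrite !big_cons /=.
move: (count_mem m s) (\sum_(y <- s) (y - m))%N (\sum_(y <- s) (y - m.-1))%N
  (\sum_(y <- s) (y - m.+1))%N IH => a b c g h.
by case: eqP => [->|ne]; lia.
Qed.

End JordanRank.

Section BlockDiagonal.

Variables (K : fieldType) (n : nat) (e : 'M[K]_n) (d : seq nat).
Hypothesis d_sizes : jordan_sizes e d.

(** The embedding of the product of the block algebras into the matrices of size n. Only its
    algebraic properties are exported, which hides the change of basis and the dependent sizes. *)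
Lemma block_diagonal_embedding :
  exists f : (forall r : 'I_(size d), 'M[K]_(nth 0%N d r)) -> 'M[K]_n,
  [/\ forall b b', f b *m f b' = f (fun r => b r *m b' r),
      forall b b', f b - f b' = f (fun r => b r - b' r),
      f (fun r => 1%:M) = 1%:M,
      forall b, \tr (f b) = \sum_r \tr (b r) &
      e = f (fun r => jordan_block K _) /\
      forall b b', (forall r, b r = b' r) -> f b = f b'].
Proof.
have [_ [P [Q [PQ QP eE]]]] := d_sizes.
exists (fun b => P *m \mxdiag_r b r *m Q); split=> [b b'|b b'||b|].
- by rewrite -mul_mxdiag !mulmxA -(mulmxA _ Q P) QP mulmx1.
- by rewrite mxdiagB mulmxBr mulmxBl.
- by rewrite (mxdiagZ 1) mulmx1.
- by rewrite mxtrace_mulC mulmxA QP mul1mx mxtrace_mxdiag.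
by split=> // b b' bb'; congr (_ *m _ *m _); apply: eq_mxdiag.
Qed.

End BlockDiagonal.

(** * Binomial coefficients modulo p *)

Section BinomialModP.

Variable p : nat.
Hypothesis p_prime : prime p.

(** The product of [c] and ['C(d, c)] is [d] times a binomial coefficient, so p^a divides it; as p^a
    does not divide [c], a factor p must come from ['C(d, c)]. *)
Lemma dvdp_bin a d c : (0 < c < p ^ a)%N -> (p ^ a %| d)%N -> (p %| 'C(d, c))%N.
Proof.
move=> /andP[c0 ltc] qd; apply/negPn/negP => pC.
have cop : coprime (p ^ a) 'C(d, c) by rewrite coprimeXl // prime_coprime.
have : (p ^ a %| c * 'C(d, c))%N.
  case: c c0 {ltc pC cop} => // c _; case: d qd => [|d] qd; first by rewrite bin0n muln0.
  by rewrite -mul_bin_diag dvdn_mulr.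
by rewrite Gauss_dvdl // => /(dvdn_leq c0); rewrite leqNgt ltc.
Qed.

(** In Vandermonde's sum for ['C(p ^ a + k * p ^ a, p ^ a)] only the two extreme terms survive
    modulo p, so each step adds 1. *)
Lemma bin_prime_power a k : 'C(k * p ^ a, p ^ a) = k %[mod p].
Proof.
elim: k => [|k IH]; first by rewrite mul0n bin0n eqn0Ngt expn_gt0 prime_gt0.
have q0 : (0 < p ^ a)%N by rewrite expn_gt0 prime_gt0.
rewrite mulSn -binomial.Vandermonde (bigD1 ord0) //= (bigD1 ord_max) /=; last first.
  by rewrite -(inj_eq val_inj) /= -lt0n.
rewrite subn0 bin0 mul1n binn subnn bin0 muln1 addnA.
have /dvdnP[m ->] : (p %| \sum_(i < (p ^ a).+1 | (i != ord0) && (i != ord_max))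
    'C(p ^ a, i) * 'C(k * p ^ a, p ^ a - i))%N.
  apply: dvdn_sum => i /andP[i0 im]; apply/dvdn_mulr/(@dvdp_bin a) => //.
  rewrite lt0n -(inj_eq val_inj) /= in i0 *.
  rewrite i0 /= ltn_neqAle -ltnS ltn_ord andbT.
  by move: im; rewrite -(inj_eq val_inj).
by rewrite addnC modnMDl -modnDml IH modnDml addn1.
Qed.

End BinomialModP.

Section Commutator.

Variable K : fieldType.

Definition commutator_mx n (e A : 'M[K]_n) : 'M[K]_n := e *m A - A *m e.

(** Let row vectors stand for K[x]/(x^d) with basis x^i. Right multiplication by the Jordan block is
    multiplication by x, and this matrix is the divided derivative [x^i |-> 'C(i, c) x^(i - c)]. *)
Definition hasse_mx d c : 'M[K]_d := \matrix_(i, j) ('C(i, c) * (i == j + c :> nat))%N%:R.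

Lemma comm_hasse_mx d c : 'C(d, c.+1)%:R = 0 :> K ->
  commutator_mx (jordan_block K d) (hasse_mx d c.+1) = hasse_mx d c.
Proof.
move=> C0; apply/matrixP => i j.
have -> : commutator_mx (jordan_block K d) (hasse_mx d c.+1) i j =
    (jordan_block K d *m hasse_mx d c.+1) i j - (hasse_mx d c.+1 *m jordan_block K d) i j.
  by rewrite /commutator_mx !mxE.
have -> : (jordan_block K d *m hasse_mx d c.+1) i j =
    ('C(i.+1, c.+1) * (i.+1 == j + c.+1))%N%:R.
  have [ltid|leid] := ltnP i.+1 d.
    rewrite mxE (bigD1 (Ordinal ltid)) //= big1 => [|l li].
      by rewrite !mxE /= eqxx mul1r addr0.
    by rewrite !mxE (_ : i.+1 == l = false) ?mul0r //; apply: contraNF li => /eqP il;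
      apply/eqP/val_inj.
  (* In the last row x times x^(d-1) is 0, whereas the general formula has the coefficient
     ['C(d, c.+1)]; this is where the hypothesis enters. *)
  have -> : i.+1 = d by apply/eqP; rewrite eqn_leq leid ltn_ord.
  rewrite natrM C0 mul0r mxE big1 // => l _.
  by rewrite !mxE (_ : i.+1 == l = false) ?mul0r //; have := ltn_ord l => ?; lia.
have -> : (hasse_mx d c.+1 *m jordan_block K d) i j =
    ('C(i, c.+1) * (i.+1 == j + c.+1))%N%:R.
  have [j0|j0] := posnP j.
    rewrite mxE big1 => [|l _]; last by rewrite !mxE j0 mulr0.
    by rewrite j0; case: eqP => [[->]|_]; rewrite ?muln0 // bin_small.
  have ltj : (j.-1 < d)%N by have := ltn_ord j; lia.
  rewrite mxE (bigD1 (Ordinal ltj)) //= big1 => [|l li].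
    rewrite !mxE /= prednK // eqxx mulr1 addr0.
    by congr (_ * nat_of_bool _)%N%:R; lia.
  rewrite !mxE (_ : l.+1 == j = false) ?mulr0 //.
  by apply: contraNF li => /eqP il; apply/eqP/val_inj; rewrite /= -il.
rewrite !mxE -natrB ?leq_mul2r ?binS ?leq_addr ?orbT //.
by rewrite -mulnBl addKn addnS eqSS.
Qed.

Lemma hasse_mx0 d : hasse_mx d 0 = 1%:M.
Proof. by apply/matrixP => i j; rewrite !mxE bin0 mul1n addn0. Qed.

Lemma tr_hasse_mx d c : (0 < c)%N -> \tr (hasse_mx d c) = 0.
Proof.
move=> c0; rewrite /mxtrace big1 // => i _; rewrite mxE.
by rewrite -{2}[nat_of_ord i]addn0 eqn_add2l eq_sym gtn_eqF // muln0.
Qed.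

Definition bin_diag_mx d a : 'M[K]_d := diag_mx (\row_i 'C(i, a)%:R).

(** Commutation with the Jordan block takes finite differences along the diagonal. By Pascal's rule
    each step lowers [a] by one, and nothing is left after a + 1 steps. *)
Lemma iter_comm_bin_diag d a m :
  iter m (commutator_mx (jordan_block K d)) (bin_diag_mx d a) =
  (if (m <= a)%N then bin_diag_mx d (a - m) else 0) *m jordan_block K d ^+ m.
Proof.
elim: m => [|m IH]; first by rewrite subn0 expr0 mulmx1.
rewrite iterS IH; have [lt_ma|lt_am|->] := ltngtP m a; last first.
- rewrite mul0mx subnn /commutator_mx.
  have -> : bin_diag_mx d 0 = 1%:M.
    rewrite -diag_const_mx; congr diag_mx; apply/rowP => i.
    by rewrite !mxE bin0.
  by rewrite mul1mx !mulmxE -exprS -exprSr subrr.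
- by rewrite !mul0mx /commutator_mx mulmx0 mul0mx subrr.
rewrite /commutator_mx -(mulmxA _ _ (jordan_block K d)) !mulmxE -exprSr exprS.
rewrite -!mulmxE mulmxA (mulmxA _ (jordan_block K d)) -mulmxBl.
rewrite (mulmxA (bin_diag_mx d (a - m.+1))); congr (_ *m _).
apply/matrixP => i j; rewrite !mxE.
have e1 : (jordan_block K d *m bin_diag_mx d (a - m)) i j = (i.+1 == j)%:R * 'C(j, a - m)%:R.
  by rewrite mul_mx_diag !mxE.
have e2 c : (bin_diag_mx d c *m jordan_block K d) i j = 'C(i, c)%:R * (i.+1 == j)%:R.
  by rewrite mul_diag_mx !mxE.
move: e1 (e2 (a - m)%N) (e2 (a - m.+1)%N); rewrite !mxE => -> -> ->.
rewrite subnS; case: eqP => [<-|_]; last by rewrite mul0r mulr0 subrr mulr0.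
have -> : (a - m = (a - m).-1.+1)%N by rewrite prednK // subn_gt0.
by rewrite /= binS natrD mul1r !mulr1 addrC addKr.
Qed.

Lemma tr_bin_diag d a : \tr (bin_diag_mx d a) = 'C(d, a.+1)%:R.
Proof.
rewrite mxtrace_diag; elim: d => [|d IH]; first by rewrite big_ord0 bin0n.
rewrite big_ord_recr binS natrD /= mxE; congr (_ + _).
by rewrite -IH; apply: eq_bigr => i _; rewrite !mxE.
Qed.

Variables (p : nat) (charK : p \in [pchar K]).
Variables (n : nat) (e : 'M[K]_n) (d : seq nat) (d_sizes : jordan_sizes e d).

(* The divided derivatives of K[x]: on K[x]/(x^m) they are defined when
   p^a divides m. *)
Lemma hasse_derivatives a : all (dvdn (p ^ a)) d ->
  exists D : nat -> 'M[K]_n, [/\ D 0%N = 1%:M,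
    forall c, (c.+1 < p ^ a)%N -> commutator_mx e (D c.+1) = D c &
    forall c, (0 < c)%N -> \tr (D c) = 0].
Proof.
move=> qd; have [f [fM fB f1 ftr [fe fext]]] := block_diagonal_embedding d_sizes.
exists (fun c => f (fun r => hasse_mx _ c)); split=> [|c ltc|c c0].
- by rewrite -f1; apply: fext => r; apply: hasse_mx0.
- rewrite /commutator_mx fe !fM fB; apply: fext => r; apply: comm_hasse_mx.
  apply/eqP; rewrite -(dvdn_pcharf charK).
  apply: (@dvdp_bin _ (pcharf_prime charK) a) => //.
  by move/allP: qd; apply; apply: mem_nth.
by rewrite ftr big1 // => r _; apply: tr_hasse_mx.
Qed.

(** With q = p^a, the diagonal matrix of the ['C(i, q - 1)] on one block of size x is killed by q
    commutators. Its trace is ['C(x, q)], which is x / q modulo p. *)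
Lemma truncated_bin_diag a x : x \in d -> (p ^ a %| x)%N -> ~~ (p ^ a.+1 %| x)%N ->
  exists B : 'M[K]_n, iter (p ^ a) (commutator_mx e) B = 0 /\ \tr B != 0.
Proof.
move=> xd qx nqx; have p_prime := pcharf_prime charK.
have [f [fM fB f1 ftr [fe fext]]] := block_diagonal_embedding d_sizes.
have ltr : (index x d < size d)%N by rewrite index_mem.
pose r0 := Ordinal ltr.
have f0 : f (fun r => 0) = 0.
  by rewrite -(subrr (f (fun r => 0))) fB; apply: fext => r; rewrite subrr.
pose b (r : 'I_(size d)) : 'M[K]_(nth 0%N d r) :=
  if r == r0 then bin_diag_mx _ (p ^ a).-1 else 0.
have q0 : (0 < p ^ a)%N by rewrite expn_gt0 prime_gt0.
exists (f b); split.
  have iterE m : iter m (commutator_mx e) (f b) =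
      f (fun r => iter m (commutator_mx (jordan_block K _)) (b r)).
    elim: m => [|m IH] //; rewrite iterS IH /commutator_mx fe !fM fB.
    by apply: fext.
  rewrite iterE -f0; apply: fext => r; rewrite /b; case: eqP => _.
    by rewrite iter_comm_bin_diag leqNgt ltn_predL q0 mul0mx.
  elim: (p ^ a)%N => //= m ->; by rewrite /commutator_mx mulmx0 mul0mx subrr.
rewrite ftr (bigD1 r0) //= big1 ?addr0 => [|r /negPf nr]; last first.
  by rewrite /b nr mxtrace0.
rewrite /b eqxx tr_bin_diag prednK // -(dvdn_pcharf charK) nth_index //.
have /dvdnP[k xE] := qx; rewrite xE /dvdn bin_prime_power // -/(dvdn p k).
by apply: contra nqx => pk; rewrite xE expnS dvdn_mul.
Qed.

End Commutator.

(** * The nilpotent action on symmetric matrices *)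

Section SelfAdjoint.

Variables (K : fieldType) (n : nat) (J e : 'M[K]_n).
Hypotheses (J_sym : J^T = J) (J_unit : J \in unitmx).
Hypothesis e_skew : e^T *m J + J *m e = 0.
Hypothesis two_neq0 : 2%:R != 0 :> K.

Local Notation Ji := (invmx J).
Local Notation E := (sym_act e).
Local Notation Sym := (sym_space K n).
Local Notation S0 := (traceless_space J).

Lemma invJ_sym : Ji^T = Ji.
Proof. by rewrite trmx_inv J_sym. Qed.

Lemma e_skewE : e^T *m J = - (J *m e).
Proof. by apply/eqP; rewrite -addr_eq0 e_skew. Qed.

(* Right multiplication by J turns symmetric matrices into self-adjoint ones,
   and the action of e into the commutator with e. *)
Lemma sym_act_comm A : E (A *m Ji) = commutator_mx e A *m Ji.
Proof.
have -> : E (A *m Ji) = (e *m A *m Ji + A *m (Ji *m (e^T *m J)) *m Ji).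
  by rewrite /sym_act !mulmxA mulmxK.
by rewrite e_skewE mulmxN mulKmx // mulmxN mulNmx /commutator_mx mulmxBl.
Qed.

Lemma iter_sym_act_comm A m : iter m E (A *m Ji) = iter m (commutator_mx e) A *m Ji.
Proof. by elim: m => //= m ->; apply: sym_act_comm. Qed.

Lemma sym_act_tr Y : (E Y)^T = E Y^T.
Proof. by rewrite /sym_act linearD /= !trmx_mul trmxK addrC. Qed.

Lemma iter_sym_act_tr Y m : (iter m E Y)^T = iter m E Y^T.
Proof. by elim: m => //= m IH; rewrite sym_act_tr IH. Qed.

(** [E] commutes with transposition and tr(YJ) is invariant under it, so witnesses built from
    arbitrary endomorphisms can be symmetrized without loss. *)
Definition sym_part (Y : 'M[K]_n) : 'M[K]_n := 2%:R^-1 *: (Y + Y^T).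

Lemma sym_part_sym Y : sym_part Y \in Sym.
Proof. by apply/sym_spaceP; rewrite linearZ linearD /= trmxK addrC. Qed.

Lemma sym_part_id Y : Y^T = Y -> sym_part Y = Y.
Proof. by move=> Ys; rewrite /sym_part Ys -mulr2n -scaler_nat scalerK. Qed.

Lemma iter_sym_part Y m : iter m E (sym_part Y) = sym_part (iter m E Y).
Proof.
have lin := iter_linear m (@sym_act_linear K n e).
rewrite /sym_part iter_sym_act_tr -!(linfun_linE lin).
by rewrite linearZ linearD.
Qed.

Lemma tr_sym_part Y : \tr (sym_part Y *m J) = \tr (Y *m J).
Proof.
rewrite /sym_part -scalemxAl mulmxDl mxtraceZ mxtraceD.
have -> : \tr (Y^T *m J) = \tr (Y *m J).
  by rewrite -mxtrace_tr trmx_mul trmxK J_sym mxtrace_mulC.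
by move: (\tr _) => t; field.
Qed.

Lemma iter_sym_act_sym Y m : Y \in Sym -> iter m E Y \in Sym.
Proof.
by move=> /sym_spaceP Ys; apply/sym_spaceP; rewrite iter_sym_act_tr Ys.
Qed.

(** The trace form of the endomorphisms XJ and YJ, for which [ad e] is skew. Within the symmetric
    matrices, S0 is the orthogonal of J^-1. *)
Definition pairing (X Y : 'M[K]_n) : K := \tr (X *m J *m Y *m J).

Lemma pairing_act X Y : pairing (E X) Y = - pairing X (E Y).
Proof.
apply/eqP; rewrite -addr_eq0; apply/eqP; rewrite /pairing /sym_act.
rewrite !mulmxDl mulmxDr !mulmxDl !mxtraceD.
have -> : \tr (X *m e^T *m J *m Y *m J) = - \tr (X *m J *m (e *m Y) *m J).
  by rewrite -(mulmxA X) e_skewE mulmxN !mulNmx raddfN /= !mulmxA.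
have -> : \tr (X *m J *m (Y *m e^T) *m J) = - \tr (e *m X *m J *m Y *m J).
  rewrite -!mulmxA e_skewE !mulmxN raddfN /= !mulmxA.
  by rewrite mxtrace_mulC !mulmxA.
by rewrite addrA subrK subrr.
Qed.

Lemma pairing_iter X Y m : pairing (iter m E X) Y = (-1) ^+ m * pairing X (iter m E Y).
Proof.
elim: m Y => [|m IH] Y; first by rewrite mul1r.
rewrite iterS pairing_act IH -iterSr exprS.
by rewrite mulN1r mulNr.
Qed.

Lemma pairing_invJ X : pairing X Ji = \tr (X *m J).
Proof. by rewrite /pairing mulmxK. Qed.

Lemma pairing_invJl X : pairing Ji X = \tr (X *m J).
Proof. by rewrite /pairing mulVmx // mul1mx. Qed.

Local Notation Ek k := (linfun (iter k E)).

Lemma EkE k : Ek k =1 iter k E.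
Proof. exact/linfun_linE/iter_linear/sym_act_linear. Qed.

Lemma traceless_sub : (S0 <= Sym)%VS.
Proof. exact: capvSl. Qed.

Lemma tr_sym_act Y : \tr (E Y *m J) = 0.
Proof.
rewrite -pairing_invJ pairing_act.
have -> : E Ji = 0.
  by rewrite -[Ji]mul1mx sym_act_comm /commutator_mx mulmx1 mul1mx subrr mul0mx.
by rewrite /pairing mulmx0 mul0mx mxtrace0 oppr0.
Qed.

Lemma iter_traceless Y m : Y \in S0 -> iter m E Y \in S0.
Proof.
move=> YS; elim: m => //= m /traceless_spaceP[Ys _]; apply/traceless_spaceP.
by rewrite sym_act_tr Ys tr_sym_act.
Qed.

(** A multiple of [B] corrects the trace of any symmetric matrix without changing its image. *)
Lemma dim_traceless_eq k B : B \in Sym -> \tr (B *m J) != 0 -> iter k E B = 0 ->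
  \dim (Ek k @: S0) = \dim (Ek k @: Sym).
Proof.
move=> BS trB EB; congr (\dim _); apply/eqP; rewrite eqEsubv limgS ?traceless_sub //.
apply/subvP => _ /memv_imgP[Y /sym_spaceP Ys ->].
pose c := \tr (Y *m J) / \tr (B *m J).
have -> : Ek k Y = Ek k (Y - c *: B) by rewrite linearB linearZ /= (EkE k B) EB scaler0 subr0.
apply/memv_img/traceless_spaceP; move/sym_spaceP: BS => Bs.
split; first by rewrite linearB linearZ /= Ys Bs.
by rewrite mulmxBl -scalemxAl raddfB /= mxtraceZ /c divfK // subrr.
Qed.

(** The restrictions to Sym and S0 have the same kernel, so the images differ in dimension by as
    much as the spaces; [B] shows that S0 is a proper subspace. *)
Lemma dim_traceless_lt k B : B \in Sym -> \tr (B *m J) != 0 ->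
    (forall C, C \in Sym -> iter k E C = 0 -> \tr (C *m J) = 0) ->
  (\dim (Ek k @: S0) + 1 = \dim (Ek k @: Sym))%N.
Proof.
move=> BS trB kerP.
have lin : linear (fun Y : 'M[K]_n => \tr (Y *m J) : K^o).
  by move=> a X Z; rewrite mulmxDl -scalemxAl linearP.
pose ta := linfun (fun Y : 'M[K]_n => \tr (Y *m J) : K^o).
have taE : ta =1 (fun Y : 'M[K]_n => \tr (Y *m J) : K^o) := linfun_linE lin.
have dimSym : \dim Sym = (\dim S0 + 1)%N.
  rewrite -(limg_ker_dim ta Sym); congr (_ + _)%N.
  have -> : (ta @: Sym = <[ta B]>)%VS.
    apply/eqP; rewrite eqEsubv; apply/andP; split; last by rewrite -memvE memv_img.
    apply/subvP => _ /memv_imgP[Y _ ->]; apply/vlineP; exists (ta Y / ta B).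
    by rewrite -[_ *: _]/(_ * _) divfK // taE.
  by rewrite dim_vline taE trB.
have ker_eq : (Sym :&: lker (Ek k) = S0 :&: lker (Ek k))%VS.
  apply/eqP; rewrite eqEsubv (capvS traceless_sub (subvv _)) andbT.
  apply/subvP => Y /memv_capP[YS]; rewrite memv_ker EkE => /eqP EY.
  apply/memv_capP; split; last by rewrite memv_ker EkE EY.
  by apply/traceless_spaceP; split; [apply/sym_spaceP | apply: kerP].
have := limg_ker_dim (Ek k) Sym; have := limg_ker_dim (Ek k) S0.
by rewrite ker_eq dimSym => <-; rewrite -addnA => /addnI->.
Qed.

(** The number of blocks of size k is the drop in dimension from [ker E :&: im E^(k-1)] to
    [ker E :&: im E^k]. If ker E^k lies in im E, these two spaces coincide. *)
Lemma count_no_blocks k : (0 < k)%N ->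
    (forall Y, Y \in Sym -> iter k E Y = 0 -> exists2 Y', Y' \in Sym & E Y' = Y) ->
  (\dim (Ek k.-1 @: Sym) + \dim (Ek k.+1 @: Sym) = 2 * \dim (Ek k @: Sym))%N.
Proof.
case: k => // k _ kerP; rewrite /=.
pose E1 := linfun E; have E1E : E1 =1 E := linfun_linE (@sym_act_linear K n e).
have step m : (Ek m.+1 @: Sym = E1 @: (Ek m @: Sym))%VS.
  apply/eqP; rewrite eqEsubv; apply/andP; split; apply/subvP => Y.
    case/memv_imgP=> X XS ->; rewrite EkE iterS -EkE -E1E.
    by apply/memv_img/memv_img.
  case/memv_imgP=> _ /memv_imgP[X XS ->] ->.
  by rewrite E1E EkE -iterS -EkE; apply/memv_img.
have := limg_ker_dim E1 (Ek k @: Sym); have := limg_ker_dim E1 (Ek k.+1 @: Sym).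
rewrite -!step.
suff -> : (Ek k @: Sym :&: lker E1 = Ek k.+1 @: Sym :&: lker E1)%VS by clear; lia.
apply/eqP; rewrite eqEsubv; apply/andP; split; apply/subvP => Y;
  rewrite !memv_cap => /andP[/memv_imgP[X XS YE] Yker]; rewrite Yker andbT.
  move: Yker; rewrite memv_ker E1E YE EkE -iterS => /eqP EX.
  have [Y' Y'S <-] := kerP X XS EX.
  by rewrite -iterSr -EkE; apply: memv_img.
rewrite YE EkE iterSr -EkE; apply: memv_img.
by rewrite -[E X]/(iter 1 E X); apply: iter_sym_act_sym.
Qed.

End SelfAdjoint.

Section Witnesses.

Variables (K : fieldType) (n : nat) (J e : 'M[K]_n).
Hypotheses (J_sym : J^T = J) (J_unit : J \in unitmx).
Hypothesis e_skew : e^T *m J + J *m e = 0.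
Hypothesis two_neq0 : 2%:R != 0 :> K.
Variables (p : nat) (charK : p \in [pchar K]).
Variables (d : seq nat) (d_sizes : jordan_sizes e d).
Variable a : nat.
Hypothesis qd : all (dvdn (p ^ a)) d.

Local Notation Ji := (invmx J).
Local Notation E := (sym_act e).
Local Notation Sym := (sym_space K n).
Local Notation S0 := (traceless_space J).
Local Notation q := (p ^ a)%N.

Let q_gt0 : (0 < q)%N.
Proof. by rewrite expn_gt0 prime_gt0 // (pcharf_prime charK). Qed.

Lemma gram_inv_witness : (p %| n)%N ->
  exists2 Y, Y \in S0 & iter q.-1 E Y = Ji.
Proof.
move=> pn; have [D [D0 DD trD]] := hasse_derivatives charK d_sizes qd.
exists (sym_part (D q.-1 *m Ji)).
  apply/traceless_spaceP; split; first exact/sym_spaceP/sym_part_sym.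
  (* For q = 1 the witness is J^-1 itself, traceless because p divides n; otherwise the divided
     derivative of positive order has trace 0. *)
  rewrite tr_sym_part // mulmxKV //; have [q1|q1] := posnP q.-1; last exact: trD.
  by rewrite q1 D0 mxtrace1; apply/eqP; rewrite -(dvdn_pcharf charK).
have iterD m c : (m + c < q)%N -> iter m (commutator_mx e) (D (m + c)%N) = D c.
  elim: m c => [|m IH] c ltq //; rewrite iterS addSnnS IH ?addnS -?addSn //.
  by apply: DD; apply: leq_ltn_trans ltq; rewrite addSn ltnS leq_addl.
rewrite iter_sym_part // (iter_sym_act_comm J_unit e_skew) -[in D _](addn0 q.-1).
rewrite iterD ?addn0 ?ltn_predL // D0 mul1mx.
by rewrite sym_part_id // invJ_sym.
Qed.

Lemma trace_witness x : x \in d -> ~~ (p ^ a.+1 %| x)%N ->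
  exists B, [/\ B \in Sym, iter q E B = 0 & \tr (B *m J) != 0].
Proof.
move=> xd nqx; have qx := allP qd x xd.
have [B [EB trB]] := truncated_bin_diag charK d_sizes xd qx nqx.
exists (sym_part (B *m Ji)); split; first exact: sym_part_sym.
  rewrite iter_sym_part // (iter_sym_act_comm J_unit e_skew) EB mul0mx.
  by rewrite /sym_part trmx0 addr0 scaler0.
by rewrite tr_sym_part // mulmxKV.
Qed.

(* [sum_c (-1)^c D_(c+1) E^c Y], for c < q - 1, is a telescoping preimage
   of Y. *)
Lemma kernel_in_image Y : Y \in Sym -> iter q.-1 E Y = 0 ->
  exists2 Y', Y' \in Sym & E Y' = Y.
Proof.
move=> /sym_spaceP Ys EY; have [D [D0 DD _]] := hasse_derivatives charK d_sizes qd.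
have ED X c : (c.+1 < q)%N -> E (D c.+1 *m X) = D c *m X + D c.+1 *m E X.
  move=> ltc; rewrite -(DD c ltc) /commutator_mx /sym_act mulmxBl mulmxDr !mulmxA addrA subrK.
  by [].
pose W m := \sum_(c < m) (-1) ^+ c *: (D c.+1 *m iter c E Y).
have lin := @sym_act_linear K n e.
have EW m : (m < q)%N -> E (W m) = Y - (-1) ^+ m *: (D m *m iter m E Y).
  elim: m => [|m IH] ltm.
    by rewrite /W big_ord0 D0 mul1mx expr0 scale1r subrr /sym_act mulmx0 mul0mx addr0.
  rewrite /W big_ord_recr /= -/(W m) -(linfun_linE lin) linearD linearZ /=.
  rewrite !(linfun_linE lin) IH ?(ltnW ltm) // ED // scalerDr addrA subrK.
  by rewrite exprS mulN1r scaleNr opprK.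
exists (sym_part (W q.-1)); first exact: sym_part_sym.
rewrite -[E _]/(iter 1 E _) iter_sym_part //= EW ?ltn_predL // EY mulmx0 scaler0 subr0.
exact: sym_part_id.
Qed.

Local Notation Ek k := (linfun (iter k E)).

Lemma iter_sym_act0 m : iter m E 0 = 0.
Proof.
have lin := iter_linear m (@sym_act_linear K n e).
by rewrite -(linfun_linE lin) linear0.
Qed.

Section Divides.

Hypothesis pn : (p %| n)%N.
Variables (x : nat) (xd : x \in d) (nqx : ~~ (p ^ a.+1 %| x)%N).

(** Let E^(q-1) Y = J^-1. Then J^-1 is the image under E^k of E^(q-1-k) Y. If E^k C = 0, then tr(CJ)
    is the pairing of C with E^(q-1) Y, which up to sign is that of E^(q-1) C = 0 with Y. *)
Lemma dim_act_lt k : (k < q)%N ->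
  (\dim (Ek k @: S0) + 1 = \dim (Ek k @: Sym))%N /\ Ji \in (Ek k @: S0)%VS.
Proof.
move=> ltkq; have [Y YS EY] := gram_inv_witness pn.
have [B [BS EB trB]] := trace_witness xd nqx.
have kq : (k <= q.-1)%N by rewrite -ltnS prednK.
split; last first.
  rewrite -EY -{1}(subnKC kq) iterD -(EkE e k); apply: memv_img.
  exact: iter_traceless.
apply: (dim_traceless_lt BS trB) => C CS EC.
have e0 : iter q.-1 E C = 0 by rewrite -(subnK kq) iterD EC iter_sym_act0.
rewrite -(pairing_invJ J_unit) -EY; apply: (mulfI (negbT (signr_eq0 K q.-1))).
by rewrite -(pairing_iter e_skew) e0 /pairing !mul0mx mxtrace0 mulr0.
Qed.

(** The witness [B] of nonzero trace is killed by E^k. If J^-1 were E^k C, its pairing with [B],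
    which is tr(BJ), would be up to sign the pairing of C with E^k B = 0. *)
Lemma dim_act_ge k : (q <= k)%N ->
  \dim (Ek k @: S0) = \dim (Ek k @: Sym) /\ Ji \notin (Ek k @: S0)%VS.
Proof.
move=> leqk; have [B [BS EB trB]] := trace_witness xd nqx.
have EkB : iter k E B = 0 by rewrite -(subnK leqk) iterD EB iter_sym_act0.
split; first exact: dim_traceless_eq EkB.
apply: contra trB => /memv_imgP[C _]; rewrite EkE => JE.
rewrite -(pairing_invJl J_unit) JE (pairing_iter e_skew) EkB.
by rewrite /pairing mulmx0 mul0mx mxtrace0 mulr0.
Qed.

End Divides.

(** J^-1 spans a complement of S0 because its trace is n, and [E] kills it; so it contributes to the
    rank for k = 0 only. *)
Lemma dim_act_ndvd k : ~~ (p %| n)%N ->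
  (\dim (Ek k @: S0) + (k == 0) = \dim (Ek k @: Sym))%N /\ Ji \notin (Ek k @: S0)%VS.
Proof.
move=> npn.
have trJ : \tr (Ji *m J) != 0.
  by rewrite mulVmx // mxtrace1 -(dvdn_pcharf charK).
have JiS : Ji \in Sym by apply/sym_spaceP/invJ_sym.
split; last first.
  apply: contra trJ => /memv_imgP[C CS]; rewrite EkE => JE.
  by have /(iter_traceless J_unit e_skew k) := CS; rewrite -JE => /traceless_spaceP[_ ->].
case: k => [|k] /=; last first.
  rewrite addn0; apply: (dim_traceless_eq JiS trJ); rewrite iterSr.
  have -> : E Ji = 0; last exact: iter_sym_act0.
  by rewrite -[Ji]mul1mx (sym_act_comm J_unit e_skew) /commutator_mx mulmx1 mul1mx subrr mul0mx.
by apply: (dim_traceless_lt JiS trJ) => C _ /= ->; rewrite mul0mx mxtrace0.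
Qed.

End Witnesses.

(** Derivative at the identity of [X^T J X - J], whose entries vanish on SO(Q). *)
Lemma lie_SO_skew (K : fieldType) n (Q : 'cV[K]_n -> K) (e : 'M[K]_n) :
    quadratic_form Q -> 2%:R != 0 :> K -> lie_algebra (SO Q) e ->
  e^T *m gram Q + gram Q *m e = 0.
Proof.
move=> quadQ two_neq0 e_lie; pose X := generic_mx n K.
have evX : ev_mx X = 1%:M by apply: eval_generic.
have evXT : ev_mx X^T = 1%:M by rewrite /ev_mx -map_trmx -/(ev_mx X) evX trmx1.
have dvXT : dv_mx e X^T = e^T by rewrite /dv_mx -map_trmx -/(dv_mx e X) dv_generic.
have := @dv_mx_vanish _ _ _ _ e_lie _ _
  (X^T *m map_mx (@mpolyC _ _) (gram Q) *m X + map_mx (@mpolyC _ _) (- gram Q)).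
rewrite dv_mxD !dv_mxM !dv_mxC ev_mxM !ev_mxC evX evXT dvXT dv_generic.
rewrite mulmx0 mulmx1 mul1mx !addr0; apply=> g /(SOP quadQ two_neq0)[gI _].
rewrite eval_mxD !eval_mxM !eval_mxC -map_trmx eval_generic gI.
by rewrite subrr.
Qed.

Lemma dvdn_biggcd_seq m (s : seq nat) :
  (m %| \big[gcdn/0%N]_(x <- s) x)%N = all (dvdn m) s.
Proof.
elim: s => [|x s IH]; first by rewrite big_nil dvdn0.
by rewrite big_cons dvdn_gcd IH.
Qed.

Section WittHyperbolic.

Variables (K : fieldType) (n : nat) (Q : 'cV[K]_n -> K) (P : 'M[K]_n).
Hypotheses (quadQ : quadratic_form Q) (two_neq0 : 2%:R != 0 :> K).
Hypothesis wittP : witt_basis Q P.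

Lemma witt_hyperbolic (i j : 'I_n) : i = 0 :> nat -> j = n.-1 :> nat -> (5 <= n)%N ->
  exists z, hyperbolic_triple Q (col i P) (col j P) z.
Proof.
move=> i0 jn n5; have lt1 : (1 < n)%N by lia.
have lt2 : (n - 2 < n)%N by lia.
(* [w_1 + w_(n-2)]: a second hyperbolic pair, orthogonal to [w_0] and [w_(n-1)]. *)
exists (col (Ordinal lt1) P + col (Ordinal lt2) P).
have Q0 (k : 'I_n) : (k + k != n.-1)%N -> Q (col k P) = 0.
  by move=> kk; rewrite (quadE quadQ two_neq0) wittP (negPf kk) mulr0.
split.
- by apply: Q0; rewrite i0; lia.
- by apply: Q0; rewrite jn; lia.
- by rewrite wittP i0 jn eqxx.
- rewrite (quadD Q) !Q0 /= ?wittP /= ?add0r; try by lia.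
  by rewrite (_ : (1 + (n - 2) == n.-1)%N) ?oner_neq0 //; lia.
split; rewrite (polarDl quadQ) !wittP /= ?i0 ?jn.
  have -> : (1 + 0 == n.-1)%N = false by lia.
  have -> : (n - 2 + 0 == n.-1)%N = false by lia.
  by rewrite addr0.
have -> : (1 + n.-1 == n.-1)%N = false by lia.
have -> : (n - 2 + n.-1 == n.-1)%N = false by lia.
by rewrite addr0.
Qed.

(** [w_(n-1)] is dual to [w_0], so pairing with it reads off the coefficient of [w_0]. *)
Lemma witt_corner (i j : 'I_n) g : i = 0 :> nat -> j = n.-1 :> nat ->
  (invmx P *m g *m P) i i = polar Q (col j P) (g *m col i P).
Proof.
move=> i0 jn; have uP := witt_unit quadQ wittP.
have rj : rev_ord j = i by apply: val_inj; rewrite /= i0 jn; have := ltn_ord i; lia.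
set X := invmx P *m g *m P.
have e : antidiag K n *m X = P^T *m gram Q *m g *m P.
  by rewrite -(witt_gram quadQ wittP) !mulmxA mulmxK.
rewrite -{1}rj -mul_antidiag e -[LHS]mx_deltaE (polarE quadQ) !colE trmx_mul.
by rewrite !mulmxA.
Qed.

End WittHyperbolic.

Theorem corollary1p5
  (K : closedFieldType) (p : nat) (charK : p \in [pchar K]) (p_gt2 : (2 < p)%N)
  (n : nat) (n_ge5 : (5 <= n)%N)
  (Q : 'cV[K]_n -> K) (quadQ : quadratic_form Q) (nondegQ : nondegenerate_form Q)
  (P : 'M[K]_n) (wittP : witt_basis Q P)
  (e : 'M[K]_n) (e_lie : lie_algebra (SO Q) e) (e_nil : nilpotent_elt (SO Q) e)
  (d : seq nat) (d_sizes : jordan_sizes e d)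
  (varpi1 : weight n) (varpi1P : fundamental_weight 1 varpi1)
  (N : nat) (L : ratrep (SO Q) N) (LP : is_L P L (varpi1 *+ 2))
  (s0 : seq nat) (s0P : jordan_sizes (rep_diff (sym2_rep (SO Q)) e) s0)
  (s2 : seq nat) (s2P : jordan_sizes (rep_diff L e) s2) :
  let alpha := logn p (\big[gcdn/0%N]_(x <- d) x) in
  let r0 m := count_mem m s0 in
  let r2 m := count_mem m s2 in
  [/\ ~~ (p %| n)%N ->
        (r2 1 + 1 = r0 1)%N /\
        (forall m, (1 <= m)%N -> m != 1%N -> r2 m = r0 m),
      (p %| n)%N -> alpha = 0%N ->
        (r2 1 + 2 = r0 1)%N /\
        (forall m, (1 <= m)%N -> m != 1%N -> r2 m = r0 m)
    & (p %| n)%N -> (0 < alpha)%N ->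
        [/\ (r2 (p ^ alpha) + 2 = r0 (p ^ alpha))%N,
            r2 (p ^ alpha - 1)%N = 2%N
          & forall m, (1 <= m)%N -> m != (p ^ alpha)%N ->
              m != (p ^ alpha - 1)%N -> r2 m = r0 m]].
Proof.
move=> alpha r0 r2.
have p_prime := pcharf_prime charK.
have two_neq0 : 2%:R != 0 :> K.
  by rewrite -(dvdn_pcharf charK) gtnNdvd.
have infK := closed_infinite (K := K).
have n_gt0 : (0 < n)%N by apply: leq_trans n_ge5.
pose i0 : 'I_n := Ordinal n_gt0.
have lt_n1 : (n.-1 < n)%N by rewrite ltn_predL.
pose j0 : 'I_n := Ordinal lt_n1.
have [z hyp] := witt_hyperbolic quadQ two_neq0 wittP (i := i0) (j := j0) erefl erefl n_ge5.
have J_sym := gram_tr Q.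
have J_unit : gram Q \in unitmx.
  have : antidiag K n \in unitmx.
    rewrite unitmxE unitfE; apply: contraNneq (oner_neq0 K) => d0.
    by rewrite -(@det1 _ n) -antidiagK det_mulmx d0 mul0r.
  by rewrite -(witt_gram quadQ wittP) !unitmx_mul => /andP[/andP[]].
have e_skew := lie_SO_skew quadQ two_neq0 e_lie.
have [irrL hwL] := LP.
have [phi [v coefL]] := irreducible_coef quadQ two_neq0 wittP infK n_ge5 varpi1P hwL (i0 := i0) erefl.
have {}coefL g : SO Q g ->
    phi *m rep_act L g *m v = (polar Q (col j0 P) (g *m col i0 P) ^+ 2)%:M.
  by move=> gSO; rewrite coefL // (witt_corner quadQ two_neq0 wittP g (j := j0)).
have [M MP] := graph_exists (col i0 P) L v.
have rkL := rank_rep_diff quadQ two_neq0 infK J_unit hyp irrL coefL e_lie MP.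
have rk0 := rank_sym2_diff (SO Q) e two_neq0.
have cnt2 m := jordan_count s2P (m := m).
have cnt0 m := jordan_count s0P (m := m).
(* The gcd of an empty list would be 0, where [logn] takes the default value 0. As n > 0 there is a
   block, and [alpha] is a genuine valuation. *)
have gcd_gt0 : (0 < \big[gcdn/0%N]_(x <- d) x)%N.
  have := jordan_rank 0 d_sizes; rewrite expr0 mxrank1.
  have [/allP d_gt0 _] := d_sizes; case: (d) d_gt0 => [|y d'] d_gt0.
    by rewrite big_nil => n0; have := n_gt0; rewrite lt0n n0.
  by move=> _; rewrite big_cons gcdn_gt0 d_gt0 ?mem_head.
set q := (p ^ alpha)%N.
have qd : all (dvdn q) d by rewrite -dvdn_biggcd_seq pfactor_dvdnn.
have [x xd nqx] : exists2 x, x \in d & ~~ (p ^ alpha.+1 %| x)%N.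
  apply/allPn; rewrite -dvdn_biggcd_seq pfactor_dvdn // -/alpha.
  by rewrite ltnn.
pose RL k := \rank (rep_diff L e ^+ k).
pose R0 k := \rank (rep_diff (sym2_rep (SO Q)) e ^+ k).
have {}cnt2 m : (0 < m)%N -> (r2 m + 2 * RL m = RL m.-1 + RL m.+1)%N by apply: cnt2.
have {}cnt0 m : (0 < m)%N -> (r0 m + 2 * R0 m = R0 m.-1 + R0 m.+1)%N by apply: cnt0.
have Rlt (pn : (p %| n)%N) k : (k < q)%N -> (RL k + 2 = R0 k)%N.
  move=> ltkq.
  have [dimE JE] := dim_act_lt J_sym J_unit e_skew two_neq0 charK d_sizes qd pn xd nqx ltkq.
  by have := rkL k; rewrite JE /R0 rk0 -dimE => <-; rewrite -addnA.
have Rge (pn : (p %| n)%N) k : (q <= k)%N -> RL k = R0 k.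
  move=> leqk.
  have [dimE JE] := dim_act_ge J_sym J_unit e_skew two_neq0 charK d_sizes qd xd nqx leqk.
  by have := rkL k; rewrite (negPf JE) addn0 /R0 rk0 -dimE.
(* If p divides n, [RL] minus [R0] is -2 below q and 0 from q on; its second difference is 2 at q -
   1 and -2 at q. For q = 1 only the latter is a block size. If p does not divide n, the difference
   is -1 at k = 0 and 0 elsewhere. *)
split=> [npn|pn al0|pn al_gt0].
- have RE k : (RL k + (k == 0%N) = R0 k)%N.
    have [dimE JE] := dim_act_ndvd J_sym J_unit e_skew charK k npn.
    by have := rkL k; rewrite (negPf JE) addn0 /RL /R0 rk0 -dimE => ->.
  have RE' k : (0 < k)%N -> RL k = R0 k by case: k => // k _; rewrite -RE addn0.
  split=> [|m m_gt0 m1].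
    by have := cnt2 1%N isT; have := cnt0 1%N isT; rewrite /= -!RE; lia.
  have m1' : (0 < m.-1)%N by lia.
  by have := cnt2 m m_gt0; have := cnt0 m m_gt0; rewrite /= !RE' //; lia.
- have q1 : q = 1%N by rewrite /q al0.
  rewrite q1 in Rlt Rge; have {}Rlt := Rlt pn; have {}Rge := Rge pn.
  split=> [|m m_gt0 m1].
    have := cnt2 1%N isT; have := cnt0 1%N isT.
    by rewrite /= -(Rlt 0%N) // !(Rge _.+1) //; lia.
  have m1' : (0 < m.-1)%N by lia.
  by have := cnt2 m m_gt0; have := cnt0 m m_gt0; rewrite /= !Rge //; lia.
have {}Rlt := Rlt pn; have {}Rge := Rge pn.
have q_gt2 : (2 < q)%N.
  by apply: leq_trans p_gt2 _; rewrite -{1}(expn1 p) leq_exp2l // prime_gt1.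
(* The second difference only gives an increase by 2 at q - 1, whereas the claim is that [r2] equals
   2 there. *)
have r0_0 : r0 q.-1 = 0%N.
  have q1_gt0 : (0 < q.-1)%N by lia.
  have := cnt0 q.-1 q1_gt0; rewrite /R0 !rk0.
  have := count_no_blocks q1_gt0
    (kernel_in_image two_neq0 charK d_sizes qd).
  lia.
split=> [||m m_gt0 mq mq1].
- have q0 : (0 < q)%N by lia.
  have := cnt2 q q0; have := cnt0 q q0.
  rewrite !(Rge q) ?(Rge q.+1) -?(Rlt q.-1) //; lia.
- have q0 : (0 < q.-1)%N by lia.
  rewrite subn1; have := cnt2 q.-1 q0; have := cnt0 q.-1 q0; rewrite r0_0.
  have q1 : q.-1.+1 = q by lia.
  rewrite q1 (Rge q) // -(Rlt q.-1) -?(Rlt q.-1.-1); lia.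
have := cnt2 m m_gt0; have := cnt0 m m_gt0.
have [ltmq|leqm] := ltnP m q.
  have h1 : (m.+1 < q)%N by lia.
  rewrite -!Rlt //; lia.
have h1 : (q <= m.-1)%N by lia.
have h2 : (q <= m.+1)%N by lia.
by rewrite !Rge //; lia.
Qed.
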